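(* Let $d\ge2$, $1\le k\le d-1$, and let $\Sigma\subset\mathbb{T}^d$ be a totally geodesic submanifold of dimension $k$ which is determined by linear equations with rational coefficients. Then for every $\lambda>1$ and every eigenfunction $e_\lambda$ on $\mathbb{T}^d$ with $-\Delta e_\lambda=\lambda^2e_\lambda$: (i) if $1\le k\le d-2$, then for every $\varepsilon>0$ $$\|e_\lambda\|_{L^2(\Sigma)}\le C\,\lambda^{\frac{d-k-2}2+\varepsilon}\,\|e_\lambda\|_{L^2(\mathbb{T}^d)};$$ (ii) if $k=d-1$, then $$\|e_\lambda\|_{L^2(\Sigma)}\le C\,\|e_\lambda\|_{L^2(\mathbb{T}^d)}.$$ Here the constant $C$ may depend on the rational coefficients (and on $d,k$, and on $\varepsilon$ in (i)) but is independent of $\lambda$.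
   Context: $\mathbb{T}^d=\mathbb{R}^d/(2\pi\mathbb{Z})^d$ is the standard flat torus and $\Delta$ its Laplace-Beltrami operator. Eigenfunctions are complex valued; those with $-\Delta e_\lambda=\lambda^2e_\lambda$ are exactly the finite sums $e_\lambda(x)=\sum_{n\in\mathbb{Z}^d,\,|n|=\lambda}c_ne^{in\cdot x}$. Totally geodesic submanifolds are bounded and have unit Hausdorff measure: a totally geodesic submanifold $\Sigma\subset\mathbb{T}^d$ of dimension $k$ is the image in $\mathbb{T}^d$ of a relatively open subset $\tilde\Sigma$ of a $k$-dimensional affine plane $V\subset\mathbb{R}^d$, with $k$-dimensional Hausdorff measure $1$, and contained in a ball of fixed radius $C_0$ (a fixed constant $C_0\ge d$, on which $C$ may depend). $L^2(\Sigma)$ is taken with respect to $k$-dimensional Hausdorff measure on $\tilde\Sigma$. ''Determined by linear equations with rational coefficients'' means that $V=\{x\in\mathbb{R}^d: a_i\cdot x=b_i,\ i=1,\dots,d-k\}$ with linearly independent $a_i\in\mathbb{Q}^d$ and $b_i\in\mathbb{R}$; the rational coefficients are the entries of the $a_i$. *)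

(* Defs.v *)
From HB Require Import structures.
From mathcomp Require Import all_boot all_order all_algebra.
From mathcomp Require Import all_classical all_reals all_analysis.
From mathcomp Require Import complex.

Set Implicit Arguments.
Unset Strict Implicit.
Unset Printing Implicit Defensive.
Import Order.TTheory GRing.Theory Num.Theory.
Import numFieldNormedType.Exports.

Local Open Scope classical_set_scope.
Local Open Scope ring_scope.

(* Points of R^d are row vectors. The library's norm on 'rV[R]_d is the sup
   norm (used only for its topology); all metric notions below use enorm. *)
Definition enorm {R : realType} {d : nat} (x : 'rV[R]_d) : R :=
  Num.sqrt (\sum_(j < d) x 0 j ^+ 2).

(* Volume of the unit ball of R^k, pi^(k/2) / Gamma(k/2 + 1), through the
   recursion omega_(k+2) = 2 pi / (k+2) * omega_k. *)
Fixpoint ball_volume (R : realType) (k : nat) : R :=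
  match k with
  | 0 => 1
  | 1 => 2
  | (k'.+2) as k0 => 2 * pi / k0%:R * ball_volume R k'
  end.

Section Hausdorff.
Context {R : realType} (d : nat).
Implicit Types A : set 'rV[R]_d.
Local Open Scope ereal_scope.

(* -oo on the empty set *)
Definition diameter A : \bar R :=
  ereal_sup [set (enorm (x - y))%:E | x in A & y in A].

(* The factor omega_k / 2^k makes the k-dimensional Hausdorff measure coincide
   with Lebesgue measure on k-planes. *)
Definition hausdorff_gauge (k : nat) A : \bar R :=
  if A == set0 then 0
  else (ball_volume R k / 2 ^+ k)%:E * diameter A ^+ k.

Definition hausdorff_cover (delta : R) A : set ((set 'rV[R]_d)^nat) :=
  [set F | A `<=` \bigcup_n F n /\ forall n, diameter (F n) <= delta%:E].

Definition hausdorff_pre (k : nat) (delta : R) A : \bar R :=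
  ereal_inf [set \sum_(n <oo) hausdorff_gauge k (F n)
            | F in hausdorff_cover delta A].

Definition hausdorff (k : nat) A : \bar R :=
  ereal_sup [set hausdorff_pre k delta A | delta in [set e : R | (0 < e)%R]].

Lemma ball_volume_ge0 k : (0 <= ball_volume R k)%R.
Proof.
suff : (0 <= ball_volume R k)%R /\ (0 <= ball_volume R k.+1)%R by case.
elim: k => [|k [h0 h1]]; first by split => //=; rewrite ler0n.
split => //=; rewrite mulr_ge0// divr_ge0 ?ler0n//.
by rewrite mulr_ge0 ?ler0n// pi_ge0.
Qed.

Lemma hausdorff_gauge_ge0 k A : 0 <= hausdorff_gauge k A.
Proof.
rewrite /hausdorff_gauge; have [_//|/set0P[x Ax]] := eqVneq A set0.
rewrite mule_ge0 ?lee_fin ?divr_ge0 ?ball_volume_ge0 ?exprn_ge0//.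
rewrite expe_ge0//; apply: (@le_trans _ _ (enorm (x - x))%:E).
  by rewrite lee_fin sqrtr_ge0.
by apply: ereal_sup_ubound; exists x => //; exists x.
Qed.

Lemma hausdorff_pre_ge0 k delta A : 0 <= hausdorff_pre k delta A.
Proof.
apply: le_ereal_inf_tmp => _ [F _ <-]; apply: nneseries_ge0 => n _ _.
exact: hausdorff_gauge_ge0.
Qed.

Lemma le_hausdorff_pre k delta A B :
  A `<=` B -> hausdorff_pre k delta A <= hausdorff_pre k delta B.
Proof.
move=> AB; apply: ereal_inf_le_tmp => _ [F [BF dF] <-].
by exists F => //; split => //; exact: subset_trans BF.
Qed.

Lemma hausdorff_pre0 k delta : hausdorff_pre k delta set0 = 0.
Proof.
apply/eqP; rewrite eq_le hausdorff_pre_ge0 andbT.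
apply: ereal_inf_lbound; exists (fun=> set0).
  split => // _; rewrite /diameter (_ : [set _ | _ in _ & _ in _] = set0).
    by rewrite ereal_sup0 leNye.
  by apply/seteqP; split => [y [x []]|y []].
by rewrite eseries0// => n _ _; rewrite /hausdorff_gauge eqxx.
Qed.

Lemma hausdorff_pre_sigma_subadditive k delta :
  sigma_subadditive (hausdorff_pre k delta).
Proof.
move=> A; set mu := hausdorff_pre k delta.
have [[i ioo]|] := pselect (exists i, mu (A i) = +oo).
  rewrite (eseries_pinfty _ _ ioo) ?leey// => n _.
  by rewrite -ltNye (lt_le_trans _ (hausdorff_pre_ge0 _ _ _)).
rewrite -forallNE => Aoo.
suff add2e (e : {posnum R}) :
    mu (\bigcup_n A n) <= \sum_(i <oo) mu (A i) + e%:num%:E.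
  by apply/lee_addgt0Pr => _/posnumP[].
rewrite (le_trans _ (epsilon_trick _ _ _))//; last first.
  by move=> n; exact: hausdorff_pre_ge0.
pose P n (B : (set 'rV[R]_d)^nat) := hausdorff_cover delta (A n) B /\
  \sum_(j <oo) hausdorff_gauge k (B j) <= mu (A n) + (e%:num / (2 ^ n.+1)%:R)%:E.
have [G PG] : {G : ((set 'rV[R]_d)^nat)^nat & forall n, P n (G n)}.
  apply: (@choice _ _ P) => n; rewrite /P.
  have muAfin : mu (A n) \is a fin_num.
    by rewrite ge0_fin_numE ?hausdorff_pre_ge0// ltey; apply/eqP; exact: Aoo.
  have en1 : (0 < e%:num / (2 ^ n.+1)%:R)%R by [].
  have [_ [B AB <-] /ltW BA] := lb_ereal_inf_adherent en1 muAfin.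
  by exists B; split.
have gG_ge0 x : 0 <= (hausdorff_gauge k \o uncurry G) x.
  exact: hausdorff_gauge_ge0.
apply: (@le_trans _ _ (\esum_(i in setT) (hausdorff_gauge k \o uncurry G) i)).
  apply: ereal_inf_lbound => /=.
  have /card_esym/ppcard_eqP[f] := card_nat2.
  exists (uncurry G \o f).
    split=> [|i]; last by rewrite /= /uncurry; case: (f i) => p q; exact: (PG p).1.2.
    apply: (@subset_trans _ (\bigcup_n \bigcup_j G n j)) => [t [i _]|].
      by move=> /(PG i).1.1 [j _ ?]; exists i => //; exists j.
    move=> t [i _ [j _ Bijt]]; exists (f^-1%FUN (i, j)) => //=.
    by rewrite invK ?inE.
  rewrite -(esum_pred_image (hausdorff_gauge k \o uncurry G) _ xpredT) ?[fun=> _]set_true//.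
  by rewrite image_eq.
rewrite (_ : esum _ _ =
    \sum_(i <oo) \sum_(j <oo) hausdorff_gauge k (G i j)); last first.
  pose J : nat -> set (nat * nat) := fun i => [set (i, j) | j in setT].
  rewrite (_ : setT = \bigcup_k J k); last first.
    by rewrite predeqE => -[a b]; split => // _; exists a => //; exists b.
  rewrite esum_bigcupT /=; last 2 first.
    - apply/trivIsetP => i j _ _ ij.
      rewrite predeqE => -[n m] /=; split => //= -[] [_] _ [<-{n} _].
      by move=> [m' _] [] /esym/eqP; rewrite (negbTE ij).
    - by move=> /= ?; exact: gG_ge0.
  rewrite -(image_id [set: nat]) -fun_true esum_pred_image//; last first.
    by move=> n _; apply: esum_ge0 => ? _; exact: hausdorff_gauge_ge0.
  apply: eq_eseriesr => /= j _.
  rewrite -(esum_pred_image (hausdorff_gauge k \o uncurry G) (pair j) predT)//=; last 2 first.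
    - by move=> ? _; exact: hausdorff_gauge_ge0.
    - by move=> ? ? _ _; exact: (@can_inj _ _ _ snd).
  by congr esum; rewrite predeqE => -[a b]; split; move=> [i _ <-]; exists i.
apply: lee_nneseries => n *.
  by apply: nneseries_ge0 => m *; exact: hausdorff_gauge_ge0.
exact: (PG n).2.
Qed.

Lemma hausdorff_pre_le k delta A :
  (0 < delta)%R -> hausdorff_pre k delta A <= hausdorff k A.
Proof. by move=> d0; apply: ereal_sup_ubound; exists delta. Qed.

Lemma hausdorff0 k : hausdorff k set0 = 0.
Proof.
apply/eqP; rewrite eq_le; apply/andP; split.
  by apply: ge_ereal_sup => _ [delta _ <-]; rewrite hausdorff_pre0.
by rewrite -(hausdorff_pre0 k 1) hausdorff_pre_le.
Qed.

Lemma hausdorff_ge0 k A : 0 <= hausdorff k A.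
Proof.
exact: (le_trans (hausdorff_pre_ge0 k 1 A) (hausdorff_pre_le k A ltr01)).
Qed.

Lemma le_hausdorff k : {homo hausdorff k : A B / A `<=` B >-> A <= B}.
Proof.
move=> A B AB; apply: ge_ereal_sup => _ [delta /= d0 <-].
exact: le_trans (le_hausdorff_pre k delta AB) (hausdorff_pre_le k B d0).
Qed.

Lemma hausdorff_sigma_subadditive k : sigma_subadditive (hausdorff k).
Proof.
move=> A; apply: ge_ereal_sup => _ [delta /= d0 <-].
apply: (le_trans (hausdorff_pre_sigma_subadditive k delta A)).
by apply: lee_nneseries => n *; [exact: hausdorff_pre_ge0|exact: hausdorff_pre_le].
Qed.

HB.instance Definition _ k := isOuterMeasure.Build R 'rV[R]_d (hausdorff k)
  (hausdorff0 k) (hausdorff_ge0 k) (@le_hausdorff k)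
  (hausdorff_sigma_subadditive k).

Definition hausdorff_outer (k : nat) : {outer_measure set 'rV[R]_d -> \bar R} :=
  hausdorff k.

(* On the Caratheodory sigma-algebra, which contains the Borel sets. *)
Definition hausdorff_measure (k : nat) :
    {measure set (caratheodory_type (hausdorff_outer k)) -> \bar R} :=
  hausdorff_outer k : set (caratheodory_type (hausdorff_outer k)) -> \bar R.

Definition L2norm (k : nat) (S : set 'rV[R]_d) (e : 'rV[R]_d -> R[i]) : \bar R :=
  'N[hausdorff_measure k]_2[(fun x => (ComplexField.Normc.normc (e x))%:E) \_ S].

End Hausdorff.

Section Torus.
Context {R : realType} (d : nat).

(* Functions on the torus are (2 pi Z)^d-periodic functions on R^d. *)
Definition torus_periodic (e : 'rV[R]_d -> R[i]) : Prop :=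
  forall (x : 'rV[R]_d) (n : 'rV[int]_d),
    e (x + (2 * pi) *: map_mx intr n) = e x.

Definition torus_cell : set 'rV[R]_d :=
  [set x | forall j, 0 <= x 0 j < 2 * pi].

Definition unit_vec (j : 'I_d) : 'rV[R]_d := delta_mx 0 j.

Definition C2 (f : 'rV[R]_d -> R) : Prop :=
  [/\ continuous f,
      forall i x, derivable f x (unit_vec i),
      forall i, continuous ('D_(unit_vec i) f),
      forall i j x, derivable ('D_(unit_vec i) f) x (unit_vec j) &
      forall i j, continuous ('D_(unit_vec j) ('D_(unit_vec i) f))].

Definition laplacian (f : 'rV[R]_d -> R) (x : 'rV[R]_d) : R :=
  \sum_(j < d) 'D_(unit_vec j) ('D_(unit_vec j) f) x.

(* - Delta e = lambda^2 e on the torus, with real and imaginary parts taken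
   separately because 'D_ is available for maps between real normed spaces. *)
Definition torus_eigenfunction (lambda : R) (e : 'rV[R]_d -> R[i]) : Prop :=
  let u := fun x => complex.Re (e x) in
  let v := fun x => complex.Im (e x) in
  [/\ torus_periodic e, C2 u, C2 v,
      forall x, - laplacian u x = lambda ^+ 2 * u x &
      forall x, - laplacian v x = lambda ^+ 2 * v x].

(* The measure is the Riemannian volume of the torus, i.e. Lebesgue measure on
   a fundamental cell. *)
Definition torus_L2norm (e : 'rV[R]_d -> R[i]) : \bar R :=
  L2norm d torus_cell e.

Definition affine_plane (k : nat) (V : set 'rV[R]_d) : Prop :=
  exists (p : 'rV[R]_d) (u : 'M[R]_(k, d)),
    row_free u /\ V = [set p + t *m u | t in [set: 'rV[R]_k]].

(* S is the lift to R^d of a bounded totally geodesic submanifold of the torus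
   of dimension k and unit measure. *)
Definition totally_geodesic (C0 : R) (k : nat) (V S : set 'rV[R]_d) : Prop :=
  [/\ affine_plane k V,
      exists2 U, open U & S = U `&` V,
      hausdorff k S = 1%E &
      exists p, forall x, S x -> enorm (x - p) <= C0].

Definition rational_plane (m : nat) (a : 'M[rat]_(m, d)) (b : 'I_m -> R) :
    set 'rV[R]_d :=
  [set x | forall i, \sum_(j < d) ratr (a i j) * x 0 j = b i].

End Torus.

(* Main.v *)
(** Every S lies in a cell P of a lattice of rank k in the direction of V, with
    generators in (2 pi Z)^d that depend only on the a_i, so the norm of e over
    S is at most its norm over P.  The mean over P of e^{i (n - n') . x} vanishes
    unless n - n' is orthogonal to the direction of V, i.e. lies in the span of
    the a_i.  Hence, writing e = sum_n c_n e^{i n . x} over |n| = lambda, the mean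
    of |e|^2 over P is at most N sum_n |c_n|^2, where N bounds the number of
    frequencies in a class modulo that span: these are the integer points of a
    sphere of dimension d - k - 1.  If k = d - 1 there are at most two of them.
    Otherwise fixing all but two coordinates in the span leaves
    O(lambda^(d - k - 2)) choices, and each slice consists of the solutions of a
    binary quadratic equation X^2 + D Y^2 = K, whose number is O_D(tau(K)^2) and
    so O(lambda^eps) by the divisor bound.

    That e is such a finite sum is proved through its real and imaginary parts:
    integrating by parts, the Fourier coefficients with |n| <> lambda vanish, and
    a continuous periodic function without Fourier coefficients is zero. *)

Require Import Defs.
From mathcomp Require Import all_boot all_order all_algebra.
From mathcomp Require Import all_classical all_reals all_analysis.
From mathcomp Require Import complex measurable_realfun.
From mathcomp Require Import zify ring lra.

Set Implicit Arguments.
Unset Strict Implicit.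
Unset Printing Implicit Defensive.
Import Order.TTheory GRing.Theory Num.Theory.
Import numFieldNormedType.Exports.

Local Open Scope classical_set_scope.
Local Open Scope ring_scope.

(** * Representations by binary quadratic forms *)

(** The Hausdorff measure is nowhere identified with Lebesgue measure and no cell has its volume
    computed. Integration rests on four facts: open sets are Caratheodory measurable, translations
    preserve the measure, parallelepipeds have finite measure, and cubes of full dimension have
    positive measure. Orthogonality is therefore not read off from iterated integrals: translating
    along an edge that is a period leaves an integral unchanged, while a suitable translation
    changes the sign of a cosine. The same invariance gives the integration by parts, since
    difference quotients have mean zero. Rationality enters twice. It supplies periods in the
    direction of V, and it makes the double orthogonal complement a statement over the rationals, so
    that frequencies which agree on V differ by a rational combination of the a_i. The binary form
    becomes diagonal because two of the a_i are orthogonalised before their denominators are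
    cleared; hence D depends on the a_i alone. *)

Lemma size_le_fibers (T U : eqType) (f : T -> U) (r : seq U) (s : seq T)
    (M : nat) :
  {in s, forall x, f x \in r} ->
  (forall u, count (fun x => f x == u) s <= M)%N ->
  (size s <= size r * M)%N.
Proof.
move=> fr fM; apply: (@leq_trans (\sum_(u <- r) count (fun x => f x == u) s)%N).
  have -> : (\sum_(u <- r) count (fun x => f x == u) s =
             \sum_(x <- s) \sum_(u <- r) (f x == u))%N.
    rewrite exchange_big/=; apply: eq_bigr => u _.
    by rewrite -sum1_count big_mkcond; apply: eq_bigr => x _; case: eqP.
  rewrite -sum1_size big_seq [leqRHS]big_seq; apply: leq_sum => x xs.
  by rewrite (big_rem _ (fr x xs))/= eqxx.
rewrite mulnC -iter_addn_0 -count_predT -big_const_seq.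
by apply: leq_sum => u _.
Qed.

Section BinaryForm.
Variables (D : nat) (K : nat).
Hypotheses (D0 : (0 < D)%N) (K0 : (0 < K)%N).

Definition represents (z : int * int) := z.1 ^+ 2 + D%:Z * z.2 ^+ 2 == K%:Z.

(** Modulo y the number K is x^2, and x is invertible modulo y. *)
Lemma represents_gcd_eq1 (x y : int) : represents (x, y) -> coprimez x y ->
  coprimez y K.
Proof.
move=> /eqP/= xyK xy.
rewrite -xyK addrC expr2 (expr2 x) mulrA.
rewrite /coprimez gcdzMDl; rewrite -/(coprimez _ _).
by rewrite coprimezMr coprimez_sym xy.
Qed.

(* Brahmagupta: (xx' + Dyy')^2 + D (xy' - x'y)^2 = K^2. *)
Lemma represents_cross (x y x' y' : int) :
  represents (x, y) -> represents (x', y') ->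
  (x * x' + D%:Z * y * y') ^+ 2 + D%:Z * (x * y' - x' * y) ^+ 2 = K%:Z ^+ 2.
Proof. move=> /eqP/= xyK /eqP/= xyK'.
transitivity ((x ^+ 2 + D%:Z * y ^+ 2) * (x' ^+ 2 + D%:Z * y' ^+ 2)).
  by ring.
by rewrite xyK xyK' expr2.
Qed.

(** The two expressions are the image of (x1, y1) under a linear map of determinant x^2 + D y^2 = K,
    which is nonzero; the proof applies the adjugate. *)
Lemma represents_cross_inj (x y x1 y1 x2 y2 : int) : represents (x, y) ->
  x * x1 + D%:Z * y * y1 = x * x2 + D%:Z * y * y2 ->
  x * y1 - x1 * y = x * y2 - x2 * y -> (x1, y1) = (x2, y2).
Proof.
move=> /eqP/= xyK em el.
have K0' : (K%:Z != 0) by lia.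
congr pair; apply: (mulfI K0'); rewrite -xyK.
  transitivity (x * (x * x1 + D%:Z * y * y1) - D%:Z * y * (x * y1 - x1 * y)).
    by ring.
  by rewrite em el; ring.
transitivity (y * (x * x1 + D%:Z * y * y1) + x * (x * y1 - x1 * y)).
  by ring.
by rewrite em el; ring.
Qed.

(** Adding the two divisibilities gives h | 2 x y0, hence h | 2 x since h is coprime to y0. Then h^2
    divides 4 K - (2 x)^2 = 4 D y^2, and y is coprime to h, so h^2 | 4 D. Only the weaker h <= 4 D
    is kept. *)
Lemma represents_dvd_bound (x0 y0 x y : int) (h : nat) :
  represents (x0, y0) -> represents (x, y) -> coprimez x0 y0 -> coprimez x y ->
  (h * h %| K)%N -> (h%:Z %| x * y0 - x0 * y)%Z -> (h%:Z %| x * y0 + x0 * y)%Z ->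
  (h <= 4 * D)%N.
Proof.
move=> r0 r c0 c hhK h1 h2.
have hK : (h%:Z %| K%:Z)%Z by apply: dvdn_trans hhK; rewrite dvdn_mulr.
have cy0 : coprimez h y0.
  by apply: coprimez_dvdl hK _; rewrite coprimez_sym; exact: represents_gcd_eq1 r0 c0.
have cy : coprimez h y.
  by apply: coprimez_dvdl hK _; rewrite coprimez_sym; exact: represents_gcd_eq1 r c.
have h2x : (h%:Z %| 2 * x)%Z.
  rewrite -(Gauss_dvdzl _ cy0).
  rewrite (_ : 2 * x * y0 = (x * y0 - x0 * y) + (x * y0 + x0 * y)); last by ring.
  exact: rpredD.
have : ((h * h)%:Z %| 4 * D%:Z * y ^+ 2)%Z.
  move/eqP: r => /= xyK.
  rewrite (_ : 4 * D%:Z * y ^+ 2 = 4 * K%:Z - (2 * x) * (2 * x)); last by rewrite -xyK; ring.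
  apply: rpredB; first by rewrite dvdz_mull.
  by rewrite PoszM dvdz_mul.
rewrite Gauss_dvdzl; last by rewrite expr2 coprimezMr PoszM !coprimezMl cy.
rewrite -PoszM => /dvdn_leq; rewrite muln_gt0 D0 => /(_ isT) hh.
case: h hh {h1 h2 hhK hK cy0 cy h2x} => // h; nia.
Qed.

(* Fix one primitive solution (x0, y0). If (x, y) is another and g is the gcd of K
   and x y0 - x0 y, then K / g divides x y0 + x0 y. For two solutions with the same g,
   x y' - x' y is thus a multiple of lcm(g, K / g) = K / h with h <= 4 D, and
   Brahmagupta leaves 16 D + 2 possibilities. *)
Lemma size_primitive_representations (s : seq (int * int)) : uniq s ->
  {in s, forall z, represents z && coprimez z.1 z.2} ->
  (size s <= size (divisors K) * (16 * D + 2))%N.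
Proof.
case: s => [//|[x0 y0] s']; set s := (_, _) :: s' => us sP.
have /andP[r0 c0] : represents (x0, y0) && coprimez x0 y0.
  by apply: sP; rewrite mem_head.
pose f (z : int * int) := gcdn K `|(z.1 * y0 - x0 * z.2)%R|%N.
apply: (@size_le_fibers _ _ f) => [z zs|g].
  by rewrite -dvdn_divisors// dvdn_gcdl.
rewrite -size_filter; set s1 := seq.filter _ _.
have s1P z : z \in s1 -> [/\ represents z, coprimez z.1 z.2 & f z = g].
  by rewrite mem_filter => /andP[/eqP -> /sP/andP[]].
have us1 : uniq s1 by rewrite filter_uniq.
case: s1 us1 s1P => [//|[x y] s1']; set s1 := (_, _) :: s1' => us1 s1P.
have [r c fg] := s1P _ (mem_head _ _); rewrite /= in c.
have gK : (g %| K)%N by rewrite -fg dvdn_gcdl.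
pose g' := (K %/ g)%N.
have K_gg' : K = (g * g')%N by rewrite /g' mulnC divnK.
have [g0 g'0] : (0 < g)%N /\ (0 < g')%N by move: K0; rewrite K_gg' muln_gt0 => /andP.
have gdvd z : z \in s1 -> (g%:Z %| z.1 * y0 - x0 * z.2)%Z.
  by move=> /s1P[_ _ <-]; exact: dvdn_gcdr.
have g'dvd z : z \in s1 -> (g'%:Z %| z.1 * y0 + x0 * z.2)%Z.
  move=> /s1P[rz cz fz].
  (* The product of the two factors is K (y0^2 - y^2), where y is [z.2]. The first factor is g A'
     with A' coprime to K / g, so K / g must divide the second. *)
  have Kdvd : (K%:Z %| (z.1 * y0 - x0 * z.2) * (z.1 * y0 + x0 * z.2))%Z.
    move/eqP: rz => /= rz; move/eqP: r0 => /= r0.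
    rewrite (_ : _ * _ = K%:Z * (y0 ^+ 2 - z.2 ^+ 2)) ?dvdz_mulr//.
    by rewrite mulrBr -{1}rz -r0; ring.
  set A := (z.1 * y0 - x0 * z.2) in fz Kdvd *.
  set B := (z.1 * y0 + x0 * z.2) in Kdvd *.
  have {}Kdvd : (K %| `|A| * `|B|)%N by rewrite -abszM.
  rewrite -[(_ %| B)%Z]/(g' %| `|B|)%N; move: Kdvd.
  have /dvdnP[A' defA] : (g %| `|A|)%N by rewrite -fz dvdn_gcdr.
  have cA' : coprime g' A'.
    rewrite /coprime -(eqn_pmul2l g0) muln1 muln_gcdr -K_gg' (mulnC g A') -defA.
    by apply/eqP; exact: fz.
  rewrite defA K_gg' (mulnC A') -mulnA dvdn_pmul2l// Gauss_dvdr//.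
pose h := gcdn g g'.
have hD : (h <= 4 * D)%N.
  apply: (represents_dvd_bound r0 r c0 c).
  - by rewrite K_gg' dvdn_mul ?dvdn_gcdl ?dvdn_gcdr.
  - by apply: dvdz_trans (gdvd (x, y) (mem_head _ _)); exact: dvdn_gcdl.
  - by apply: dvdz_trans (g'dvd (x, y) (mem_head _ _)); exact: dvdn_gcdr.
pose L := lcmn g g'.
have KLh : K = (L * h)%N by rewrite K_gg' muln_lcm_gcd.
have L0 : (0 < L)%N by rewrite lcmn_gt0 g0.
have h0 : (0 < h)%N by rewrite gcdn_gt0 g0.
pose l (z : int * int) := x * z.2 - z.1 * y.
pose m (z : int * int) := x * z.1 + D%:Z * y * z.2.
have cy0 : coprimez y0 K by apply: represents_gcd_eq1 r0 c0.
(* As y0 is coprime to K, divisibility by g and by K / g may be tested after multiplication by y0,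
   where [l z] becomes a combination of the factors attached to (x0, y0). *)
have Ldvd z : z \in s1 -> (L%:Z %| l z)%Z.
  move=> zs; rewrite -[(_ %| l z)%Z]/(L %| `|l z|)%N dvdn_lcm; apply/andP; split.
    have cg : coprimez g y0 by rewrite coprimez_sym; apply: coprimez_dvdr cy0.
    rewrite -[(_ %| _)%N]/(g%:Z %| l z)%Z -(Gauss_dvdzl _ cg).
    rewrite (_ : l z * y0 = (x * y0 - x0 * y) * z.2 - (z.1 * y0 - x0 * z.2) * y);
      last by rewrite /l; ring.
    by apply: rpredB; rewrite dvdz_mulr//; [exact: (gdvd (x, y) (mem_head _ _))|exact: gdvd].
  have cg : coprimez g' y0.
    by rewrite coprimez_sym; apply: coprimez_dvdr cy0; rewrite K_gg' /dvdz/= dvdn_mull.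
  rewrite -[(_ %| _)%N]/(g'%:Z %| l z)%Z -(Gauss_dvdzl _ cg).
  rewrite (_ : l z * y0 = (x * y0 + x0 * y) * z.2 - (z.1 * y0 + x0 * z.2) * y);
    last by rewrite /l; ring.
  by apply: rpredB; rewrite dvdz_mulr//; [exact: (g'dvd (x, y) (mem_head _ _))|exact: g'dvd].
(* Once [l z] is known, Brahmagupta's identity gives [m z] only up to sign, so the sign is recorded
   too. Since [l z] = q L with |q| <= h <= 4 D, there are 8 D + 1 values of [l z], and two signs
   make 16 D + 2. *)
pose F z := (l z, 0 <= m z).
pose r1 := [seq (((i%:Z - (4 * D)%:Z) * L%:Z), b) | i <- iota 0 (8 * D + 1), b <- [:: true; false]].
have -> : (16 * D + 2)%N = size r1 by rewrite size_allpairs size_iota/=; lia.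
rewrite -(size_map F); apply: uniq_leq_size.
  rewrite map_inj_in_uniq// => z1 z2 z1s z2s [el em].
  have [rz1 _ _] := s1P _ z1s; have [rz2 _ _] := s1P _ z2s.
  rewrite (surjective_pairing z1) in rz1 *; rewrite (surjective_pairing z2) in rz2 *.
  apply: (represents_cross_inj r); last exact: el.
  have := represents_cross r rz2; rewrite -(represents_cross r rz1).
  rewrite -[in X in X -> _]/(l z1) -/(l z2) -/(m z1) -/(m z2) el => /addIr.
  move: em; rewrite -/(m z1) -/(m z2); move: (m z1) (m z2) => m1 m2.
  move=> em /eqP; rewrite eqf_sqr => /orP[/eqP//|/eqP m12].
  by move: em; rewrite m12; lia.
move=> _ /mapP[z zs ->].
have /dvdzP[q lq] := Ldvd _ zs.
have qh : (`|q| <= h)%N.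
  have [rz _ _] := s1P _ zs.
  have := represents_cross r rz; rewrite -/(l z) lq.
  rewrite KLh PoszM => e1.
  have {}e1 : (q * L%:Z) ^+ 2 <= (L%:Z * h%:Z) ^+ 2.
    rewrite -e1; set u := _ * L%:Z; set v := (X in X ^+ 2 + _).
    apply: (@le_trans _ _ (D%:Z * u ^+ 2)); last by rewrite lerDr sqr_ge0.
    by rewrite ler_peMl ?sqr_ge0//; lia.
  move: e1; rewrite exprMn exprMn mulrC ler_pM2l ?exprn_gt0//.
  by rewrite -[q ^+ 2]real_normK ?num_real// ler_sqr ?nnegrE//; lia.
apply/allpairsP; exists (absz (q + (4 * D)%:Z), 0 <= m z); split => /=.
- by rewrite mem_iota; lia.
- by case: (0 <= m z).
by rewrite /F lq; congr (_ * _, _); lia.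
Qed.

End BinaryForm.

(** Sort the representations by c, the gcd of the two entries. Since c^2 divides K, there are at
    most tau(K) values of c, and division by c turns each fibre into primitive representations of K
    / c^2. This is the origin of the second factor tau(K). *)
Lemma size_representations (D K : nat) (s : seq (int * int)) :
  (0 < D)%N -> (0 < K)%N -> uniq s -> {in s, forall z, represents D K z} ->
  (size s <= size (divisors K) ^ 2 * (16 * D + 2))%N.
Proof.
move=> D0 K0 us sP.
have sub_div n : (n %| K)%N -> (size (divisors n) <= size (divisors K))%N.
  move=> nK; apply: uniq_leq_size; first exact: divisors_uniq.
  move=> i; rewrite -!dvdn_divisors//; last exact: dvdn_gt0 nK.
  by move=> /dvdn_trans; apply.
pose f (z : int * int) := gcdn `|z.1|%N `|z.2|%N.
have fK z : z \in s -> (f z * f z %| K)%N.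
  move=> /sP/eqP zK; rewrite -[(_ %| _)%N]/((f z * f z)%:Z %| K%:Z)%Z -zK PoszM.
  have h1 : ((f z)%:Z %| z.1)%Z by exact: dvdn_gcdl.
  have h2 : ((f z)%:Z %| z.2)%Z by exact: dvdn_gcdr.
  apply: rpredD; rewrite expr2; first exact: dvdz_mul.
  by apply: dvdz_mull; exact: dvdz_mul.
rewrite expnS expn1 -mulnA; apply: (@size_le_fibers _ _ f) => [z zs|c].
  by rewrite -dvdn_divisors//; apply: dvdn_trans (fK z zs); rewrite dvdn_mulr.
rewrite -size_filter; set s1 := seq.filter _ _.
have [->//|/hasP[z0 z0s1 _]] : s1 = [::] \/ has predT s1.
  by case: s1 => [|? ?]; [left|right].
have s1P z : z \in s1 -> represents D K z /\ f z = c.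
  by rewrite mem_filter => /andP[/eqP fz zs]; split => //; exact: sP.
have cK : (c * c %| K)%N.
  by move: z0s1; rewrite mem_filter => /andP[/eqP <-]; exact: fK.
have c0 : (0 < c)%N by move: (dvdn_gt0 K0 cK); rewrite muln_gt0 => /andP[].
pose F (z : int * int) := ((z.1 %/ c)%Z, (z.2 %/ c)%Z).
have FK z : z \in s1 -> z = ((F z).1 * c%:Z, (F z).2 * c%:Z).
  move=> /s1P[_ fz].
  have h1 : (c%:Z %| z.1)%Z by rewrite -fz; exact: dvdn_gcdl.
  have h2 : (c%:Z %| z.2)%Z by rewrite -fz; exact: dvdn_gcdr.
  by rewrite /F/= (divzK h1) (divzK h2); case: z {fz h1 h2}.
apply: (@leq_trans (size (divisors (K %/ (c * c))) * (16 * D + 2))%N).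
  rewrite -(size_map F); apply: size_primitive_representations => //.
  - by rewrite divn_gt0 ?muln_gt0 ?c0// dvdn_leq.
  - rewrite map_inj_in_uniq ?filter_uniq// => z1 z2 /FK e1 /FK e2 e12.
    by rewrite e1 e2 e12.
  move=> _ /mapP[z zs ->]; have [rz fz] := s1P z zs; have ez := FK z zs.
  apply/andP; split.
    move: rz; rewrite {1}ez /represents/=; move: (F z) => [u v]/=.
    rewrite -[in X in X -> _](divnK cK) !PoszM => /eqP e.
    have cc : c%:Z * c%:Z != 0 by rewrite mulf_neq0//; lia.
    by apply/eqP; apply: (mulIf cc); rewrite -e; ring.
  move: fz; rewrite {1}ez; move: (F z) => [u v]; rewrite /f/= !abszM /= -muln_gcdl.
  by rewrite -[RHS]mul1n => /eqP; rewrite eqn_pmul2r.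
by rewrite leq_mul2r sub_div ?orbT// -{2}(divnK cK) dvdn_mulr.
Qed.

(** * The divisor bound *)

Lemma size_divisors n : size (divisors n) = (\prod_(f <- prime_decomp n) f.2.+1)%N.
Proof.
rewrite /divisors; elim: (prime_decomp n) => [|[p e] s IH]; first by rewrite big_nil.
rewrite big_cons -IH /=; set t := foldr _ _ _.
by elim: e => [|e IHe] /=; rewrite ?mul1n// size_merge size_cat size_map IHe -mulSnr.
Qed.

(** Compare e + 1 with p^(e eps) prime by prime. With B above 2^(1 / eps), a prime p >= B has p^eps
    >= 2, and 2^e >= e + 1. A smaller prime still has p^eps >= 1 + [kap], so Bernoulli's inequality
    costs it at most the factor c = 1 + 1 / [kap]; fewer than B primes being concerned, c^B
    suffices. *)
Lemma divisor_bound (R : realType) (eps : R) : 0 < eps ->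
  exists2 C : R, 0 < C &
    forall n, (0 < n)%N -> (size (divisors n))%:R <= C * n%:R `^ eps.
Proof.
move=> e0.
pose kap : R := 2 `^ eps - 1.
have k0 : 0 < kap.
  rewrite subr_gt0; have := gt0_ltr_powR e0 (_ : 1 \in Num.nneg) (_ : (2 : R) \in Num.nneg).
  by rewrite powR1; apply; rewrite ?nnegrE ?ltr1n.
pose c : R := 1 + kap^-1.
have c1 : 1 <= c by rewrite lerDl invr_ge0 ltW.
pose B := Num.bound (2 `^ (eps^-1) : R).
have BP (p : nat) : (B <= p)%N -> 2 <= p%:R `^ eps.
  move=> Bp.
  have h : 2 `^ (eps^-1) <= p%:R :> R.
    apply: (@le_trans _ _ B%:R); last by rewrite ler_nat.
    by apply/ltW; apply: le_lt_trans (archi_boundP _); rewrite ?ler_norm ?powR_ge0.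
  have := @ge0_ler_powR R eps (ltW e0) _ _ (powR_ge0 _ _) (ler0n _ p) h.
  by rewrite -powRrM mulVf ?gt_eqF// powRr1.
pose cp (p : nat) : R := if (p < B)%N then c else 1.
have cp1 p : 1 <= cp p by rewrite /cp; case: ifP.
have key (p e : nat) : prime p -> e.+1%:R <= cp p * (p ^ e)%N%:R `^ eps.
  move=> pp; rewrite natrX -powR_mulrn ?ler0n// powRAC powR_mulrn ?powR_ge0//.
  have bern (x : R) : 0 <= x -> 1 + e%:R * x <= (1 + x) ^+ e.
    move=> x0; elim: (e) => [|m IH]; first by rewrite mul0r addr0 expr0.
    rewrite exprSr; apply: (@le_trans _ _ ((1 + m%:R * x) * (1 + x))).
      rewrite -natr1; have : 0 <= m%:R * x * x by rewrite !mulr_ge0.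
      by nra.
    by rewrite ler_wpM2r// addr_ge0.
  rewrite /cp; case: ltnP => [_|Bp].
    apply: (@le_trans _ _ (c * (1 + kap) ^+ e)).
      apply: (@le_trans _ _ (c * (1 + e%:R * kap))); last first.
        by rewrite ler_wpM2l ?bern ?(le_trans _ c1)// ltW.
      rewrite -natr1 /c (_ : _ * _ = 1 + e%:R * kap + kap^-1 + e%:R * (kap^-1 * kap)); last by ring.
      rewrite mulVf ?gt_eqF//.
      have : 0 <= e%:R * kap by rewrite mulr_ge0// ltW.
      have : 0 <= kap^-1 by rewrite invr_ge0 ltW.
      by lra.
    rewrite ler_wpM2l ?(le_trans _ c1)// lerXn2r ?nnegrE ?powR_ge0//.
      by rewrite addr_ge0// ltW.
    rewrite /kap addrC subrK; apply: ge0_ler_powR; rewrite ?nnegrE ?ler0n//; first exact: ltW.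
    by rewrite ler_nat prime_gt1.
  rewrite mul1r; apply: (@le_trans _ _ (2 ^+ e)).
    by rewrite -natrX ler_nat ltn_expl.
  by rewrite lerXn2r ?nnegrE ?powR_ge0// BP.
exists (c ^+ B); first by rewrite exprn_gt0// (lt_le_trans _ c1).
move=> n n0; rewrite size_divisors.
have np := prod_prime_decomp n0.
rewrite [in leRHS]np.
have step : forall s : seq (nat * nat), {in s, forall f, prime f.1} ->
   (\prod_(f <- s) f.2.+1)%N%:R <= \prod_(f <- s) cp f.1 *
     (\prod_(f <- s) f.1 ^ f.2)%N%:R `^ eps :> R.
  elim=> [|f s IH] sP; first by rewrite !big_nil powR1 mulr1.
  rewrite !big_cons !natrM powRM// mulrACA ler_pM//.
    by apply: key; apply: sP; rewrite mem_head.
  by apply: IH => g gs; apply: sP; rewrite inE gs orbT.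
apply: (le_trans (step _ _)) => [[p e] /mem_prime_decomp[]//|].
rewrite ler_wpM2r ?powR_ge0//.
rewrite (_ : \prod_(f <- _) _ = \prod_(p <- primes n) cp p); last by rewrite big_map.
rewrite /cp -big_mkcond/= big_const_seq.
rewrite (_ : iter _ _ _ = c ^+ count (fun p => (p < B)%N) (primes n)); last first.
  by elim: (count _ _) => [|m IH]; rewrite ?expr0//= exprS IH.
rewrite ler_weXn2l// -size_filter -[X in (_ <= X)%N](size_iota 0 B).
apply: uniq_leq_size; first by rewrite filter_uniq// primes_uniq.
by move=> p; rewrite mem_filter mem_iota => /andP[].
Qed.

(** * Integer points on spheres in rational subspaces *)

(** Taken over a general ring because frequencies are integral, their classes are cut out over the
    rationals, and phases are real. *)
Definition dotp (T : comPzRingType) d (u v : 'rV[T]_d) : T :=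
  \sum_j u 0 j * v 0 j.

Section Dotp.
Variables (T : comPzRingType) (d : nat).
Implicit Types u v w : 'rV[T]_d.

Lemma dotpC u v : dotp u v = dotp v u.
Proof. by apply: eq_bigr => j _; rewrite mulrC. Qed.

Lemma dotpDl u v w : dotp (u + v) w = dotp u w + dotp v w.
Proof. by rewrite -big_split; apply: eq_bigr => j _; rewrite mxE mulrDl. Qed.

Lemma dotpZl c u w : dotp (c *: u) w = c * dotp u w.
Proof. by rewrite mulr_sumr; apply: eq_bigr => j _; rewrite mxE mulrA. Qed.

Lemma dotpDr u v w : dotp w (u + v) = dotp w u + dotp w v.
Proof. by rewrite !(dotpC w) dotpDl. Qed.

Lemma dotpZr c u w : dotp w (c *: u) = c * dotp w u.
Proof. by rewrite !(dotpC w) dotpZl. Qed.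

Lemma dotpNl u w : dotp (- u) w = - dotp u w.
Proof. by rewrite -scaleN1r dotpZl mulN1r. Qed.

Lemma dotpNr u w : dotp w (- u) = - dotp w u.
Proof. by rewrite !(dotpC w) dotpNl. Qed.

Lemma dotpBl u v w : dotp (u - v) w = dotp u w - dotp v w.
Proof. by rewrite dotpDl dotpNl. Qed.

Lemma dotpBr u v w : dotp w (u - v) = dotp w u - dotp w v.
Proof. by rewrite dotpDr dotpNr. Qed.

End Dotp.

Lemma dotp_map (S T : comNzRingType) (f : {rmorphism S -> T}) d (u v : 'rV[S]_d) :
  dotp (map_mx f u) (map_mx f v) = f (dotp u v).
Proof. by rewrite rmorph_sum; apply: eq_bigr => j _; rewrite !mxE rmorphM. Qed.

Lemma dotp_intr (T : comNzRingType) d (u v : 'rV[int]_d) :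
  dotp (map_mx intr u) (map_mx intr v) = (dotp u v)%:~R :> T.
Proof. exact: dotp_map. Qed.

Section DotpReal.
Variables (T : realDomainType) (d : nat).
Implicit Types u v : 'rV[T]_d.

Lemma dotp_ge0 u : 0 <= dotp u u.
Proof. by apply: sumr_ge0 => j _; rewrite -expr2 sqr_ge0. Qed.

Lemma dotp_eq0 u : (dotp u u == 0) = (u == 0).
Proof.
rewrite psumr_eq0; last by move=> j _; rewrite -expr2 sqr_ge0.
apply/allP/eqP => [h|->]; last by move=> j _; rewrite /= mxE mul0r eqxx.
apply/rowP => j; have := h j (mem_index_enum j).
by rewrite -expr2 sqrf_eq0 mxE => /eqP.
Qed.

Lemma dotp_gt0 u : (0 < dotp u u) = (u != 0).
Proof. by rewrite lt_def dotp_ge0 andbT dotp_eq0. Qed.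

Lemma sqr_coord_le u j : u 0 j ^+ 2 <= dotp u u.
Proof.
rewrite /dotp (bigD1 j)//= -expr2 lerDl; apply: sumr_ge0 => i _.
by rewrite -expr2 sqr_ge0.
Qed.

End DotpReal.

Lemma clear_denominators m n (A : 'M[rat]_(m, n)) :
  exists2 M : int, 0 < M & exists B : 'M[int]_(m, n),
    map_mx intr B = M%:~R *: A.
Proof.
pose M : int := \prod_i \prod_j denq (A i j).
exists M; first by rewrite prodr_gt0// => i _; rewrite prodr_gt0// => j _; rewrite denq_gt0.
exists (\matrix_(i, j) numq (M%:~R * A i j)); apply/matrixP => i j; rewrite !mxE.
apply/eqP; rewrite numqE; suff -> : denq (M%:~R * A i j) = 1 by rewrite mulr1.
suff : M%:~R * A i j \is a Num.int by rewrite Qint_def => /eqP.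
rewrite /M (bigD1 i)//= (bigD1 j)//= mulrAC !rmorphM/=.
rewrite mulrC !mulrA -(numqE (A i j)).
by rewrite !rpredM ?intr_int.
Qed.

(** A line meets a sphere at most twice: if n0 + t a has the norm of n0 and t is nonzero, then t = -
    2 (n0 . a) / (a . a), so all points other than n0 coincide. *)
Lemma size_sphere_line d (a : 'M[rat]_(1, d)) (s : seq 'rV[int]_d) :
  a != 0 -> uniq s ->
  {in s &, forall n n', (map_mx intr (n - n') <= a)%MS /\ dotp n n = dotp n' n'} ->
  (size s <= 2)%N.
Proof.
move=> a0; case: s => [|n0 [|n1 [|n2 s]]]// us sP; exfalso.
have h i : i \in [:: n1; n2] -> exists2 t : rat, t *: a = map_mx intr (i - n0) &
     t != 0 /\ t * dotp a a = - 2 * dotp (map_mx intr n0) a.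
  move=> ii.
  have i0 : i != n0.
    apply: contraL us => /eqP ei; move: ii; rewrite ei !inE /= !inE.
    by case/orP => /eqP <-; rewrite eqxx ?orbT.
  have i_s : i \in [:: n0, n1, n2 & s].
    by move: ii; rewrite !inE => /orP[]->; rewrite ?orbT.
  have [/sub_rVP[t et] ei] := sP i n0 i_s (mem_head _ _).
  have t0 : t != 0.
    apply: contraNneq i0 => t0; rewrite -subr_eq0; apply/eqP/rowP => j.
    by move: et; rewrite t0 scale0r => /rowP/(_ j); rewrite !mxE => /eqP; rewrite intr_eq0 => /eqP.
  exists t; [by rewrite et|split=> //].
  have en : map_mx intr i = map_mx intr n0 + t *: a.
    by rewrite -et map_mxB addrC subrK.
  have := dotp_intr rat i i; rewrite ei -dotp_intr en !(dotpDl, dotpDr, dotpZl, dotpZr)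
    (dotpC a) => h.
  apply: (mulfI t0); move: h; set x := dotp _ _; move: (dotp a a) => z.
  move: (dotp _ a) => y; clearbody x => /eqP; rewrite -subr_eq0 => /eqP h.
  by apply/eqP; rewrite -subr_eq0 -h; apply/eqP; ring.
have [t1 e1 [t10 h1]] := h n1 (mem_head _ _).
have [|t2 e2 [t20 h2]] := h n2; first by rewrite !inE eqxx orbT.
have t12 : t1 = t2.
  by apply: (mulIf (_ : dotp a a != 0)); [rewrite dotp_eq0|rewrite h1].
move: us; rewrite /= !inE; suff -> : n1 = n2 by rewrite eqxx !andbF.
apply: (@addIr _ (- n0)); apply/rowP => j.
by move/rowP: e2 => /(_ j); rewrite -t12 e1 !mxE => /intr_inj.
Qed.

Lemma dotp_CauchySchwarz (T : realDomainType) d (u w : 'rV[T]_d) :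
  dotp u w ^+ 2 <= dotp u u * dotp w w.
Proof.
have [->|w0] := eqVneq w 0.
  by rewrite -(scale0r 0) !dotpZr !mul0r mulr0 expr0n.
have ww : 0 < dotp w w by rewrite dotp_gt0.
have := dotp_ge0 (dotp w w *: u - dotp u w *: w).
rewrite !(dotpBl, dotpBr, dotpZl, dotpZr) (dotpC w u).
set x := dotp u u; set y := dotp u w; set z := dotp w w in ww *.
rewrite (_ : _ - _ = z * (x * z - y ^+ 2)); last by ring.
by rewrite pmulr_rge0// subr_ge0.
Qed.

(** All n in [s] have the same component orthogonal to w1 and w2, and the same norm, so (n . w1)^2 /
    A + (n . w2)^2 / B is constant. Multiplied by A B^2 this reads X^2 + (A B) Y^2 = K with X = B (n
    . w1) and Y = n . w2, and (X, Y) determines n. The case K = 0 leaves at most one point;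
    Cauchy-Schwarz bounds K. *)
Lemma size_sphere_plane d (w1 w2 : 'rV[int]_d) (N A B : nat) (s : seq 'rV[int]_d) :
  dotp w1 w1 = A%:Z -> dotp w2 w2 = B%:Z -> (0 < A)%N -> (0 < B)%N ->
  dotp w1 w2 = 0 -> uniq s -> {in s, forall n, dotp n n = N%:Z} ->
  {in s &, forall n n', exists t : rat * rat,
     map_mx intr (n - n') = t.1 *: map_mx intr w1 + t.2 *: map_mx intr w2} ->
  (size s <= 1)%N \/ exists2 K, (0 < K <= 2 * A * B ^ 2 * N)%N &
    (size s <= size (divisors K) ^ 2 * (16 * (A * B) + 2))%N.
Proof.
move=> wA wB A0 B0 w12 us sN sP.
case: s us sN sP => [|n0 s']; first by left.
set s := n0 :: s' => us sN sP.
have n0s : n0 \in s by rewrite mem_head.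
have [wA' wB'] : dotp (map_mx intr w1) (map_mx intr w1) = A%:R :> rat /\
  dotp (map_mx intr w2) (map_mx intr w2) = B%:R :> rat.
  by rewrite !dotp_intr wA wB.
have w12' : dotp (map_mx intr w1) (map_mx intr w2) = 0 :> rat by rewrite dotp_intr w12.
have w21' : dotp (map_mx intr w2) (map_mx intr w1) = 0 :> rat by rewrite dotpC.
have Aq : A%:R != 0 :> rat by rewrite pnatr_eq0 -lt0n.
have Bq : B%:R != 0 :> rat by rewrite pnatr_eq0 -lt0n.
pose F (n : 'rV[int]_d) := (B%:Z * dotp n w1, dotp n w2).
have Fdiff n n' : n \in s -> n' \in s -> exists t1 t2 : rat,
   [/\ map_mx intr n = map_mx intr n' + (t1 *: map_mx intr w1 + t2 *: map_mx intr w2),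
     (dotp n w1)%:~R = (dotp n' w1)%:~R + t1 * A%:R &
     (dotp n w2)%:~R = (dotp n' w2)%:~R + t2 * B%:R ].
  move=> ns n's; have [[t1 t2]/= et] := sP _ _ ns n's.
  exists t1, t2; have e : map_mx intr n = map_mx intr n' + (t1 *: map_mx intr w1 + t2 *: map_mx
    intr w2).
    by rewrite -et map_mxB addrC subrK.
  split => //; rewrite -!dotp_intr e !(dotpDl, dotpZl).
    by rewrite wA' w21' mulr0 addr0.
  by rewrite wB' w12' mulr0 add0r.
have Finj : {in s &, injective F}.
  move=> n n' ns n's [e1 e2].
  have {}e1 : dotp n w1 = dotp n' w1 by apply: mulfI e1; lia.
  have [t1 [t2 [e h1 h2]]] := Fdiff _ _ ns n's.
  have t10 : t1 = 0.
    move: h1; rewrite e1 => /eqP; rewrite -subr_eq0 opprD addNKr oppr_eq0.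
    by rewrite mulf_eq0 (negbTE Aq) orbF => /eqP.
  have t20 : t2 = 0.
    move: h2; rewrite e2 => /eqP; rewrite -subr_eq0 opprD addNKr oppr_eq0.
    by rewrite mulf_eq0 (negbTE Bq) orbF => /eqP.
  apply/rowP => j; move/rowP: e => /(_ j).
  by rewrite t10 t20 !scale0r !addr0 !mxE => /intr_inj.
pose K := absz (B%:Z * (B%:Z * dotp n0 w1 ^+ 2 + A%:Z * dotp n0 w2 ^+ 2)).
have KE : K%:Z = B%:Z * (B%:Z * dotp n0 w1 ^+ 2 + A%:Z * dotp n0 w2 ^+ 2).
  by rewrite gez0_abs// mulr_ge0// addr_ge0// mulr_ge0// sqr_ge0.
have FK : {in s, forall n, represents (A * B) K (F n)}.
  move=> n ns; apply/eqP => /=; rewrite KE.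
  have [t1 [t2 [e h1 h2]]] := Fdiff _ _ ns n0s.
  apply/eqP; rewrite -(eqr_int rat); apply/eqP.
  rewrite !(rmorphM, rmorphD, rmorphXn)/= h1 h2.
  have hN : dotp (map_mx intr n) (map_mx intr n) =
     dotp (map_mx intr n0) (map_mx intr n0) :> rat by rewrite !dotp_intr !sN.
  move: hN; rewrite e !(dotpDl, dotpDr, dotpZl, dotpZr) wA' wB' w12' w21'.
  rewrite !(dotpC (map_mx _ w1)) !(dotpC (map_mx _ w2)) !dotp_intr.
  move: (dotp n0 n0)%:~R (dotp n0 w1)%:~R (dotp n0 w2)%:~R => z x y hN.
  rewrite !pmulrn.
  apply/eqP; rewrite -subr_eq0.
  set b : rat := B%:~R; set a : rat := A%:~R.
  rewrite (_ : _ - _ = a * b ^+2 * ((z + (t1 * x + t2 * y) +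
      (t1 * (x + (t1 * a + t2 * 0)) + t2 * (y + (t1 * 0 + t2 * b)))) - z)); last by ring.
  by rewrite mulf_eq0 subr_eq0 -[X in _ || (_ == X)]hN; apply/orP; right; apply/eqP; ring.
have [K0|K0] := posnP K.
  left; rewrite -(size_map F); apply: (@uniq_leq_size _ _ [:: (0 : int, 0 : int)]).
    by rewrite map_inj_in_uniq.
  move=> _ /mapP[n ns ->]; have := FK n ns; rewrite K0 => /eqP/= h.
  rewrite inE; apply/eqP; rewrite /F.
  have := sqr_ge0 (B%:Z * dotp n w1); have := sqr_ge0 (dotp n w2).
  move: h; set x := _ * dotp n w1; set y := dotp n w2 => h x2 y2.
  have [x0 y0] : x ^+ 2 = 0 /\ y ^+ 2 = 0 by split; nia.
  by congr pair; apply/eqP; rewrite -sqrf_eq0 ?x0 ?y0.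
right; exists K; last first.
  rewrite -(size_map F); apply: size_representations => //.
  - by rewrite muln_gt0 A0.
  - by rewrite map_inj_in_uniq.
  - by move=> _ /mapP[n ns ->]; exact: FK.
rewrite K0 /=.
have := dotp_CauchySchwarz n0 w1; have := dotp_CauchySchwarz n0 w2.
rewrite wA wB (sN _ n0s) => h2 h1.
rewrite -lez_nat KE.
apply: (@le_trans _ _ (B%:Z * (B%:Z * (N%:Z * A%:Z) + A%:Z * (N%:Z * B%:Z)))).
  by rewrite ler_wpM2l// lerD// ler_wpM2l.
by rewrite expnS expn1 !PoszM; nia.
Qed.

(** Gram-Schmidt over the rationals followed by clearing denominators. Orthogonality removes the
    cross term from the binary form. *)
Lemma orthogonal_integer_pair d (a0 a1 : 'rV[rat]_d) :
  a0 != 0 -> (forall c, a1 != c *: a0) ->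
  exists w1 w2 : 'rV[int]_d,
    [/\ w1 != 0, w2 != 0, dotp w1 w2 = 0 & forall c0 c1 : rat,
      exists t : rat * rat,
        c0 *: a0 + c1 *: a1 = t.1 *: map_mx intr w1 + t.2 *: map_mx intr w2].
Proof.
move=> a00 a10; pose k := dotp a1 a0 / dotp a0 a0.
have aa : dotp a0 a0 != 0 by rewrite dotp_eq0.
have [M1 M10 [w1 e1]] := clear_denominators a0.
have [M2 M20 [w2 e2]] := clear_denominators (a1 - k *: a0).
have M1q : M1%:~R != 0 :> rat by rewrite intr_eq0 gt_eqF.
have M2q : M2%:~R != 0 :> rat by rewrite intr_eq0 gt_eqF.
have map0 (w : 'rV[int]_d) : map_mx intr w != 0 :> 'rV[rat]_d -> w != 0.
  by apply: contra_neq => ->; rewrite map_mx0.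
exists w1, w2; split.
- by apply: map0; rewrite e1 scaler_eq0 negb_or M1q.
- by apply: map0; rewrite e2 scaler_eq0 negb_or M2q subr_eq0 a10.
- apply: (@intr_inj rat); rewrite -dotp_intr e1 e2 !(dotpZl, dotpZr, dotpBr).
  by rewrite (dotpC a0 a1) /k divfK// subrr !mulr0.
move=> c0 c1; exists ((c0 + c1 * k) / M1%:~R, c1 / M2%:~R) => /=.
by rewrite e1 e2 !scalerA !divfK//; apply/rowP => j; rewrite !mxE; ring.
Qed.

Lemma absz_shift (z : int) (L : nat) : (absz z <= L)%N ->
  (absz (z + L%:Z)%R < (2 * L).+1)%N /\ z = (absz (z + L%:Z))%:Z - L%:Z.
Proof. by split; lia. Qed.

Lemma size_sphere_subspace (R : realType) (m d : nat) (a : 'M[rat]_(m.+2, d))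
    (eps : R) : row_free a -> 0 < eps ->
  exists2 C : R, 0 < C & forall (lambda : R) (s : seq 'rV[int]_d),
    1 < lambda -> uniq s ->
    {in s, forall n, (dotp n n)%:~R = lambda ^+ 2} ->
    {in s &, forall n n', (map_mx intr (n - n') <= a)%MS} ->
    (size s)%:R <= C * lambda ^+ m * lambda `^ eps.
Proof.
move=> fa e0.
have fa' (c : 'rV[rat]_m.+2) : c *m a = 0 -> c = 0.
  by move=> ca; apply/eqP; rewrite -(mulmx_free_eq0 c fa) ca.
pose i1 : 'I_m.+2 := lift ord0 ord0.
have [w1 [w2 [w10 w20 w12 wspan]]] : exists w1 w2 : 'rV[int]_d,
    [/\ w1 != 0, w2 != 0, dotp w1 w2 = 0 & forall c0 c1 : rat,
      exists t : rat * rat, c0 *: row ord0 a + c1 *: row i1 a =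
        t.1 *: map_mx intr w1 + t.2 *: map_mx intr w2].
  apply: orthogonal_integer_pair => [|c].
    apply/eqP; rewrite rowE => /fa'/rowP/(_ ord0); rewrite !mxE !eqxx.
    by move/eqP; rewrite oner_eq0.
  apply/eqP; rewrite !rowE scalemxAl => /eqP; rewrite -subr_eq0 -mulmxBl => /eqP.
  move=> /fa'/rowP/(_ i1); rewrite !mxE !eqxx /= mulr0 subr0.
  by move/eqP; rewrite oner_eq0.
pose A := absz (dotp w1 w1); pose B := absz (dotp w2 w2).
have wA : dotp w1 w1 = A%:Z by rewrite gez0_abs// dotp_ge0.
have wB : dotp w2 w2 = B%:Z by rewrite gez0_abs// dotp_ge0.
have A0 : (0 < A)%N by have := dotp_gt0 w1; rewrite wA w10.
have B0 : (0 < B)%N by have := dotp_gt0 w2; rewrite wB w20.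
have [M M0 [P eP]] := clear_denominators (pinvmx a).
(* The divisor bound is used squared, at a K of order lambda^2, so its exponent is multiplied by
   4. *)
have e40 : 0 < eps / 4 by rewrite divr_gt0.
have [C1 C10 C1P] := divisor_bound e40.
pose c : R := \sum_i \sum_j `|P j i|%:~R.
have c0 : 0 <= c by apply: sumr_ge0 => i _; apply: sumr_ge0 => j _; rewrite ler0z.
pose kap : R := (2 * A * B ^ 2)%N%:R.
(* The summand 1 covers the slices that contain at most one point. *)
pose C2 : R := 1 + C1 ^+ 2 * kap `^ (eps / 2) * (16 * (A * B) + 2)%N%:R.
have C21 : 1 <= C2 by rewrite lerDl mulr_ge0// mulr_ge0 ?powR_ge0// exprn_ge0// ltW.
exists ((2 * c + 1) ^+ m * C2).
  by rewrite mulr_gt0// ?(lt_le_trans ltr01 C21)// exprn_gt0// ltr_wpDl// mulr_ge0.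
move=> lam s lam1 us sN sa.
have lam0 : 0 < lam by rewrite (lt_trans ltr01).
pose L := Num.truncn (c * lam).
have LP : L%:R <= c * lam by rewrite truncn_le// mulr_ge0// ltW.
pose X : R := C2 * lam `^ eps.
have lame : 1 <= lam `^ eps.
  by rewrite -(powRr0 lam) ler_powR ?ltW.
have X1 : 1 <= X by rewrite /X (le_trans C21)// ler_peMr// (le_trans ler01).
pose MX := Num.truncn X.
(* A frequency need not lie in the row space of [a], only differences do. The integral map [n *m P]
   is linear, and on a difference it returns M times the coordinates along the rows of [a]; equal
   keys thus leave only the first two rows. *)
pose key (n : 'rV[int]_d) : {ffun 'I_m -> int} :=
  [ffun i => (n *m P) 0 (lift ord0 (lift ord0 i))].
pose r : seq {ffun 'I_m -> int} :=
  [seq [ffun i => (f i : nat)%:Z - L%:Z] | f : {ffun 'I_m -> 'I_(2 * L).+1}].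
have szr : size r = ((2 * L).+1 ^ m)%N by rewrite size_image card_ffun !card_ord.
have : (size s <= size r * MX)%N.
  apply: (@size_le_fibers _ _ key) => [n ns|u].
    have nl i : (`|n 0 i|%:~R : R) <= lam.
      rewrite -ler_sqr ?nnegrE ?ler0z ?(ltW lam0)//.
      rewrite -(sN n ns) -rmorphXn/= ler_int real_normK ?num_real//.
      exact: sqr_coord_le.
    have kl (i : 'I_m.+2) : (absz ((n *m P)%R 0%R i) <= L)%N.
      have : (`|(n *m P) 0 i|%:~R : R) <= c * lam.
        rewrite mxE; apply: (@le_trans _ _ (\sum_j `|n 0 j * P j i|)%:~R).
          by rewrite ler_int ler_norm_sum.
        rewrite rmorph_sum/= mulr_suml (bigD1 i)//=.
        apply: (@le_trans _ _ ((\sum_j `|P j i|%:~R) * lam)).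
          rewrite mulr_suml; apply: ler_sum => j _; rewrite normrM rmorphM/= mulrC.
          by rewrite ler_wpM2l// ler0z.
        rewrite lerDl; apply: sumr_ge0 => k _; rewrite mulr_ge0 ?(ltW lam0)//.
        by apply: sumr_ge0 => j _; rewrite ler0z.
      by rewrite -[ `|_|%:~R]/((absz _)%:R) -truncn_ge_nat ?mulr_ge0// ltW.
    apply/mapP.
    exists [ffun i : 'I_m =>
      inord (absz ((n *m P) 0 (lift ord0 (lift ord0 i)) + L%:Z)) : 'I_(2*L).+1].
      by rewrite mem_enum.
    apply/ffunP => i; rewrite !ffunE.
    have := kl (lift ord0 (lift ord0 i)); set z := (n *m P) 0 _.
    by move=> /absz_shift[zL2 ez]; rewrite inordK.
  rewrite -size_filter; set s1 := seq.filter _ _.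
  have [->//|/hasP[n0 n0s1 _]] : s1 = [::] \/ has predT s1.
    by case: s1 => [|? ?]; [left|right].
  have s1s n : n \in s1 -> n \in s by rewrite mem_filter => /andP[].
  pose N := absz (dotp n0 n0).
  have NE : N%:R = lam ^+ 2.
    by rewrite -(sN n0 (s1s _ n0s1)) -[in RHS](gez0_abs (dotp_ge0 n0)).
  have us1 : uniq s1 by rewrite filter_uniq.
  have s1N : {in s1, forall n, dotp n n = N%:Z}.
    by move=> n /s1s/sN; rewrite -NE -[N%:R]/((N%:Z)%:~R) => /intr_inj.
  have sp : {in s1 &, forall n n', exists t : rat * rat,
     map_mx intr (n - n') = t.1 *: map_mx intr w1 + t.2 *: map_mx intr w2}.
    move=> n n' ns n's.
    have na := sa _ _ (s1s _ ns) (s1s _ n's).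
    pose x := map_mx intr (n - n') *m pinvmx a.
    have ex : map_mx intr (n - n') = x *m a by rewrite /x mulmxKpV.
    have defx : x = map_mx intr (n - n') *m pinvmx a by [].
    clearbody x; have [t et] := wspan (x 0 ord0) (x 0 i1).
    exists t; rewrite -et ex; apply/rowP => j; rewrite !mxE.
    rewrite big_ord_recl big_ord_recl/= big1 ?addr0 ?addrA// => i _.
    suff -> : x 0 (lift ord0 (lift ord0 i)) = 0 by rewrite mul0r.
    move: ns n's; rewrite !mem_filter => /andP[/eqP kn _] /andP[/eqP kn' _].
    have /ffunP/(_ i) : key n = key n' by rewrite kn kn'.
    rewrite !ffunE => kk.
    have M0q : M%:~R != 0 :> rat by rewrite intr_eq0 gt_eqF.
    apply: (mulfI M0q); rewrite mulr0.
    transitivity ((M%:~R *: x) 0 (lift ord0 (lift ord0 i))); first by rewrite !mxE.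
    rewrite defx scalemxAr -eP -map_mxM mulmxBl.
    have z0 : (n *m P - n' *m P) 0 (lift ord0 (lift ord0 i)) = 0.
      by rewrite [LHS]mxE [X in _ + X]mxE kk subrr.
    by rewrite mxE z0.
  have [s11|[K /andP[K0 KN] sK]] := size_sphere_plane wA wB A0 B0 w12 us1 s1N sp.
    by apply: (leq_trans s11); rewrite /MX truncn_ge_nat// (le_trans ler01).
  rewrite /MX truncn_ge_nat ?(le_trans ler01)//.
  apply: (@le_trans _ _ ((size (divisors K) ^ 2 * (16 * (A * B) + 2))%N%:R)).
    by rewrite ler_nat.
  rewrite natrM natrX.
  apply: (@le_trans _ _ ((C1 * K%:R `^ (eps / 4)) ^+ 2 * (16 * (A * B) + 2)%N%:R)).
    rewrite ler_wpM2r// lerXn2r ?nnegrE ?ler0n ?mulr_ge0 ?powR_ge0 ?(ltW C10)//.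
    exact: C1P.
  have Kl : K%:R `^ (eps / 4) <= (kap * lam ^+ 2) `^ (eps / 4).
    apply: ge0_ler_powR; rewrite ?nnegrE ?ler0n ?(ltW e40)//.
      by rewrite mulr_ge0 ?ler0n// exprn_ge0// ltW.
    by rewrite -NE /kap -natrM ler_nat.
  apply: (@le_trans _ _ ((C1 * (kap * lam ^+ 2) `^ (eps / 4)) ^+ 2 * (16 * (A * B) + 2)%N%:R)).
    rewrite ler_wpM2r// lerXn2r ?nnegrE ?ler0n ?mulr_ge0 ?powR_ge0 ?(ltW C10)//.
    by rewrite ler_wpM2l// ltW.
  rewrite exprMn -[X in _ * X * _]powR_mulrn ?powR_ge0// -powRrM.
  rewrite (_ : eps / 4 * 2 = eps / 2); last by field.
  rewrite powRM ?ler0n ?exprn_ge0 ?(ltW lam0)//.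
  rewrite -(@powR_mulrn _ lam) ?(ltW lam0)// -powRrM.
  rewrite (_ : 2 * (eps / 2) = eps); last by field.
  by rewrite mulrA mulrAC /X ler_wpM2r ?powR_ge0// lerDr.
rewrite szr -(ler_nat R) natrM natrX => /le_trans; apply.
rewrite (_ : (2 * c + 1) ^+ m * C2 * _ * _ = ((2 * c + 1) * lam) ^+ m * X); last first.
  by rewrite exprMn /X; ring.
apply: ler_pM; rewrite ?exprn_ge0//; last by rewrite truncn_le// (le_trans ler01).
rewrite lerXn2r ?nnegrE ?ler0n//.
  by rewrite mulr_ge0 ?(ltW lam0)// addr_ge0// mulr_ge0.
rewrite -natr1 natrM; move: LP lam1 c0; clear; nra.
Qed.

(** * Hausdorff measure *)

Section Enorm.
Context {R : realType} {d : nat}.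
Implicit Types x y : 'rV[R]_d.

Lemma enorm_ge0 x : 0 <= enorm x.
Proof. exact: sqrtr_ge0. Qed.

Lemma coord_le_enorm x j : `|x 0 j| <= enorm x.
Proof.
rewrite -sqrtr_sqr ler_wsqrtr// (bigD1 j)//= lerDl.
by apply: sumr_ge0 => i _; exact: sqr_ge0.
Qed.

Lemma enorm_le_sum x : enorm x <= \sum_j `|x 0 j|.
Proof.
have s0 : 0 <= \sum_j `|x 0 j| by apply: sumr_ge0.
rewrite -[leRHS]ger0_norm// -sqrtr_sqr ler_wsqrtr//.
rewrite expr2 mulr_suml; apply: ler_sum => j _.
rewrite -real_normK ?num_real// expr2 ler_wpM2l//.
by rewrite (bigD1 j)//= lerDl; apply: sumr_ge0.
Qed.

Lemma normr_le_enorm x : `|x| <= enorm x.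
Proof.
rewrite [leLHS]mx_normrE; apply/bigmax_leP; split=> [|[i j] _ /=]; first exact: enorm_ge0.
by rewrite ord1 coord_le_enorm.
Qed.

End Enorm.

Section HausdorffMetric.
Context {R : realType} {d : nat}.
Implicit Types A B : set 'rV[R]_d.
Local Open Scope ereal_scope.

Lemma diameter0 : diameter (set0 : set 'rV[R]_d) = -oo.
Proof.
rewrite /diameter (_ : [set _ | _ in _ & _ in _] = set0) ?ereal_sup0//.
by apply/seteqP; split => [y [x []]|y []].
Qed.

Lemma hausdorff_gauge0 k : hausdorff_gauge k (set0 : set 'rV[R]_d) = 0.
Proof. by rewrite /hausdorff_gauge eqxx. Qed.

Lemma enorm_le_diameter A x y : A x -> A y -> (enorm (x - y))%:E <= diameter A.
Proof. by move=> Ax Ay; apply: ereal_sup_ubound; exists x => //; exists y. Qed.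

Lemma hausdorff_pre_anti k (e1 e2 : R) A : (e1 <= e2)%R ->
  hausdorff_pre k e2 A <= hausdorff_pre k e1 A.
Proof.
move=> e12; apply: ereal_inf_le_tmp => _ [F [AF dF] <-]; exists F => //.
by split => // n; apply: le_trans (dF n) _; rewrite lee_fin.
Qed.

(** Members of a cover that miss [A] become the empty set, of gauge 0. Keeping the indices lets the
    sums for two sets be compared term by term. *)
Let meet_part A (F : (set 'rV[R]_d)^nat) n : set 'rV[R]_d :=
  if pselect (F n `&` A !=set0) then F n else set0.

Let meet_part_cover delta A (F : (set 'rV[R]_d)^nat) :
  A `<=` \bigcup_n F n -> (forall n, diameter (F n) <= delta%:E) ->
  hausdorff_cover delta A (meet_part A F).
Proof.
move=> AF dF; split => [x Ax|n].
  have [n _ Fnx] := AF x Ax; exists n => //.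
  by rewrite /meet_part; case: pselect => // -[]; exists x.
by rewrite /meet_part; case: pselect => //= _; rewrite diameter0 leNye.
Qed.

(** A set of diameter at most delta < r cannot meet both [A] and [B], so each member of a cover of
    the union is charged to at most one of them. *)
Lemma hausdorff_pre_separated k A B (r delta : R) : (delta < r)%R ->
  (forall x y, A x -> B y -> (r <= enorm (x - y))%R) ->
  hausdorff_pre k delta A + hausdorff_pre k delta B <=
  hausdorff_pre k delta (A `|` B).
Proof.
move=> dr AB; apply: le_ereal_inf_tmp => _ [F [ABF dF] <-].
apply: (@le_trans _ _ (\sum_(n <oo) hausdorff_gauge k (meet_part A F n) +
                       \sum_(n <oo) hausdorff_gauge k (meet_part B F n))).
  apply: leeD; apply: ereal_inf_lbound.
    exists (meet_part A F) => //; apply: meet_part_cover => //.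
    by apply: subset_trans ABF; exact: subsetUl.
  exists (meet_part B F) => //; apply: meet_part_cover => //.
  by apply: subset_trans ABF; exact: subsetUr.
rewrite -nneseriesD; [|by move=> ? _ _; exact: hausdorff_gauge_ge0..].
apply: lee_nneseries => [n _ _|n _].
  by apply: adde_ge0; exact: hausdorff_gauge_ge0.
rewrite /meet_part; case: pselect => /= [[x [Fx Ax]]|_]; last first.
  by rewrite hausdorff_gauge0 add0e; case: pselect => //= _;
    rewrite ?hausdorff_gauge0 hausdorff_gauge_ge0.
case: pselect => /= [[y [Fy By]]|_]; last by rewrite hausdorff_gauge0 adde0.
exfalso; have := le_trans (enorm_le_diameter Fx Fy) (dF n).
by rewrite lee_fin leNgt (lt_le_trans dr)// AB.
Qed.

Lemma hausdorff_separated k A B (r : R) : (0 < r)%R ->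
  (forall x y, A x -> B y -> (r <= enorm (x - y))%R) ->
  hausdorff k A + hausdorff k B <= hausdorff k (A `|` B).
Proof.
move=> r0 AB; set c := hausdorff k (A `|` B).
have [->|] := eqVneq c +oo; first exact: leey.
rewrite -ltey => coo.
have cfin : c \is a fin_num by rewrite ge0_fin_numE ?hausdorff_ge0.
have key (e1 e2 : R) : (0 < e1)%R -> (0 < e2)%R ->
    hausdorff_pre k e1 A + hausdorff_pre k e2 B <= c.
  (* The suprema defining the two measures run over independent scales. Since the premeasure grows
     as the scale shrinks, one scale below both, and below r, serves for the two. *)
  move=> e10 e20; pose e := Num.min (Num.min e1 e2) (r / 2)%R.
  have e0 : (0 < e)%R by rewrite !lt_min e10 e20 divr_gt0.
  have er : (e < r)%R by rewrite gt_min ltr_pdivrMr// ltr_pMr// ltr1n orbT.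
  apply: le_trans (hausdorff_pre_le k _ e0).
  apply: le_trans (hausdorff_pre_separated k er AB).
  by apply: leeD; apply: hausdorff_pre_anti; rewrite !ge_min lexx ?orbT.
have hB : hausdorff k B \is a fin_num.
  rewrite ge0_fin_numE ?hausdorff_ge0//; apply: le_lt_trans coo.
  by apply: le_hausdorff; exact: subsetUr.
rewrite -leeBrDr//; apply: ge_ereal_sup => _ [e1 /= e10 <-].
have pA : hausdorff_pre k e1 A \is a fin_num.
  rewrite ge0_fin_numE ?hausdorff_pre_ge0//; apply: le_lt_trans coo.
  apply: le_trans (key e1 1%R e10 ltr01).
  by rewrite leeDl// hausdorff_pre_ge0.
rewrite leeBrDr// addeC -leeBrDr//; apply: ge_ereal_sup => _ [e2 /= e20 <-].
by rewrite leeBrDr// addeC key.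
Qed.

(* Caratheodory's criterion for a metric outer measure: the shells
   1/(i+2) <= f < 1/(i+1) of equal parity are pairwise separated, so the total
   mass of the shells near {f = 0} is finite. *)
Lemma hausdorff_caratheodory_gt0 k (f : 'rV[R]_d -> R) :
  (forall x y, `|f x - f y| <= enorm (x - y))%R ->
  (hausdorff_outer d k : set 'rV[R]_d -> \bar R).-caratheodory [set x | (0 < f x)%R].
Proof.
move=> lipf; set G := [set x | _]; apply: le_caratheodory_measurable => E.
set nu := hausdorff_outer d k.
have [->|] := eqVneq (nu E) +oo; first exact: leey.
rewrite -ltey => Eoo.
have sep (A B : set 'rV[R]_d) (a b : R) : (b < a)%R ->
    A `<=` [set x | (a <= f x)%R] -> B `<=` [set x | (f x < b)%R] ->
    nu A + nu B <= nu (A `|` B).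
  move=> ab Aa Bb; apply: (@hausdorff_separated _ _ _ (a - b)); first by rewrite subr_gt0.
  move=> x y /Aa/= Ax /Bb/= By; apply: le_trans (lipf x y).
  by apply: le_trans (ler_norm _); lra.
have inv_le (i j : nat) : (i <= j)%N -> (j.+1%:R^-1 <= i.+1%:R^-1 :> R)%R.
  by move=> ij; rewrite lef_pV2 ?posrE// ler_nat.
have inv_lt (i j : nat) : (i < j)%N -> (j.+1%:R^-1 < i.+1%:R^-1 :> R)%R.
  by move=> ij; rewrite ltf_pV2 ?posrE// ltr_nat.
pose S_ (i : nat) := E `&` [set x | (i.+3%:R^-1 <= f x < i.+2%:R^-1)%R].
have parity (b m : nat) : \sum_(0 <= i < m) nu (S_ (i.*2 + b)%N) <=
    nu (\bigcup_(i in [set i | (i < m)%N]) S_ (i.*2 + b)%N).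
  elim: m => [|m IH]; first by rewrite big_geq// outer_measure_ge0.
  rewrite big_nat_recr//; apply: (le_trans (leeD IH (lexx _))).
  apply: (le_trans (@sep _ _ ((m.*2 + b).+1%:R^-1)%R ((m.*2 + b).+2%:R^-1)%R _ _ _)).
  - exact: inv_lt.
  - move=> x [i /= im [_ /= /andP[+ _]]]; apply: le_trans.
    by apply: inv_le; lia.
  - by move=> x [_ /= /andP[]].
  apply: le_outer_measure => x [[i /= im Sx]|Sx].
    by exists i => //=; rewrite ltnS ltnW.
  by exists m => /=.
have sumE b : \sum_(0 <= i <oo) nu (S_ (i.*2 + b)%N) <= nu E.
  apply: lime_le; first by apply: is_cvg_nneseries => *; exact: outer_measure_ge0.
  apply: nearW => m; apply: (le_trans (parity b m)); apply: le_outer_measure.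
  by move=> x [i _ []].
have tail b : \sum_(n <= i <oo) nu (S_ (i.*2 + b)%N) @[n --> \oo] --> 0.
  apply: nneseries_tail_cvg => [|*]; last exact: outer_measure_ge0.
  exact: le_lt_trans (sumE b) Eoo.
(* The part of E where f >= 1 / (2 n + 2) is separated from the part where f <= 0. The rest of E
   inside G lies in shells of index at least 2 n, whose measure is bounded by tails of convergent
   series. *)
have main n : nu (E `&` G) + nu (E `&` ~` G) <= nu E +
    (\sum_(n <= i <oo) nu (S_ (i.*2 + 0)%N) + \sum_(n <= i <oo) nu (S_ (i.*2 + 1)%N)).
  pose Gn := [set x | (n.*2.+2%:R^-1 <= f x)%R].
  pose T b := \bigcup_(i in ~` `I_n) S_ (i.*2 + b)%N.
  have nuT b : nu (T b) <= \sum_(n <= i <oo) nu (S_ (i.*2 + b)%N).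
    exact: outer_measure_sigma_subadditive_tail.
  have EG : E `&` G `<=` (E `&` Gn) `|` (T 0%N `|` T 1%N).
    move=> x [Ex Gx]; have [Gnx|fn] := leP (n.*2.+2%:R^-1)%R (f x); first by left.
    right; have ex : exists j, (j.+3%:R^-1 <= f x)%R.
      exists (Num.truncn (f x)^-1%R); rewrite -[leRHS]invrK lef_pV2 ?posrE ?invr_gt0//.
      by apply: le_trans (ltW (truncnS_gt _)) _; rewrite ler_nat; exact: leqW (leqnSn _).
    have [j jx jmin] := ex_minnP ex.
    have fj : (f x < j.+2%:R^-1)%R.
      case: j jx jmin => [_ _|j _ jmin].
        by apply: lt_le_trans fn _; apply: inv_le; lia.
      by rewrite ltNge; apply/negP => /jmin; rewrite ltnn.
    have nj : (n.*2 <= j)%N.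
      rewrite leqNgt; apply/negP => jn; move: fn; rewrite ltNge => /negP; apply.
      by apply: le_trans jx; apply: inv_le; lia.
    have Sj : S_ j x by split => //=; rewrite jx fj.
    case: (boolP (odd j)) => oj; [right|left]; exists j./2 => /=.
    - by apply/negP; lia.
    - by rewrite (_ : (_ + _)%N = j)//; lia.
    - by apply/negP; lia.
    - by rewrite (_ : (_ + _)%N = j)//; lia.
  have h1 : nu (E `&` G) <= nu (E `&` Gn) + (nu (T 0%N) + nu (T 1%N)).
    apply: (le_trans (le_outer_measure nu _ _ EG)).
    apply: (le_trans (outer_measureU2 nu _ _)); apply: leeD => //.
    exact: outer_measureU2.
  have h2 : nu (E `&` Gn) + nu (E `&` ~` G) <= nu E.
    apply: (le_trans (@sep _ _ (n.*2.+2%:R^-1)%R (n.*2.+3%:R^-1)%R _ _ _)).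
    - exact: inv_lt.
    - by move=> x [].
    - move=> x [_ /= /negP]; rewrite -leNgt => fx0; apply: le_lt_trans fx0 _.
      by rewrite invr_gt0.
    by apply: le_outer_measure => x [[]|[]].
  apply: (le_trans (leeD h1 (lexx _))).
  rewrite addeAC; apply: leeD => //; apply: leeD; exact: nuT.
have lim0 : nu E + (\sum_(n <= i <oo) nu (S_ (i.*2 + 0)%N) +
    \sum_(n <= i <oo) nu (S_ (i.*2 + 1)%N)) @[n --> \oo] --> nu E + (0 + 0).
  apply: cvgeD; first by rewrite adde0 fin_num_adde_defl.
    exact: cvg_cst.
  by apply: cvgeD; [|exact: tail..].
suff : nu (E `&` G) + nu (E `&` ~` G) <= nu E + (0 + 0) by rewrite !adde0.
by apply: (cvge_ge _ lim0); exact: nearW.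
Qed.

(** The distance to the complement, in the sup norm, is positive exactly on U. It is 1-Lipschitz for
    that norm, hence for the larger Euclidean norm. The whole space is treated apart, the distance
    then being an infimum over the empty set. *)
Lemma hausdorff_caratheodory_open k (U : set 'rV[R]_d) : open U ->
  (hausdorff_outer d k : set 'rV[R]_d -> \bar R).-caratheodory U.
Proof.
move=> oU; have [UT|/set0P[z0 z0U]] := eqVneq (~` U) set0.
  rewrite -(setCK U) UT; apply: caratheodory_measurable_setC.
  exact: caratheodory_measurable_set0.
pose f x := inf [set `|x - y|%R | y in ~` U].
have lb x : has_lbound [set `|x - y|%R | y in ~` U].
  by exists 0%R => _ [y _ <-]; exact: normr_ge0.
have ne x : [set `|x - y|%R | y in ~` U] !=set0 by exists `|x - z0|%R; exists z0.
have f_le x y : (f x <= `|x - y| + f y)%R.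
  rewrite addrC -lerBlDr; apply: lb_le_inf => // _ [z Uz <-].
  rewrite lerBlDr; apply: (@le_trans _ _ `|x - z|%R); first by apply: ge_inf => //; exists z.
  by rewrite [leRHS]addrC ler_distD.
suff -> : U = [set x | (0 < f x)%R].
  apply: hausdorff_caratheodory_gt0 => x y.
  apply: le_trans (normr_le_enorm _).
  have h1 := f_le x y; have h2 := f_le y x; rewrite distrC in h2.
  by rewrite ler_norml; lra.
apply/seteqP; split => [x Ux /=|x /= fx].
  have /nbhs_ballP[e /= e0 eU] := oU x Ux.
  apply: (lt_le_trans e0); apply: lb_le_inf => // _ [y Uy <-].
  rewrite leNgt; apply/negP => xy; apply: Uy; apply: eU.
  by rewrite -ball_normE.
apply: contrapT => Ux; move: fx; rewrite ltNge => /negP; apply.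
by apply: ge_inf => //; exists x => //; rewrite subrr normr0.
Qed.

(** A preimage, that is [A] - v: the form in which measurability and change of variables under x + v
    call for it. *)
Definition shift_set (v : 'rV[R]_d) A := [set x | A (x + v)%R].

Lemma hausdorff_pre_shift_le k delta v A :
  hausdorff_pre k delta (shift_set v A) <= hausdorff_pre k delta A.
Proof.
have dshift (F : set 'rV[R]_d) : diameter (shift_set v F) = diameter F.
  congr ereal_sup; apply/seteqP; split => [_ [x Fx [y Fy <-]]|_ [x Fx [y Fy <-]]].
    exists (x + v)%R => //; exists (y + v)%R => //.
    by rewrite opprD addrACA subrr addr0.
  exists (x - v)%R; first by rewrite /shift_set/= subrK.
  exists (y - v)%R; first by rewrite /shift_set/= subrK.
  by rewrite opprB addrA subrK.
apply: le_ereal_inf_tmp => _ [F [AF dF] <-]; apply: ereal_inf_lbound.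
exists (shift_set v \o F).
  split => [x /AF[n _ Fx]|n]; first by exists n.
  by rewrite /= dshift.
congr (limn _); apply/funext => n; apply: eq_bigr => i _ /=.
rewrite /hausdorff_gauge dshift; congr (if _ then _ else _).
apply/eqP/eqP => [e|->]; last by apply/seteqP; split.
apply/seteqP; split => // x Fx.
by move/seteqP: e => [/(_ (x - v)%R)]; rewrite /shift_set/= subrK => /(_ Fx).
Qed.

Lemma hausdorff_shift k v A : hausdorff k (shift_set v A) = hausdorff k A.
Proof.
have le w B : hausdorff k (shift_set w B) <= hausdorff k B.
  apply: ge_ereal_sup => _ [e /= e0 <-].
  exact: le_trans (hausdorff_pre_shift_le _ _ _ _) (hausdorff_pre_le _ _ e0).
apply/eqP; rewrite eq_le le/=.
rewrite {1}(_ : A = shift_set (- v) (shift_set v A))//.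
by apply/seteqP; split => x; rewrite /shift_set/= subrK.
Qed.

End HausdorffMetric.

(** Half-open, so that a translation along an edge can be undone modulo that edge by exchanging two
    slabs. *)
Definition pbox {R : realType} {k d : nat} (p : 'rV[R]_d) (U : 'M[R]_(k, d)) :
    set 'rV[R]_d :=
  [set p + t *m U | t in [set t : 'rV[R]_k | forall l, 0 <= t 0 l < 1]].

(** * Finiteness of the measure on parallelepipeds and positivity on cubes *)

Section HausdorffBox.
Context {R : realType} {d : nat}.

Lemma hausdorff_gauge_le k (A : set 'rV[R]_d) (r : R) : 0 <= r ->
  (forall x y, A x -> A y -> enorm (x - y) <= r) ->
  (hausdorff_gauge k A <= (ball_volume R k / 2 ^+ k * r ^+ k)%:E)%E.
Proof.
move=> r0 Ar; rewrite /hausdorff_gauge.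
have b0 : 0 <= ball_volume R k / 2 ^+ k by rewrite divr_ge0 ?ball_volume_ge0.
have [_|/set0P[x Ax]] := eqVneq A set0.
  by rewrite lee_fin mulr_ge0// exprn_ge0.
have dA : (diameter A <= r%:E)%E.
  by apply: ge_ereal_sup => _ [y Ay [z Az <-]]; rewrite lee_fin Ar.
have dA0 : (0 <= diameter A)%E.
  by apply: le_trans (enorm_le_diameter Ax Ax); rewrite lee_fin enorm_ge0.
have dfin : diameter A \is a fin_num.
  by rewrite ge0_fin_numE//; apply: le_lt_trans dA (ltry _).
rewrite -(fineK dfin) -EFin_expe -EFinM lee_fin ler_wpM2l// lerXn2r ?nnegrE//.
  exact: fine_ge0.
by rewrite -lee_fin fineK.
Qed.

(** Cutting every edge into N equal parts gives N^k pieces of diameter at most [Lc] / N, so the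
    total gauge does not depend on N. The bound is uniform in the base point, which is what later
    makes the constant independent of the right-hand sides of the equations. *)
Lemma hausdorff_pbox_bounded k (U : 'M[R]_(k, d)) :
  exists c : R, forall p, (hausdorff k (pbox p U) <= c%:E)%E.
Proof.
pose Lc : R := \sum_j \sum_l `|U l j|.
have Lc0 : 0 <= Lc by apply: sumr_ge0 => j _; exact: sumr_ge0.
exists (ball_volume R k / 2 ^+ k * Lc ^+ k) => p.
apply: ge_ereal_sup => _ [delta /= d0 <-].
pose N := (Num.truncn (Lc / delta)).+1.
have N0 : 0 < N%:R :> R by rewrite ltr0n.
have LN : Lc / N%:R <= delta.
  rewrite ler_pdivrMr// mulrC -ler_pdivrMr//.
  exact/ltW/truncnS_gt.
pose piece (i : {ffun 'I_k -> 'I_N}) : set 'rV[R]_d :=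
  [set p + t *m U | t in [set t : 'rV[R]_k |
     forall l, (i l)%:R / N%:R <= t 0 l < (i l).+1%:R / N%:R]].
have piece_le i x y : piece i x -> piece i y -> enorm (x - y) <= Lc / N%:R.
  move=> [t tP <-] [t' tP' <-].
  rewrite opprD addrACA subrr add0r -mulmxBl.
  apply: (le_trans (enorm_le_sum _)); rewrite /Lc mulr_suml; apply: ler_sum => j _.
  rewrite mxE mulr_suml; apply: (le_trans (ler_norm_sum _ _ _)).
  apply: ler_sum => l _; rewrite normrM mulrC ler_wpM2l// !mxE.
  have := tP l; have := tP' l; rewrite -natr1 mulrDl mul1r.
  by rewrite ler_norml; lra.
pose Q := [seq piece i | i : {ffun 'I_k -> 'I_N}].
have szQ : size Q = (N ^ k)%N by rewrite size_image card_ffun !card_ord.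
have QP n : (n < N ^ k)%N -> exists i, nth set0 Q n = piece i.
  move=> nN; have /mapP[i _ ->] : nth set0 Q n \in Q by rewrite mem_nth// szQ.
  by exists i.
apply: (@le_trans _ _ (\sum_(n <oo) hausdorff_gauge k (nth set0 Q n))%E).
  apply: ereal_inf_lbound; exists (nth set0 Q) => //; split.
    move=> _ [t tP <-].
    have tN (l : 'I_k) : (Num.truncn (t 0 l * N%:R)%R < N)%N.
      rewrite truncn_lt_nat ?mulr_ge0//; last by case/andP: (tP l).
      by rewrite -[ltRHS]mul1r ltr_pM2r//; case/andP: (tP l).
    pose i : {ffun 'I_k -> 'I_N} := [ffun l => Ordinal (tN l)].
    have iQ : piece i \in Q by apply/mapP; exists i => //; rewrite mem_enum.
    exists (index (piece i) Q) => //; rewrite nth_index//; exists t => // l.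
    rewrite ffunE /= ler_pdivrMr// ltr_pdivlMr//.
    have h := tP l; have h0 : 0 <= t 0 l * N%:R by rewrite mulr_ge0//; case/andP: h.
    by apply/andP; split; [rewrite truncn_le|exact: truncnS_gt].
  move=> n; have [nN|nN] := ltnP n (N ^ k); last first.
    by rewrite nth_default ?szQ// diameter0 leNye.
  have [i ->] := QP n nN; apply: ge_ereal_sup => _ [x Ax [y Ay <-]].
  by rewrite lee_fin (le_trans (piece_le _ _ _ Ax Ay)).
rewrite (nneseries_split 0 (N ^ k)); last by move=> n _; exact: hausdorff_gauge_ge0.
rewrite eseries0 ?adde0; last first.
  by move=> n; rewrite add0n => nN _; rewrite nth_default ?szQ// hausdorff_gauge0.
rewrite add0n big_mkord.
apply: (@le_trans _ _ (\sum_(n < N ^ k) (ball_volume R k / 2 ^+ k * (Lc / N%:R) ^+ k)%:E)%E).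
  apply: lee_sum => n _; have [i ->] := QP n (ltn_ord n).
  apply: hausdorff_gauge_le; first by rewrite divr_ge0.
  exact: piece_le.
rewrite sumEFin lee_fin sumr_const card_ord -[leLHS]mulr_natr natrX -[leLHS]mulrA -exprMn.
by rewrite divfK// gt_eqF.
Qed.

(** Subtracting from each coordinate its minimum over the set embeds the set in a grid of side K +
    1. *)
Lemma card_grid_box (N K : nat) (A : {set {ffun 'I_d -> 'I_N}}) :
  (forall i i' j, i \in A -> i' \in A -> (i j <= i' j + K)%N) ->
  (#|A| <= K.+1 ^ d)%N.
Proof.
move=> AK; have [->|/set0Pn[i0 i0A]] := eqVneq A finset.set0; first by rewrite cards0.
pose b j := [arg min_(i < i0 in A) (i j : nat)].
have bP j : b j \in A /\ forall i, i \in A -> (b j j <= i j)%N.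
  by rewrite /b; case: arg_minnP => // i iA imin; split.
pose f (i : {ffun 'I_d -> 'I_N}) : {ffun 'I_d -> 'I_K.+1} :=
  [ffun j => inord (i j - b j j)].
have -> : (K.+1 ^ d)%N = #|{ffun 'I_d -> 'I_K.+1}| by rewrite card_ffun !card_ord.
rewrite -(card_in_imset (f := f) (D := mem A)) ?max_card// => i i' iA i'A /ffunP ff.
apply/ffunP => j; apply: val_inj; have := ff j; rewrite !ffunE => /(congr1 val)/=.
have [bA bmin] := bP j.
have h1 := AK i (b j) j iA bA; have h2 := AK i' (b j) j i'A bA.
have h3 := bmin i iA; have h4 := bmin i' i'A.
rewrite !inordK ?ltnS ?leq_subLR// => e.
by rewrite /= -(subnK h3) e subnK.
Qed.

Definition cbox (a : 'rV[R]_d) (s : R) : set 'rV[R]_d :=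
  [set x | forall j, a 0 j <= x 0 j <= a 0 j + s].

Lemma cbox_compact a s : compact (cbox a s).
Proof.
have := @rV_compact R d (fun j => `[a 0 j, a 0 j + s]%classic)
  (fun=> @segment_compact _ _ _).
by congr compact; apply/seteqP; split => x /= h j; have := h j; rewrite in_itv.
Qed.

(* Count the points of a fine grid of mesh s/N in each set of a finite open
   subcover, the sets having been enlarged by eta. *)
Lemma cbox_cover_sum (a : 'rV[R]_d) (s : R) (F : (set 'rV[R]_d)^nat)
    (r eta : nat -> R) :
  0 < s -> (forall n, 0 <= r n) -> (forall n, 0 < eta n) ->
  cbox a s `<=` \bigcup_n F n ->
  (forall n x y, F n x -> F n y -> enorm (x - y) <= r n) ->
  exists m, s ^+ d <= \sum_(n < m) (r n + 3 * eta n) ^+ d.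
Proof.
move=> s0 r0 eta0 aF Fr.
pose O n := \bigcup_(y in F n) ball y (eta n).
have oO n : open (O n) by apply: bigcup_open => y _; exact: ball_open.
have : cover_compact (cbox a s) by rewrite -compact_cover; exact: cbox_compact.
move=> /(_ _ setT O) []; first by move=> *; exact: oO.
  by move=> x /aF[n _ Fx]; exists n => //; exists x => //; exact: ballxx.
move=> D' _ D'cov.
pose m := (\max_(i <- finmap.enum_fset D') i).+1.
have cov x : cbox a s x -> exists2 n, (n < m)%N & O n x.
  by move=> /D'cov[n /= nD' Ox]; exists n => //; rewrite ltnS; exact: leq_bigmax_seq.
exists m.
(* The mesh s / N must not exceed any of the finitely many enlargements [eta n]. *)
have [N N0 NP] : exists2 N, (0 < N)%N & forall n : 'I_m, s <= N%:R * eta n.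
  exists (\sum_(n < m) (Num.truncn (s / eta n)).+1)%N.
    by rewrite (bigD1 ord0)//=.
  move=> n; rewrite -ler_pdivrMr//; apply/ltW/(lt_le_trans (truncnS_gt _)).
  by rewrite ler_nat (bigD1 n)//= leq_addr.
have N0R : 0 < N%:R :> R by rewrite ltr0n.
pose pt (i : {ffun 'I_d -> 'I_N}) : 'rV[R]_d := \row_j (a 0 j + (i j)%:R * (s / N%:R)).
have ptbox i : cbox a s (pt i).
  move=> j; rewrite mxE lerDl mulr_ge0 ?divr_ge0// ?(ltW s0)//= lerD2l.
  rewrite mulrCA -[leRHS]mulr1 ler_wpM2l// ?(ltW s0)// ler_pdivrMr// mul1r ler_nat.
  by rewrite ltnW.
pose A (n : 'I_m) : {set {ffun 'I_d -> 'I_N}} := [set i | `[< O n (pt i) >]]%SET.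
have Acard n : (#|A n|)%:R <= ((N%:R / s) * (r n + 3 * eta n)) ^+ d.
  (* Enlarging on both sides adds 2 eta to the diameter. The third eta pays for the 1 added when
     counting grid points in an interval, because N eta / s >= 1. *)
  pose K := Num.truncn ((N%:R / s) * (r n + 2 * eta n)).
  have K0 : 0 <= (N%:R / s) * (r n + 2 * eta n).
    by rewrite mulr_ge0// ?divr_ge0 ?(ltW s0)// addr_ge0// mulr_ge0// ltW.
  have h1 : (#|A n| <= K.+1 ^ d)%N.
    apply: card_grid_box => i i' j; rewrite !finset.in_set =>
      /asboolP[y Fy yi] /asboolP[y' Fy' yi'].
    have near (u v : 'rV[R]_d) : ball u (eta n) v -> `|u 0 j - v 0 j| < eta n.
      rewrite -ball_normE /= => uv; apply: le_lt_trans uv.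
      rewrite [leRHS]mx_normrE; apply: (le_trans _ (le_bigmax _ _ (ord0, j))) => /=.
      by rewrite !mxE.
    have h : (i j)%:R * (s / N%:R) <= (i' j)%:R * (s / N%:R) + (r n + 2 * eta n).
      have := near _ _ yi; have := near _ _ yi'; rewrite !mxE.
      have := le_trans (coord_le_enorm (y - y') j) (Fr _ _ _ Fy Fy'); rewrite !mxE.
      rewrite ler_norml !ltr_norml => /andP[? ?] /andP[? ?] /andP[? ?].
      by lra.
    have {}h : (i j)%:R <= (i' j)%:R + (N%:R / s) * (r n + 2 * eta n).
      have Ns : 0 <= N%:R / s by rewrite divr_ge0// ltW.
      have e (x : R) : (N%:R / s) * (x * (s / N%:R)) = x by field; rewrite !gt_eqF.
      by have := ler_wpM2l Ns h; rewrite mulrDr !e.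
    have [ii|ii] := leqP (i j) (i' j); first exact: leq_trans ii (leq_addr _ _).
    rewrite -leq_subLR truncn_ge_nat// natrB ?(ltnW ii)//.
    by rewrite lerBlDl.
  apply: (@le_trans _ _ ((K.+1)%:R ^+ d)); first by rewrite -natrX ler_nat.
  have h3 : 1 <= (N%:R / s) * eta n.
    by rewrite mulrAC ler_pdivlMr// mul1r.
  rewrite lerXn2r ?nnegrE ?ler0n//.
    by rewrite mulr_ge0// ?divr_ge0 ?(ltW s0)// addr_ge0// mulr_ge0// ltW.
  rewrite -natr1 (_ : _ * _ = (N%:R / s) * (r n + 2 * eta n) + (N%:R / s) * eta n); last by ring.
  by apply: lerD => //; rewrite truncn_le.
have Asum : (N ^ d <= \sum_(n < m) #|A n|)%N.
  have -> : (N ^ d)%N = #|[set: {ffun 'I_d -> 'I_N}]%SET|.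
    by rewrite cardsT card_ffun !card_ord.
  apply: (@leq_trans #|(\bigcup_(n < m) A n)%SET|).
    apply: subset_leq_card; apply/fintype.subsetP => i _.
    have [n nm On] := cov _ (ptbox i).
    by apply/finset.bigcupP; exists (Ordinal nm) => //; rewrite inE; apply/asboolP.
  elim/big_rec2: _ => [|n B1 B2 _ IH]; first by rewrite cards0.
  by apply: leq_trans (leq_card_setU _ _) _; rewrite leq_add2l.
have : (N ^ d)%N%:R <= \sum_(n < m) ((N%:R / s) * (r n + 3 * eta n)) ^+ d.
  apply: (@le_trans _ _ (\sum_(n < m) #|A n|)%N%:R); first by rewrite ler_nat.
  by rewrite natr_sum; apply: ler_sum => n _; exact: Acard.
under eq_bigr do rewrite exprMn.
rewrite -mulr_sumr natrX exprMn exprVn -mulrA.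
rewrite ler_pMr ?exprn_gt0// mulrC ler_pdivlMr ?exprn_gt0// mul1r.
done.
Qed.

Lemma ball_volume_gt0 k : 0 < ball_volume R k.
Proof.
suff : 0 < ball_volume R k /\ 0 < ball_volume R k.+1 by case.
elim: k => [|k [h0 h1]]; first by split => //=; rewrite ltr0n.
split => //=; rewrite mulr_gt0// divr_gt0 ?ltr0n//.
by rewrite mulr_gt0 ?ltr0n// pi_gt0.
Qed.

(** Members of a cover are arbitrary sets, so they are enlarged to open sets by amounts whose total
    is negligible and then counted on a grid. The estimate (r + t)^d <= 2^d (r^d + t) for 0 <= t <=
    1 separates the enlargements from the diameters; the loss of 2^d is harmless for positivity. *)
Lemma hausdorff_cbox_gt0 (a : 'rV[R]_d) (s : R) : (0 < d)%N -> 0 < s ->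
  (0 < hausdorff d (cbox a s))%E.
Proof.
move=> d0 s0.
pose c : R := ball_volume R d / 2 ^+ d.
have c0 : 0 < c by rewrite divr_gt0 ?ball_volume_gt0// exprn_gt0.
(* Half of s^d / 2^d: the enlargements use up at most one half, and the other half remains as a
   lower bound for the sum of the r^d. *)
pose q : R := s ^+ d / 2 ^+ d.+1.
have q0 : 0 < q by rewrite divr_gt0// exprn_gt0.
apply: (@lt_le_trans _ _ (c * q)%:E); first by rewrite lte_fin mulr_gt0.
apply: le_trans (hausdorff_pre_le d _ ltr01).
apply: le_ereal_inf_tmp => _ [F [aF dF] <-].
pose r n : R := if F n == set0 then 0 else fine (diameter (F n)).
have dge0 n x : F n x -> (0 <= diameter (F n))%E.
  by move=> Fx; apply: le_trans (enorm_le_diameter Fx Fx); rewrite lee_fin enorm_ge0.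
have dfin n x : F n x -> diameter (F n) \is a fin_num.
  by move=> Fx; rewrite ge0_fin_numE ?(dge0 _ _ Fx)//; apply: le_lt_trans (dF n) (ltry _).
have r0 n : 0 <= r n.
  rewrite /r; have [//|/set0P[x Fx]] := eqVneq (F n) set0.
  by rewrite fine_ge0// (dge0 _ _ Fx).
have gaugeE n : hausdorff_gauge d (F n) = (c * r n ^+ d)%:E.
  rewrite /hausdorff_gauge /r; have [_|/set0P[x Fx]] := eqVneq (F n) set0.
    by rewrite expr0n gtn_eqF// mulr0.
  by rewrite /= [in RHS]EFinM EFin_expe fineK// (dfin _ _ Fx).
pose kap := Num.min 1 q.
have kap0 : 0 < kap by rewrite lt_min ltr01.
pose eta n : R := kap / 3 / 2 ^+ n.+1.
have eta0 n : 0 < eta n by rewrite !divr_gt0// exprn_gt0.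
have [|m sm] := cbox_cover_sum s0 r0 eta0 aF.
  move=> n x y Fx Fy; rewrite /r ifF; last by apply/eqP => e; rewrite e in Fx.
  by rewrite -lee_fin fineK ?(dfin _ _ Fx)//; exact: enorm_le_diameter.
apply: le_trans (nneseries_lim_ge m _); last by move=> *; exact: hausdorff_gauge_ge0.
rewrite big_mkord; under eq_bigr do rewrite gaugeE.
rewrite sumEFin lee_fin -mulr_sumr ler_wpM2l ?(ltW c0)//.
have eta_sum : \sum_(n < m) 3 * eta n <= q.
  apply: (@le_trans _ _ (kap * (1 - 2^-1 ^+ m))).
    rewrite le_eqVlt; apply/orP; left; apply/eqP.
    elim: (m) => [|i IH]; first by rewrite big_ord0 expr0 subrr mulr0.
    rewrite big_ord_recr/= IH /eta exprVn exprVn [in RHS]exprS [in LHS]exprS.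
    by field; rewrite expf_neq0.
  apply: (@le_trans _ _ kap); last by rewrite ge_min lexx orbT.
  by rewrite ler_piMr ?(ltW kap0)// gerBl exprn_ge0// invr_ge0.
have bnd n : (r n + 3 * eta n) ^+ d <= 2 ^+ d * (r n ^+ d + 3 * eta n).
  have e1 : 3 * eta n <= 1.
    rewrite /eta mulrA mulrCA divff// mulr1 ler_pdivrMr ?exprn_gt0// mul1r.
    apply: (@le_trans _ _ 1); first by rewrite ge_min lexx.
    by rewrite exprn_ege1// ler1n.
  have e0 : 0 <= 3 * eta n by rewrite mulr_ge0// ltW.
  have e2 : (3 * eta n) ^+ d <= 3 * eta n.
    by rewrite -[leRHS]expr1; apply: ler_wiXn2l.
  pose M := Num.max (r n) (3 * eta n).
  have M0 : 0 <= M by rewrite le_max r0.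
  apply: (@le_trans _ _ ((2 * M) ^+ d)).
    rewrite lerXn2r ?nnegrE ?(addr_ge0 (r0 n) e0) ?(mulr_ge0 _ M0)//.
    by rewrite (_ : 2 * M = M + M) ?lerD ?le_max ?lexx ?orbT//; ring.
  rewrite exprMn ler_wpM2l ?exprn_ge0// /M.
  have [_|_] := leP (r n) (3 * eta n); first by apply: (le_trans e2); rewrite lerDr exprn_ge0.
  by rewrite lerDl.
have : s ^+ d <= 2 ^+ d * (\sum_(n < m) r n ^+ d + q).
  apply: (le_trans sm); apply: (@le_trans _ _ (\sum_(n < m) 2 ^+ d * (r n ^+ d + 3 * eta n))).
    by apply: ler_sum => n _; exact: bnd.
  by rewrite -mulr_sumr ler_wpM2l ?exprn_ge0// big_split/= lerD2l.
have -> : s ^+ d = 2 ^+ d * (q + q).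
  by rewrite /q exprS; field; rewrite expf_neq0.
by rewrite ler_pM2l ?exprn_gt0// lerD2r.
Qed.

End HausdorffBox.

(** * Means over parallelepipeds *)

Section Mean.
Context {R : realType} (k d : nat).
Notation X := (caratheodory_type (hausdorff_outer d k : set 'rV[R]_d -> \bar R)).
Notation mu := (hausdorff_measure d k : {measure set X -> \bar R}).

Lemma continuous_measurable_hausdorff (f : 'rV[R]_d -> R) :
  continuous f -> measurable_fun [set: X] (f : X -> R).
Proof.
move=> /continuousP cf _; apply: (measurability _ (RGenOInfty.measurableE R)) => //.
move=> _ [_ [a ->] <-]; rewrite setTI.
by apply: hausdorff_caratheodory_open; apply: cf; exact: interval_open.
Qed.

Lemma measurable_preimage (f : X -> R) (Y : set R) :
  measurable_fun [set: X] f -> measurable Y -> measurable (f @^-1` Y : set X).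
Proof. by move=> mf mY; rewrite -[_ @^-1` _]setTI; exact: mf. Qed.

Lemma measurable_linear (a : 'I_d -> R) :
  measurable_fun [set: X] ((fun x => \sum_j x 0 j * a j) : X -> R).
Proof.
apply: measurable_sum => j; apply: measurable_funM; last exact: measurable_cst.
by apply: continuous_measurable_hausdorff => x; exact: coord_continuous.
Qed.

Lemma measurable_mulmx (m : nat) (A : 'M[R]_(d, m)) l :
  measurable_fun [set: X] ((fun x : 'rV[R]_d => (x *m A) 0 l) : X -> R).
Proof.
rewrite [X in measurable_fun _ X](_ : _ = (fun x : 'rV[R]_d => \sum_j x 0 j * A j l)).
  exact: measurable_linear.
by apply/funext => x; rewrite mxE.
Qed.

Lemma measurable_hausdorff_shift (v : 'rV[R]_d) :
  measurable_fun [set: X] ((fun x => x + v) : X -> X).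
Proof.
move=> _ A mA; rewrite setTI.
suff : (hausdorff_outer d k : set 'rV[R]_d -> \bar R).-caratheodory (shift_set v A) by [].
move=> E.
have h B : hausdorff k (shift_set (- v) B) = hausdorff k B by exact: hausdorff_shift.
have e (B : set 'rV[R]_d) : shift_set (- v) (E `&` [set x | B (x + v)]) =
    shift_set (- v) E `&` B.
  by apply/seteqP; split => x; rewrite /shift_set/= subrK.
rewrite -[LHS](hausdorff_shift k (- v)) (mA (shift_set (- v) E)).
by congr (_ + _)%E; rewrite -e; exact: hausdorff_shift.
Qed.

Lemma integral_hausdorff_shift (v : 'rV[R]_d) (A : set X) (g : X -> R) :
  measurable A -> measurable_fun [set: X] g ->
  mu.-integrable (shift_set v A) (fun x : X => (g (x + v))%:E) ->
  \int[mu]_(x in shift_set v A) (g (x + v : 'rV[R]_d)) = \int[mu]_(x in A) g x.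
Proof.
move=> mA mg ig; have mg' : measurable_fun [set: X] (EFin \o g) by exact/measurable_EFinP.
have H := @integral_pushforward _ _ X X R _ (measurable_hausdorff_shift v) mu A
  (EFin \o g) mg' ig mA.
rewrite /Rintegral; congr fine; refine (etrans (esym H) _).
have e : pushforward mu (fun x : X => x + v : X) = (mu : set X -> \bar R).
  by apply/funext => B; exact: (hausdorff_shift k v B).
exact: (congr1 (fun m : set X -> \bar R => (\int[m]_(y in A) (g y)%:E)%E) e).
Qed.

(** Bounded on the whole space and not just on a cell: the class is then stable under translations
    as well as sums and products, and its members are integrable over every measurable set of finite
    measure. *)
Definition bddmeas (g : 'rV[R]_d -> R) :=
  measurable_fun [set: X] (g : X -> R) /\ exists B, forall x, `|g x| <= B.

Lemma bddmeasD f g : bddmeas f -> bddmeas g -> bddmeas (fun x => f x + g x).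
Proof.
move=> [mf [Bf fB]] [mg [Bg gB]]; split; first exact: measurable_funD.
by exists (Bf + Bg) => x; rewrite (le_trans (ler_normD _ _))// lerD.
Qed.

Lemma bddmeasM f g : bddmeas f -> bddmeas g -> bddmeas (fun x => f x * g x).
Proof.
move=> [mf [Bf fB]] [mg [Bg gB]]; split; first exact: measurable_funM.
by exists (Bf * Bg) => x; rewrite normrM ler_pM.
Qed.

Lemma bddmeas_cst c : bddmeas (fun=> c).
Proof. by split; [exact: measurable_cst|exists `|c|]. Qed.

Lemma bddmeas_sum (I : Type) (s : seq I) (f : I -> 'rV[R]_d -> R) :
  (forall i, bddmeas (f i)) -> bddmeas (fun x => \sum_(i <- s) f i x).
Proof.
move=> nf; elim: s => [|i s IH].
  by rewrite (_ : (fun _ => _) = fun=> 0); [exact: bddmeas_cst|apply/funext => x; rewrite big_nil].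
rewrite (_ : (fun _ => _) = fun x => f i x + \sum_(i <- s) f i x); first exact: bddmeasD.
by apply/funext => x; rewrite big_cons.
Qed.

Lemma bddmeas_shift v f : bddmeas f -> bddmeas (fun x => f (x + v)).
Proof.
move=> [mf [B fB]]; split; last by exists B.
exact: (measurableT_comp mf (measurable_hausdorff_shift v)).
Qed.

Section PBox.
Context (p : 'rV[R]_d) (U : 'M[R]_(k, d)) (fU : row_free U).
Let P : set X := pbox p U.
Let c (x : 'rV[R]_d) : 'rV[R]_k := (x - p) *m pinvmx U.

Lemma pboxE : pbox p U = [set x | p + c x *m U = x /\ forall l, 0 <= c x 0 l < 1].
Proof.
apply/seteqP; split => [_ [t tP <-]|x /= [e cx]]; last by exists (c x).
by rewrite /= /c addrAC subrr add0r mulmxKp.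
Qed.

Lemma pcoord_measurable l : measurable_fun [set: X] ((fun x => c x 0 l) : X -> R).
Proof.
rewrite [X in measurable_fun _ X](_ : _ =
    (fun x : 'rV[R]_d => (x *m pinvmx U) 0 l - (p *m pinvmx U) 0 l)).
  by apply: measurable_funB; [exact: measurable_mulmx|exact: measurable_cst].
by apply/funext => x; rewrite /c mulmxBl !mxE.
Qed.

(** Membership amounts to finitely many conditions on linear functionals: the coordinates read by
    [pinvmx U] lie in [0, 1[, and they reconstruct the point. *)
Lemma measurable_pbox : measurable P.
Proof.
pose A := pinvmx U *m U - 1%:M; pose q := p - p *m pinvmx U *m U.
have hE x : x *m A + q = p + c x *m U - x.
  rewrite /A /q /c; move: (pinvmx U) => V; rewrite mulmxBr mulmx1 !mulmxBl !mulmxA.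
  move: (x *m _ *m U) (p *m _ *m U) => u v.
  by rewrite [LHS]addrC -!addrA [- v + _]addrCA.
have -> : P = (\bigcap_(l in [set: 'I_k]) ((fun x => c x 0 l) @^-1` `[0, 1[)) `&`
    (\bigcap_(j in [set: 'I_d]) ((fun x : 'rV[R]_d => (x *m A) 0 j + q 0 j) @^-1` [set 0])).
  rewrite /P pboxE; apply/seteqP; split => [x [/= e cx]|x [/= cx e]].
    split => [l _ /=|j _ /=]; first by rewrite in_itv/= cx.
    have : (x *m A + q) 0 j = 0 by rewrite hE e subrr mxE.
    by rewrite mxE.
  split => [|l]; last by have := cx l I; rewrite /= in_itv.
  apply/eqP; rewrite -subr_eq0 -hE; apply/eqP/rowP => j.
  by have := e j I; rewrite /= => ej; rewrite [LHS]mxE ej mxE.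
apply: measurableI; apply: fin_bigcap_measurable.
- exact: finite_finset.
- by move=> l _; apply: measurable_preimage; [exact: pcoord_measurable|exact: measurable_itv].
- exact: finite_finset.
- move=> j _.
  have mf : measurable_fun [set: X] ((fun x : 'rV[R]_d => (x *m A) 0 j + q 0 j) : X -> R).
    by apply: measurable_funD; [exact: measurable_mulmx|exact: measurable_cst].
  exact: (measurable_preimage mf (measurable_set1 0)).
Qed.

Lemma pbox_fin : (mu P < +oo)%E.
Proof.
have [B HB] := hausdorff_pbox_bounded U.
exact: le_lt_trans (HB p) (ltry _).
Qed.

(** Not normalised: the measure of the cell remains as a factor in what follows. *)
Definition mean (g : 'rV[R]_d -> R) : R := \int[mu]_(x in P) (g : X -> R) x.

Lemma bddmeas_integrable_on (A : set X) g : measurable A -> (mu A < +oo)%E -> bddmeas g ->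
  mu.-integrable A (EFin \o (g : X -> R)).
Proof.
move=> mA Afin [mg [B gB]]; apply: measurable_bounded_integrable => //.
  exact: measurable_funTS.
exists B; split; first exact: num_real.
by move=> M BM x _ /=; rewrite (le_trans (gB x))// ltW.
Qed.

Lemma bddmeas_integrable g : bddmeas g -> mu.-integrable P (EFin \o (g : X -> R)).
Proof. exact: bddmeas_integrable_on measurable_pbox pbox_fin. Qed.

Lemma meanD f g : bddmeas f -> bddmeas g -> mean (fun x => f x + g x) = mean f + mean g.
Proof.
by move=> nf ng; apply: RintegralD; [exact: measurable_pbox|exact: bddmeas_integrable..].
Qed.

Lemma meanZ r g : bddmeas g -> mean (fun x => r * g x) = r * mean g.
Proof.
by move=> ng; apply: RintegralZl; [exact: measurable_pbox|exact: bddmeas_integrable].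
Qed.

Lemma mean_le f g : bddmeas f -> bddmeas g -> {in P, forall x, f x <= g x} -> mean f <= mean g.
Proof.
move=> nf ng fg; apply: le_Rintegral; [exact: measurable_pbox|exact: bddmeas_integrable..|].
by move=> x Px; apply: fg; rewrite inE.
Qed.

Lemma mean_cst r : mean (fun=> r) = r * fine (hausdorff k P).
Proof. by apply: Rintegral_cst; exact: measurable_pbox. Qed.

Lemma mean_sum (I : Type) (s : seq I) (f : I -> 'rV[R]_d -> R) :
  (forall i, bddmeas (f i)) -> mean (fun x => \sum_(i <- s) f i x) = \sum_(i <- s) mean (f i).
Proof.
move=> nf; elim: s => [|i s IH].
  rewrite big_nil -[RHS](mul0r (fine (hausdorff k P))) -mean_cst.
  by congr mean; apply/funext => x; rewrite big_nil.
rewrite big_cons -IH -(meanD (nf i) (bddmeas_sum s nf)).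
by congr mean; apply/funext => x; rewrite big_cons.
Qed.

(** Cut the cell at coordinate 1 - s along edge l. Translation by s carries the lower slab onto the
    part with coordinate at least s, and translation by s - 1 carries the upper slab onto the part
    below s. On the upper slab, periodicity replaces s by s - 1. *)
Lemma mean_shift (l : 'I_k) (s : R) g : bddmeas g ->
  (forall x, g (x + row l U) = g x) -> 0 <= s < 1 ->
  mean (fun x => g (x + s *: row l U)) = mean g.
Proof.
move=> ng gper /andP[s0 s1].
have cshift w x m : c (x + w *: row l U) 0 m = c x 0 m + w * (m == l)%:R.
  rewrite /c addrAC mulmxDl mxE; congr (_ + _).
  by rewrite -scalemxAl rowE mulmxKp// !mxE eqxx.
have pshift w x : (p + c (x + w *: row l U) *m U = x + w *: row l U) <->
    (p + c x *m U = x).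
  have -> : c (x + w *: row l U) *m U = c x *m U + w *: row l U.
    by rewrite /c addrAC mulmxDl mulmxDl; congr (_ + _); rewrite -!scalemxAl rowE mulmxKp.
  by rewrite addrA; split => [/addIr|->].
have mlt (a : R) : measurable (P `&` (fun x => c x 0 l) @^-1` `]-oo, a[).
  apply: measurableI; first exact: measurable_pbox.
  by apply: measurable_preimage; [exact: pcoord_measurable|exact: measurable_itv].
have mge (a : R) : measurable (P `&` (fun x => c x 0 l) @^-1` `[a, +oo[).
  apply: measurableI; first exact: measurable_pbox.
  by apply: measurable_preimage; [exact: pcoord_measurable|exact: measurable_itv].
have Pfin (B : set X) : measurable B -> B `<=` P -> (mu B < +oo)%E.
  move=> mB BP; apply: le_lt_trans pbox_fin.
  by apply: le_measure => //; rewrite inE; [|exact: measurable_pbox].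
have split_P (a : R) h : bddmeas h -> mean h =
    \int[mu]_(x in P `&` (fun x => c x 0 l) @^-1` `]-oo, a[) (h : X -> R) x +
    \int[mu]_(x in P `&` (fun x => c x 0 l) @^-1` `[a, +oo[) (h : X -> R) x.
  move=> nh; have PU : P = (P `&` (fun x => c x 0 l) @^-1` `]-oo, a[) `|`
      (P `&` (fun x => c x 0 l) @^-1` `[a, +oo[).
    rewrite -setIUr; apply/esym/setIidPl => x _ /=; rewrite !in_itv/= andbT.
    by have [|] := ltP (c x 0 l) a; [left|right].
  rewrite /mean [in LHS]PU; apply: Rintegral_setU => //.
    by rewrite -PU; exact: bddmeas_integrable.
  apply/disj_setPS => x [[_ /=]]; rewrite in_itv/= => h1 [_ /=]; rewrite in_itv/= andbT.
  by rewrite leNgt h1.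
have slab_lt : shift_set (s *: row l U) (P `&` (fun x => c x 0 l) @^-1` `[s, +oo[) =
    P `&` (fun x => c x 0 l) @^-1` `]-oo, 1 - s[.
  rewrite /P pboxE /shift_set; apply/seteqP; split => x /=.
    rewrite !in_itv/= andbT => -[[/pshift e cx] cl]; have := cx l; rewrite cshift eqxx mulr1 => cxl.
    split; last by lra.
    split => // m; have := cx m; rewrite cshift.
    case: eqVneq => [->|_]; last by rewrite mulr0 addr0.
    by rewrite cshift eqxx mulr1 in cl; rewrite mulr1 => ?; lra.
  rewrite !in_itv/= andbT => -[[e cx] cl]; have cxl := cx l.
  split; last by rewrite cshift eqxx mulr1; lra.
  split; first exact/pshift.
  move=> m; rewrite cshift; case: eqVneq => [->|_]; last by rewrite mulr0 addr0.
  by rewrite mulr1; lra.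
have slab_ge : shift_set ((s - 1) *: row l U) (P `&` (fun x => c x 0 l) @^-1` `]-oo, s[) =
    P `&` (fun x => c x 0 l) @^-1` `[1 - s, +oo[.
  rewrite /P pboxE /shift_set; apply/seteqP; split => x /=.
    rewrite !in_itv/= andbT => -[[/pshift e cx] cl]; have := cx l; rewrite cshift eqxx mulr1 => cxl.
    split; last by lra.
    split => // m; have := cx m; rewrite cshift.
    case: eqVneq => [->|_]; last by rewrite mulr0 addr0.
    by rewrite cshift eqxx mulr1 in cl; rewrite mulr1 => ?; lra.
  rewrite !in_itv/= andbT => -[[e cx] cl]; have cxl := cx l.
  split; last by rewrite cshift eqxx mulr1; lra.
  split; first exact/pshift.
  move=> m; rewrite cshift; case: eqVneq => [->|_]; last by rewrite mulr0 addr0.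
  by rewrite mulr1; lra.
have nsg w := bddmeas_shift (w *: row l U) ng.
rewrite (split_P (1 - s) _ (nsg s)) (split_P s _ ng) addrC.
congr (_ + _).
- have I1 : mu.-integrable (shift_set ((s - 1) *: row l U)
      (P `&` (fun x => c x 0 l) @^-1` `]-oo, s[))
      (EFin \o (fun x : X => g (x + (s - 1) *: row l U))).
    by rewrite slab_ge; apply: bddmeas_integrable_on => //; apply: Pfin => //; exact: subIsetl.
  refine (etrans _ (integral_hausdorff_shift (mlt s) (proj1 ng) I1)).
  rewrite slab_ge; apply: eq_Rintegral => x _ /=.
  by rewrite -[in RHS]gper -addrA -[X in _ + (_ + X)]scale1r -scalerDl subrK.
- have I2 : mu.-integrable (shift_set (s *: row l U)
      (P `&` (fun x => c x 0 l) @^-1` `[s, +oo[))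
      (EFin \o (fun x : X => g (x + s *: row l U))).
    by rewrite slab_lt; apply: bddmeas_integrable_on => //; apply: Pfin => //; exact: subIsetl.
  refine (etrans _ (integral_hausdorff_shift (mge s) (proj1 ng) I2)).
  by rewrite slab_lt.
Qed.

Lemma mean_cvg (g_ : nat -> 'rV[R]_d -> R) g B : (forall n, bddmeas (g_ n)) -> bddmeas g ->
  (forall n x, `|g_ n x| <= B) -> (forall x, g_ n x @[n --> \oo] --> g x) ->
  mean (g_ n) @[n --> \oo] --> mean g.
Proof.
move=> ng_ ng gB gcvg.
have [] := @dominated_convergence _ X R mu P measurable_pbox
  (fun n x => (g_ n x)%:E) (fun x => (g x)%:E) (fun=> B%:E).
- by move=> n; apply/measurable_EFinP; apply: measurable_funTS; case: (ng_ n).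
- by apply/measurable_EFinP; apply: measurable_funTS; case: ng.
- apply: aeW => x _; apply: cvg_EFin; last exact: gcvg.
  exact: nearW.
- exact: (bddmeas_integrable (bddmeas_cst B)).
- by apply: aeW => x n _; rewrite /= lee_fin.
move=> _ _ h; rewrite /mean /Rintegral.
apply: fine_cvg; rewrite fineK//.
by apply: integrable_fin_num; [exact: measurable_pbox|exact: bddmeas_integrable].
Qed.

End PBox.
End Mean.

Lemma cosD2piz (R : realType) (x : R) (z : int) : cos (x + 2 * pi * z%:~R) = cos x.
Proof.
have cosn (y : R) (n : nat) : cos (y + 2 * pi * n%:R) = cos y.
  rewrite -(periodicn (@cosD2pi R) n y); congr (cos (y + _)).
  by rewrite mulr_natr mulr_natl.
case: z => n; first exact: cosn.
by rewrite -[LHS](cosn _ n.+1) NegzE mulrNz mulrN subrK.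
Qed.

(** * Trigonometric polynomials *)

Section Phase.
Context {R : realType} {d : nat}.
Implicit Types (n m : 'rV[int]_d) (x v : 'rV[R]_d).

Definition phase n x : R := dotp (map_mx intr n) x.

Lemma phaseDr n x v : phase n (x + v) = phase n x + phase n v.
Proof. exact: dotpDr. Qed.

Lemma phaseBl n m x : phase (n - m) x = phase n x - phase m x.
Proof. by rewrite /phase map_mxB dotpBl. Qed.

Lemma phaseDl n m x : phase (n + m) x = phase n x + phase m x.
Proof. by rewrite /phase map_mxD dotpDl. Qed.

Lemma phaseNl n x : phase (- n) x = - phase n x.
Proof. by rewrite /phase map_mxN dotpNl. Qed.

Lemma phaseZr n a x : phase n (a *: x) = a * phase n x.
Proof. exact: dotpZr. Qed.

Lemma phase_int n m : phase n (map_mx intr m) = (dotp n m)%:~R.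
Proof. exact: dotp_intr. Qed.

(** The free angle lets one statement serve both trigonometric functions, a sine being a cosine
    moved by pi / 2. *)
Lemma bddmeas_cos k n (theta : R) : bddmeas k (fun x => cos (phase n x + theta)).
Proof.
split; last by exists 1 => x; exact: cos_max.
apply: (measurableT_comp (continuous_measurable_fun (@continuous_cos R))).
apply: measurable_funD; last exact: measurable_cst.
rewrite [X in measurable_fun _ X](_ : _ = (fun x : 'rV[R]_d => \sum_j x 0 j * (n 0 j)%:~R)).
  exact: measurable_linear.
by apply/funext => x; apply: eq_bigr => j _; rewrite !mxE mulrC.
Qed.

Lemma bddmeas_cos_phase k n : bddmeas k (fun x => cos (phase n x)).
Proof.
by under [X in bddmeas k X]eq_fun do rewrite -[phase n _]addr0; exact: bddmeas_cos.
Qed.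

Lemma bddmeas_sin_phase k n : bddmeas k (fun x => sin (phase n x)).
Proof.
under [X in bddmeas k X]eq_fun do rewrite -cosBpihalf.
exact: bddmeas_cos.
Qed.

End Phase.

Section Orthogonality.
Context {R : realType} (k d : nat) (p : 'rV[R]_d) (u : 'M[int]_(k, d)).
Let U : 'M[R]_(k, d) := (2 * pi) *: map_mx intr u.
Hypothesis fU : row_free U.

Lemma phase_row n l a : phase n (a *: row l U) = 2 * pi * a * (dotp n (row l u))%:~R.
Proof.
rewrite /U (_ : row l _ = (2 * pi) *: map_mx intr (row l u)); last first.
  by apply/rowP => j; rewrite !mxE.
by rewrite !phaseZr phase_int; ring.
Qed.

(** With q the integer n . u_l, translation along edge l by s = 1 / (2 |q|) adds pi or - pi to the
    phase and so changes the sign of the cosine, while the mean does not move. As q is a nonzero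
    integer, s <= 1 / 2 is an admissible step. *)
Lemma mean_cos_eq0 n l (theta : R) : dotp n (row l u) != 0 ->
  mean p U (fun x => cos (phase n x + theta)) = 0.
Proof.
set q := dotp _ _ => q0.
have qR : (q%:~R != 0 :> R) by rewrite intr_eq0.
pose s : R := (2 * `|q%:~R|)^-1.
have q1 : 1 <= `|q%:~R| :> R by rewrite -intr_norm ler1z; lia.
have sP : 0 <= s < 1.
  rewrite invr_ge0 mulr_ge0//= invf_lt1 ?mulr_gt0 ?normr_gt0//.
  by lra.
have h per := mean_shift p fU (l := l) (s := s) (bddmeas_cos k n theta) per sP.
have {h}e : mean p U (fun x => cos (phase n (x + s *: row l U) + theta)) =
    mean p U (fun x => cos (phase n x + theta)).
  apply: h => x; rewrite -[row l U]scale1r phaseDr phase_row mulr1 -/q.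
  by rewrite addrAC cosD2piz.
have e2 : (fun x => cos (phase n (x + s *: row l U) + theta)) =
    (fun x => -1 * cos (phase n x + theta)).
  apply/funext => x; rewrite phaseDr phase_row -/q addrAC mulN1r.
  have -> : 2 * pi * s * q%:~R = Num.sg q%:~R * pi :> R.
    rewrite [in LHS](numEsg q%:~R) /s; field; rewrite normr_eq0 //.
  have [->|->] : Num.sg q%:~R = 1 :> R \/ Num.sg q%:~R = -1 :> R.
  - have [qn|qp|qe] := ltgtP (q%:~R : R) 0; first by right; exact: ltr0_sg.
      by left; exact: gtr0_sg.
    by rewrite qe eqxx in qR.
  - by rewrite mul1r cosDpi.
  - by rewrite mulN1r cosB cospi sinpi; ring.
move: e; rewrite e2 (meanZ p fU _ (bddmeas_cos k n theta)).
by move=> h; lra.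
Qed.

Lemma mean_cos_phase_eq0 n l : dotp n (row l u) != 0 ->
  mean p U (fun x => cos (phase n x)) = 0.
Proof.
move=> nl; rewrite -(mean_cos_eq0 0 nl); congr mean; apply/funext => x.
by rewrite addr0.
Qed.

Lemma mean_sin_phase_eq0 n l : dotp n (row l u) != 0 ->
  mean p U (fun x => sin (phase n x)) = 0.
Proof.
move=> nl; rewrite -(mean_cos_eq0 (- (pi / 2)) nl); congr mean; apply/funext => x.
by rewrite cosBpihalf.
Qed.

Let trig (al be : 'rV[int]_d -> R) n x := al n * cos (phase n x) + be n * sin (phase n x).

(* F = Re (sum_n c_n e^{i n.x}) with c_n = al n - i be n; G is the imaginary
   part, and the mean of F^2 + G^2 splits along the classes of frequencies that
   agree on the plane. *)
Lemma mean_sqr_trig_le (s : seq 'rV[int]_d) (al be : 'rV[int]_d -> R) (N : nat) :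
  (forall n, n \in s ->
     count (fun n' => [forall l, dotp (n - n') (row l u) == 0]) s <= N)%N ->
  mean p U (fun x => (\sum_(n <- s) trig al be n x) ^+ 2) <=
  fine (hausdorff k (pbox p U)) * N%:R * \sum_(n <- s) (al n ^+ 2 + be n ^+ 2).
Proof.
move=> sN; set vol := fine _.
have vol0 : 0 <= vol by rewrite fine_ge0// hausdorff_ge0.
pose be' n := - al n; pose F := trig al be; pose G := trig (fun n => be n) be'.
(* The real part of c_n times the conjugate of c_n' times e^{i (n - n') . x}. *)
pose T n n' x := (al n * al n' + be n * be n') * cos (phase (n - n') x) +
  (be n * al n' - al n * be n') * sin (phase (n - n') x).
have TE n n' x : T n n' x = F n x * F n' x + G n x * G n' x.
  rewrite /T /F /G /trig /be' phaseBl cosB sinB; ring.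
have nT n n' : bddmeas k (T n n').
  by apply: bddmeasD; apply: bddmeasM;
    [exact: bddmeas_cst|exact: bddmeas_cos_phase|exact: bddmeas_cst|exact: bddmeas_sin_phase].
have ntrig a b n : bddmeas k (trig a b n).
  by apply: bddmeasD; apply: bddmeasM;
    [exact: bddmeas_cst|exact: bddmeas_cos_phase|exact: bddmeas_cst|exact: bddmeas_sin_phase].
pose rho n := al n ^+ 2 + be n ^+ 2.
have FG n x : F n x ^+ 2 + G n x ^+ 2 = rho n.
  rewrite /F /G /trig /be' /rho -[RHS]mulr1 -(cos2Dsin2 (phase n x)); ring.
have rho0 n : 0 <= rho n by rewrite addr_ge0// sqr_ge0.
pose cl n n' := [forall l, dotp (n - n') (row l u) == 0].
(* Between different classes the mean vanishes. Within a class no cosine is evaluated: pointwise,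
   [T n n'] is at most half the sum of |c_n|^2 and |c_n'|^2. *)
have meanT n n' : mean p U (T n n') <= (cl n n')%:R * (vol * ((rho n + rho n') / 2)).
  case: (boolP (cl n n')) => [_|/forallPn[l nl]].
    rewrite mul1r mulrC -(mean_cst p fU); apply: (mean_le fU (nT n n') (bddmeas_cst k d _)).
    move=> x _; rewrite TE -!(FG _ x).
    have := sqr_ge0 (F n x - F n' x); have := sqr_ge0 (G n x - G n' x).
    by move: (F n x) (F n' x) (G n x) (G n' x) => a b c' e; nra.
  have nc := bddmeas_cos_phase (R := R) k (n - n'); have ns := bddmeas_sin_phase (R :=
    R) k (n - n').
  rewrite mul0r /T (meanD p fU (bddmeasM (bddmeas_cst k d _) nc) (bddmeasM (bddmeas_cst k d _) ns)).
  rewrite (meanZ p fU _ nc) (meanZ p fU _ ns).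
  by rewrite (mean_cos_phase_eq0 nl) (mean_sin_phase_eq0 nl) !mulr0 addr0.
apply: (@le_trans _ _ (mean p U (fun x => \sum_(n <- s) \sum_(n' <- s) T n n' x))).
  have nF : bddmeas k (fun x => \sum_(n <- s) F n x) by apply: bddmeas_sum => n; exact: ntrig.
  have nF2 : bddmeas k (fun x => (\sum_(n <- s) F n x) ^+ 2) := bddmeasM nF nF.
  have nTT : bddmeas k (fun x => \sum_(n <- s) \sum_(n' <- s) T n n' x) :=
    bddmeas_sum s (fun n => bddmeas_sum s (nT n)).
  apply: (mean_le fU nF2 nTT).
  move=> x _; have -> : \sum_(n <- s) \sum_(n' <- s) T n n' x =
      (\sum_(n <- s) F n x) ^+ 2 + (\sum_(n <- s) G n x) ^+ 2.
    rewrite !expr2 !mulr_suml -big_split; apply: eq_bigr => n _ /=.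
    rewrite !mulr_sumr -big_split; apply: eq_bigr => n' _ /=; exact: TE.
  by rewrite lerDl sqr_ge0.
rewrite (mean_sum p fU s (fun n => bddmeas_sum s (nT n))).
under eq_bigr do rewrite (mean_sum p fU s (nT _)).
apply: (@le_trans _ _ (\sum_(n <- s) \sum_(n' <- s) (cl n n')%:R * (vol * ((rho n + rho n') / 2)))).
  by apply: ler_sum => n _; apply: ler_sum => n' _; exact: meanT.
have clC n n' : cl n n' = cl n' n.
  by apply: eq_forallb => l; rewrite -opprB dotpNl oppr_eq0.
have half : \sum_(n <- s) \sum_(n' <- s) (cl n n')%:R * rho n <= N%:R * \sum_(n <- s) rho n.
  rewrite mulr_sumr big_seq [leRHS]big_seq; apply: ler_sum => n ns.
  rewrite -mulr_suml ler_wpM2r// -natr_sum ler_nat.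
  apply: leq_trans (sN n ns); rewrite -sum1_count [in leqRHS]big_mkcond.
  by apply: leq_sum => n' _; rewrite /cl; case: ifP.
have half' : \sum_(n <- s) \sum_(n' <- s) (cl n n')%:R * rho n' <= N%:R * \sum_(n <- s) rho n.
  rewrite exchange_big /=; apply: le_trans half.
  by apply: ler_sum => n _; apply: ler_sum => n' _; rewrite clC.
rewrite (_ : \sum_(n <- s) _ = vol * (2^-1 * (\sum_(n <- s) \sum_(n' <- s) (cl n n')%:R * rho n +
   \sum_(n <- s) \sum_(n' <- s) (cl n n')%:R * rho n'))); last first.
  rewrite -big_split/= !mulr_sumr; apply: eq_bigr => n _.
  rewrite -big_split/= !mulr_sumr; apply: eq_bigr => n' _; by field.
rewrite -mulrA ler_wpM2l//; move: half half'; rewrite /rho.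
by move: (\sum_(n <- s) _) => a; move: (\sum_(n <- s) _) => b h1 h2; lra.
Qed.

End Orthogonality.

(** * Fourier coefficients of eigenfunctions *)

Section LineDerivative.
Context {R : realType} {d : nat}.
Implicit Types (f g : 'rV[R]_d -> R) (x v : 'rV[R]_d).

(** Brings directional derivatives under the calculus of one real variable, namely the chain rule
    and the mean value theorem. *)
Lemma is_derive_line f x v l (s : R) : is_derive (x + s *: v) v f l <->
  is_derive s 1 (fun s : R => f (x + s *: v)) l.
Proof.
have e : (fun h : R => h^-1 *: ((f \o shift (x + s *: v)) (h *: v) - f (x + s *: v))) =
    (fun h : R => h^-1 *: (((fun s : R => f (x + s *: v)) \o shift s) (h *: 1) - f (x + s *: v))).
  apply/funext => h; congr (_ *: (f _ - _)) => /=.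
  by rewrite [h *: 1]mulr1 scalerDl addrCA.
split => -[h1 h2]; apply: DeriveDef.
- by rewrite /derivable -e.
- by rewrite /derive -e.
- by rewrite /derivable e.
- by rewrite /derive e.
Qed.

(** The derivative is written as a cosine whose angle is advanced by pi / 2, so that shifted cosines
    form a family closed under differentiation. *)
Lemma is_derive_cos_phase (n : 'rV[int]_d) (theta : R) x v :
  is_derive x v (fun x => cos (phase n x + theta))
    (phase n v * cos (phase n x + (theta + pi / 2))).
Proof.
rewrite -[x in is_derive x](addr0 x) -(scale0r v); apply/is_derive_line.
rewrite [X in is_derive _ _ X _](_ : _ = cos \o (fun s : R =>
  phase n v * s + (phase n x + theta))); last first.
  by apply/funext => s /=; rewrite phaseDr phaseZr; congr cos; ring.
have L : is_derive (0 : R) 1 (fun s : R => phase n v * s + (phase n x + theta)) (phase n v).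
  rewrite [X in is_derive _ _ X _](_ : _ = (phase n v *: id + cst (phase n x + theta))) //.
  by apply: is_derive_eq; rewrite addr0 [_ *: _]mulr1.
have /is_derive_eq := is_derive1_comp (is_derive_cos _) L; apply.
by rewrite mulr0 add0r addrA cosDpihalf; ring.
Qed.

Lemma continuous_sum (T : topologicalType) (I : Type) (s : seq I) (f : I -> T -> R) :
  (forall i, continuous (f i)) -> continuous (fun t => \sum_(i <- s) f i t).
Proof.
move=> cf; elim: s => [|i s IH] t.
  by under eq_fun do rewrite big_nil; exact: cst_continuous.
by under eq_fun do rewrite big_cons; apply: cvgD; [exact: cf|exact: IH].
Qed.

Lemma continuous_phase (n : 'rV[int]_d) : continuous (phase n : 'rV[R]_d -> R).
Proof.
apply: continuous_sum => j x.
by apply: continuousM; [exact: cst_continuous|exact: coord_continuous].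
Qed.

Lemma continuous_cos_phase (n : 'rV[int]_d) theta :
  continuous (fun x : 'rV[R]_d => cos (phase n x + theta)).
Proof.
move=> x; apply: (@continuous_comp _ _ _ (fun x => phase n x + theta) cos).
  by apply: continuousD; [exact: continuous_phase|exact: cst_continuous].
exact: continuous_cos.
Qed.

End LineDerivative.

(** * Means over the torus: translation invariance and integration by parts *)

Section Torus.
Context {R : realType} {d : nat}.
Implicit Types (f g : 'rV[R]_d -> R) (x v : 'rV[R]_d) (n m : 'rV[int]_d).

Definition periodic2pi f :=
  forall x (n : 'rV[int]_d), f (x + (2 * pi) *: map_mx intr n) = f x.

(** Edges given by an integer matrix, here the identity, so that the results on means over
    parallelepipeds apply to the torus itself. *)
Let U : 'M[R]_(d, d) := (2 * pi) *: map_mx intr (1%:M : 'M[int]_d).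

Lemma twopi_gt0 : 0 < 2 * pi :> R.
Proof. by rewrite mulr_gt0// pi_gt0. Qed.

Lemma row_free_torus : row_free U.
Proof.
rewrite row_free_unit /U map_mx1 scalemx1.
by rewrite unitmxE det_scalar unitrX// unitfE gt_eqF// twopi_gt0.
Qed.

Lemma row_torus l : row l U = (2 * pi) *: map_mx intr (delta_mx 0 l : 'rV[int]_d).
Proof. by apply/rowP => j; rewrite !mxE eqxx/= eq_sym. Qed.

Lemma torus_cellE : @torus_cell R d = pbox 0 U.
Proof.
apply/seteqP; split => [x xP|_ [t tP <-] j].
  exists ((2 * pi)^-1 *: x).
    move=> l /=; rewrite mxE; have /andP[x0 x1] := xP l.
    by rewrite mulr_ge0 ?invr_ge0 ?(ltW twopi_gt0)//= mulrC ltr_pdivrMr ?twopi_gt0// mul1r.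
  rewrite add0r /U map_mx1 -scalemxAr mulmx1 scalerA divff ?scale1r//.
  by rewrite gt_eqF// twopi_gt0.
rewrite add0r /U map_mx1 -scalemxAr mulmx1 mxE.
have /andP[t0 t1] := tP j.
by rewrite mulr_ge0 ?(ltW twopi_gt0)//= -[ltRHS]mulr1 ltr_pM2l// twopi_gt0.
Qed.

Definition tmean f : R := mean 0 U f.

Lemma tmean_cos_eq0 n : n != 0 -> tmean (fun x => cos (phase n x)) = 0.
Proof.
move=> n0; have [l nl] : exists l, n 0 l != 0.
  apply/existsP; apply: contraNT n0 => /existsPn h; apply/eqP/rowP => l.
  by have := h l; rewrite negbK mxE => /eqP.
apply: (mean_cos_phase_eq0 _ row_free_torus (l := l)).
rewrite /dotp (bigD1 l)//= big1 ?addr0 ?mxE ?eqxx ?mulr1// => j jl.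
by rewrite !mxE eq_sym (negbTE jl) mulr0.
Qed.

Lemma tmean_sin_eq0 n : tmean (fun x => sin (phase n x)) = 0.
Proof.
have [->|n0] := eqVneq n 0.
  rewrite /tmean -[RHS](mul0r (fine (hausdorff d (pbox 0 U)))).
  rewrite -(mean_cst 0 row_free_torus); congr mean; apply/funext => x.
  by rewrite /phase map_mx0 /dotp big1 ?sin0// => j _; rewrite mxE mul0r.
have [l nl] : exists l, n 0 l != 0.
  apply/existsP; apply: contraNT n0 => /existsPn h; apply/eqP/rowP => l.
  by have := h l; rewrite negbK mxE => /eqP.
apply: (mean_sin_phase_eq0 _ row_free_torus (l := l)).
rewrite /dotp (bigD1 l)//= big1 ?addr0 ?mxE ?eqxx ?mulr1// => j jl.
by rewrite !mxE eq_sym (negbTE jl) mulr0.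
Qed.

(** The admissible translations are closed under addition and contain the periods and the fractional
    steps along each edge. Every vector is a sum of these, by splitting each coordinate into its
    integral and fractional parts. *)
Lemma tmean_shift f v : bddmeas d f -> periodic2pi f ->
  tmean (fun x => f (x + v)) = tmean f.
Proof.
move=> nf pf.
pose S v := forall g, bddmeas d g -> periodic2pi g -> tmean (fun x => g (x + v)) = tmean g.
have S0 : S 0 by move=> g _ _; congr mean; apply/funext => x; rewrite addr0.
have SD v1 v2 : S v1 -> S v2 -> S (v1 + v2).
  move=> S1 S2 g ng pg; rewrite -(S2 g ng pg) -(S1 (fun x => g (x + v2))).
  - by congr mean; apply/funext => x; rewrite addrA.
  - exact: bddmeas_shift.
  - by move=> x n; rewrite addrAC pg.
have Sper n : S ((2 * pi) *: map_mx intr n).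
  by move=> g ng pg; congr mean; apply/funext => x; rewrite pg.
have Srow l s : 0 <= s < 1 -> S (s *: row l U).
  move=> s01 g ng pg; apply: (mean_shift 0 row_free_torus ng _ s01) => x.
  by rewrite row_torus pg.
suff : S v by apply.
have -> : v = \sum_l (v 0 l / (2 * pi)) *: row l U.
  apply/rowP => j; rewrite summxE (bigD1 j)//= big1 ?addr0 => [|l lj].
    by rewrite !mxE eqxx mulr1 divfK// gt_eqF// twopi_gt0.
  by rewrite !mxE (negbTE lj) !mulr0.
elim/big_ind: _ => // l _.
set a := _ / _; rewrite (_ : a *: _ = (a - (Num.floor a)%:~R) *: row l U +
    (2 * pi) *: map_mx intr ((Num.floor a) *: delta_mx 0 l)).
  apply: SD => //; apply: Srow; rewrite subr_ge0 floor_le/= ltrBlDl.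
  by have := floorD1_gt a; rewrite intrD.
rewrite row_torus scalerBl -[in LHS](subrK ((Num.floor a)%:~R *: ((2 * pi) *: map_mx intr
  (delta_mx 0 l))) (a *: _)).
by congr (_ + _); apply/rowP => j; rewrite !mxE rmorphM/=; ring.
Qed.

Lemma periodic_bounded f : continuous f -> periodic2pi f -> exists B, forall x, `|f x| <= B.
Proof.
move=> cf pf.
have : bounded_set (f @` cbox 0 (2 * pi)).
  apply: compact_bounded; apply: continuous_compact; last exact: cbox_compact.
  exact: continuous_subspaceT.
move=> [B [_ HB]]; exists (B + 1) => x.
pose n : 'rV[int]_d := \row_j - Num.floor (x 0 j / (2 * pi)).
rewrite -(pf x n); apply: (HB (B + 1)); first by rewrite ltrDl.
exists (x + (2 * pi) *: map_mx intr n) => // j; rewrite !mxE add0r.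
have h1 : (Num.floor (x 0 j / (2 * pi)))%:~R <= x 0 j / (2 * pi) by exact: floor_le.
have h2 : x 0 j / (2 * pi) < (Num.floor (x 0 j / (2 * pi)))%:~R + 1.
  by have := floorD1_gt (x 0 j / (2 * pi)); rewrite intrD.
rewrite ler_pdivlMr ?twopi_gt0// in h1; rewrite ltr_pdivrMr ?twopi_gt0// in h2.
by rewrite mulrNz; lra.
Qed.

Lemma bddmeas_periodic f : continuous f -> periodic2pi f -> bddmeas d f.
Proof.
move=> cf pf; split; first exact: continuous_measurable_hausdorff.
exact: periodic_bounded.
Qed.

(** The difference quotients of [f] along [v] have mean zero by translation invariance. The mean
    value theorem bounds them by the supremum of |g|, and they converge to [g] pointwise, so
    dominated convergence applies. *)
Lemma tmean_derive f g v : continuous f -> periodic2pi f -> continuous g ->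
  (forall x, is_derive x v f (g x)) -> tmean g = 0.
Proof.
move=> cf pf cg dfg.
have pg : periodic2pi g.
  move=> x n; have [_ <-] := dfg x; have [_ <-] := dfg (x + (2 * pi) *: map_mx intr n).
  rewrite /derive (_ : (fun h => _) = fun h => h^-1 *: ((f \o shift x) (h *: v) - f x))//.
  by apply/funext => h /=; rewrite addrA !pf.
have nf := bddmeas_periodic cf pf; have ng := bddmeas_periodic cg pg.
have [B gB] := periodic_bounded cg pg.
pose g_ (i : nat) x : R := (harmonic i)^-1 * (f (x + harmonic i *: v) + -1 * f x).
have ng_ i : bddmeas d (g_ i).
  apply: bddmeasM; first exact: bddmeas_cst.
  by apply: bddmeasD; [exact: bddmeas_shift|apply: bddmeasM; [exact: bddmeas_cst|]].
have h0 i : 0 < harmonic i :> R by rewrite /harmonic /= invr_gt0.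
have g_B i x : `|g_ i x| <= B.
  have der (s : R) : is_derive s 1 (fun s : R => f (x + s *: v)) (g (x + s *: v)).
    by apply/is_derive_line; exact: dfg.
  have cont : {within `[0, harmonic i], continuous (fun s : R => f (x + s *: v))}.
    apply: derivable_within_continuous => s _; exact: (@ex_derive _ _ _ _ _ _ _ (der s)).
  have [c _ e] := @MVT _ (fun s : R => f (x + s *: v)) (fun s => g (x + s *: v)) 0
    (harmonic i) (h0 i) (fun s _ => der s) cont.
  rewrite /g_ mulN1r; rewrite scale0r addr0 subr0 in e.
  by rewrite e mulrC mulfK ?gt_eqF.
have g_cvg x : g_ i x @[i --> \oo] --> g x.
  have [dx dv] := dfg x; rewrite -dv /derive.
  have hh : harmonic i @[i --> \oo] --> (0 : R)^'.
    move=> A A0.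
    have h : \forall i \near \oo, harmonic i != 0 :> R -> A (harmonic i) := @cvg_harmonic R _ A0.
    have : \forall i \near \oo, A (harmonic i).
      by apply: filterS h => i; apply; exact: lt0r_neq0 (h0 i).
    exact.
  have := cvg_comp _ _ hh dx; rewrite (_ : (fun i => g_ i x) = (fun h =>
    h^-1 *: ((f \o shift x) (h *: v) - f x)) \o harmonic)//.
  by apply/funext => i; rewrite /g_ /= mulN1r (addrC x).
have m0 i : tmean (g_ i) = 0.
  rewrite /tmean /g_ (meanZ 0 row_free_torus); last first.
    by apply: bddmeasD; [exact: bddmeas_shift|apply: bddmeasM; [exact: bddmeas_cst|]].
  rewrite (meanD 0 row_free_torus (bddmeas_shift _ nf) (bddmeasM (bddmeas_cst d d _) nf)).
  rewrite (meanZ 0 row_free_torus _ nf) -[X in X + _]/(tmean _) tmean_shift//.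
  by rewrite /tmean mulN1r subrr mulr0.
have lim1 : tmean (g_ i) @[i --> \oo] --> tmean g.
  exact: (@mean_cvg R d d 0 U row_free_torus g_ g B ng_ ng g_B g_cvg).
have lim2 : tmean (g_ i) @[i --> \oo] --> (0 : R).
  by under eq_fun do rewrite m0; exact: cvg_cst.
exact: (cvg_unique _ lim1 lim2).
Qed.

End Torus.

Section EigenCoefficients.
Context {R : realType} {d : nat}.
Implicit Types (f g : 'rV[R]_d -> R) (x v : 'rV[R]_d) (n m : 'rV[int]_d).

Lemma tmeanD f g : bddmeas d f -> bddmeas d g ->
  tmean (fun x => f x + g x) = tmean f + tmean g.
Proof. by move=> nf ng; exact: (meanD 0 row_free_torus nf ng). Qed.

Lemma tmeanZ r f : bddmeas d f -> tmean (fun x => r * f x) = r * tmean f.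
Proof. by move=> nf; exact: (meanZ 0 row_free_torus r nf). Qed.

Lemma tmean_sum (I : Type) (s : seq I) (f : I -> 'rV[R]_d -> R) :
  (forall i, bddmeas d (f i)) -> tmean (fun x => \sum_(i <- s) f i x) = \sum_(i <- s) tmean (f i).
Proof. by move=> nf; exact: (mean_sum 0 row_free_torus s nf). Qed.

Lemma periodic_cos_phase n (theta : R) :
  periodic2pi (fun x : 'rV[R]_d => cos (phase n x + theta)).
Proof.
by move=> x m; rewrite phaseDr phaseZr phase_int addrAC cosD2piz.
Qed.

Lemma periodic_derive f v : periodic2pi f -> periodic2pi ('D_v f).
Proof.
move=> pf x n.
rewrite /derive (_ : (fun h => _) = fun h => h^-1 *: ((f \o shift x) (h *: v) - f x))//.
by apply/funext => h /=; rewrite addrA !pf.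
Qed.

(** Green's identity in one direction: with w the cosine and w' its derivative along e_j, the
    derivative of (D f) w - f w' is (D^2 f) w + n_j^2 f w, because w'' = - n_j^2 w. A derivative has
    mean zero. *)
Lemma tmean_derive2 f (j : 'I_d) n (theta : R) : C2 f -> periodic2pi f ->
  tmean (fun x => 'D_(unit_vec j) ('D_(unit_vec j) f) x * cos (phase n x + theta)) =
  - (n 0 j)%:~R ^+ 2 * tmean (fun x => f x * cos (phase n x + theta)).
Proof.
move=> [cf df cdf ddf cddf] pf; set e := unit_vec j.
pose q : R := (n 0 j)%:~R; pose w t (x : 'rV[R]_d) := cos (phase n x + t).
have phe : phase n e = q.
  rewrite /phase /dotp (bigD1 j)//= big1 ?addr0 => [|i ij].
    by rewrite !mxE !eqxx mulr1.
  by rewrite !mxE (negbTE ij) andbF mulr0.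
have dw t x : is_derive x e (w t) (q * w (t + pi / 2) x).
  by rewrite -phe; exact: is_derive_cos_phase.
have cw t : continuous (w t) by exact: continuous_cos_phase.
have pw t : periodic2pi (w t) by exact: periodic_cos_phase.
have w2 t x : w (t + pi / 2 + pi / 2) x = - w t x.
  by rewrite /w -cosDpi; congr cos; field.
have pdf := periodic_derive e pf; have pddf := periodic_derive e pdf.
have nw t : bddmeas d (w t) by exact: bddmeas_cos.
have nf := bddmeas_periodic cf pf.
have nddf := bddmeas_periodic (cddf j j) pddf.
pose g := ('D_e f * w theta) - (f * (fun x => q * w (theta + pi / 2) x)).
pose G x := 'D_e ('D_e f) x * w theta x + q ^+ 2 * (f x * w theta x).
have G0 : tmean G = 0.
  apply: (@tmean_derive _ _ g G e).
  - move=> x; apply: continuousB; apply: continuousM.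
    + exact: cdf.
    + exact: cw.
    + exact: cf.
    + by apply: continuousM; [exact: cst_continuous|exact: cw].
  - by move=> x m; rewrite /g !fctE pdf pf !pw.
  - have cG1 : continuous (fun x => 'D_e ('D_e f) x * w theta x).
      by move=> x; exact: (continuousM (cddf j j x) (cw theta x)).
    have cG2 : continuous (fun x => q ^+ 2 * (f x * w theta x)).
      move=> x; have c1 := continuousM (cf x) (cw theta x).
      have c0 : {for x, continuous (fun _ : 'rV[R]_d => q ^+ 2)} by exact: cst_continuous.
      exact: (continuousM c0 c1).
    by move=> x; exact: (continuousD (cG1 x) (cG2 x)).
  move=> x.
  have d1 : is_derive x e ('D_e f) ('D_e ('D_e f) x) by apply: derivableP; exact: ddf.
  have d2 : is_derive x e f ('D_e f x) by apply: derivableP; exact: df.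
  have d3 := dw theta x.
  have d4 : is_derive x e (fun x => q * w (theta + pi / 2) x)
    (q * (q * w (theta + pi / 2 + pi / 2) x)).
    exact: (is_deriveZ q (dw (theta + pi / 2) x)).
  have := is_deriveB (is_deriveM d1 d3) (is_deriveM d2 d4).
  move=> /is_derive_eq; apply.
  by rewrite w2 /G /GRing.scale/=; ring.
have nfw := bddmeasM nf (nw theta); have nddfw := bddmeasM nddf (nw theta).
have := tmeanD nddfw (bddmeasM (bddmeas_cst d d (q ^+ 2)) nfw).
rewrite -/(tmean G) (tmeanZ _ nfw) => h.
have {}h : tmean G = tmean (fun x => 'D_e ('D_e f) x * w theta x) +
    q ^+ 2 * tmean (fun x => f x * w theta x) := h.
by apply/eqP; rewrite mulNr -addr_eq0 -h G0.
Qed.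

(** Summing the one-direction identity over j gives |n|^2 T = lambda^2 T for the coefficient T. *)
Lemma eigen_coef_eq0 f (lam : R) n (theta : R) : C2 f -> periodic2pi f ->
  (forall x, - laplacian f x = lam ^+ 2 * f x) ->
  (dotp n n)%:~R != lam ^+ 2 ->
  tmean (fun x => f x * cos (phase n x + theta)) = 0.
Proof.
move=> C2f pf ef nl; set T := tmean _.
have [cf _ cdf _ cddf] := C2f.
have nw := bddmeas_cos (R := R) d n theta; have nfw := bddmeasM (bddmeas_periodic cf pf) nw.
have nddf j := bddmeas_periodic (cddf j j) (periodic_derive (unit_vec j)
  (periodic_derive (unit_vec j) pf)).
have : tmean (fun x => \sum_(j < d) 'D_(unit_vec j)
  ('D_(unit_vec j) f) x * cos (phase n x + theta)) =
    - lam ^+ 2 * T.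
  rewrite -tmeanZ//; congr mean; apply/funext => x.
  rewrite -mulr_suml -[\sum_(j < d) _]/(laplacian f x) mulrA; congr (_ * _).
  by rewrite mulNr -ef opprK.
rewrite (tmean_sum _ (fun j => bddmeasM (nddf j) nw)).
under eq_bigr do rewrite (tmean_derive2 _ n theta C2f pf) -/T.
rewrite -mulr_suml sumrN (_ : \sum_(j < d) _ = (dotp n n)%:~R); last first.
  by rewrite /dotp rmorph_sum; apply: eq_bigr => j _; rewrite rmorphM expr2.
move=> /eqP; rewrite -subr_eq0 -mulrBl mulf_eq0 => /orP[|/eqP//].
by rewrite opprK addrC subr_eq0 eq_sym (negbTE nl).
Qed.

End EigenCoefficients.

(** * Completeness of the trigonometric system *)

Section Completeness.
Context {R : realType} {d : nat} (d0 : (0 < d)%N).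
Implicit Types (f g w : 'rV[R]_d -> R) (x v : 'rV[R]_d) (n m : 'rV[int]_d).

Lemma cos_le_cos (a b : R) : 0 <= a -> a <= `|b| -> `|b| <= pi -> cos b <= cos a.
Proof.
move=> a0 ab bpi; rewrite -(cos_norm b) leNgt ltr_cos ?in_itv/= ?a0 ?normr_ge0//.
- by rewrite -leNgt.
- exact: le_trans bpi.
Qed.

Lemma measurable_cbox (k : nat) (a : 'rV[R]_d) (s : R) :
  measurable (cbox a s : set (caratheodory_type (hausdorff_outer d k : set 'rV[R]_d -> \bar R))).
Proof.
have cB : closed (cbox a s) by apply: compact_closed; [exact: norm_hausdorff|exact: cbox_compact].
rewrite -[X in measurable X]setCK; apply: measurableC.
by apply: hausdorff_caratheodory_open; exact: closed_openC.
Qed.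

(** All Fourier coefficients of f w are required to vanish, not just its mean: in this form the
    property survives multiplication of w by a cosine, through the product formula. *)
Definition annihilates f w :=
  bddmeas d w /\ forall n (theta : R), tmean (fun x => f x * w x * cos (phase n x + theta)) = 0.

Lemma annihilates_sum f (I : Type) (s : seq I) (W : I -> 'rV[R]_d -> R) : bddmeas d f ->
  (forall i, annihilates f (W i)) -> annihilates f (fun x => \sum_(i <- s) W i x).
Proof.
move=> nf aW; have nW i := (aW i).1; split; first exact: bddmeas_sum.
move=> n theta.
rewrite (_ : (fun x => _) = fun x => \sum_(i <- s) f x * W i x * cos (phase n x + theta));
  last first.
  by apply/funext => x; rewrite mulr_sumr mulr_suml.
rewrite (tmean_sum s (fun i => bddmeasM (bddmeasM nf (nW i)) (bddmeas_cos d n theta))).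
by rewrite big1// => i _; rewrite (aW i).2.
Qed.

Lemma annihilatesD f w1 w2 : bddmeas d f -> annihilates f w1 -> annihilates f w2 ->
  annihilates f (fun x => w1 x + w2 x).
Proof.
move=> nf [n1 a1] [n2 a2]; split; first exact: bddmeasD.
move=> n theta; have nc := bddmeas_cos (R := R) d n theta.
rewrite -[RHS]addr0 -{1}(a1 n theta) -(a2 n theta).
rewrite -(tmeanD (bddmeasM (bddmeasM nf n1) nc) (bddmeasM (bddmeasM nf n2) nc)).
by congr tmean; apply/funext => x; ring.
Qed.

Lemma annihilatesZ f w (r : R) : bddmeas d f -> annihilates f w ->
  annihilates f (fun x => r * w x).
Proof.
move=> nf [n1 a1]; split; first exact: (bddmeasM (bddmeas_cst d d r) n1).
move=> n theta; have nc := bddmeas_cos (R := R) d n theta.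
rewrite -[RHS](mulr0 r) -(a1 n theta) -(tmeanZ r (bddmeasM (bddmeasM nf n1) nc)).
by congr tmean; apply/funext => x; ring.
Qed.

Lemma annihilatesM_cos f w m (eta : R) : bddmeas d f -> annihilates f w ->
  annihilates f (fun x => w x * cos (phase m x + eta)).
Proof.
move=> nf [nw aw]; have nm := bddmeas_cos (R := R) d m eta; split; first exact: bddmeasM.
move=> n theta.
have n1 := bddmeas_cos (R := R) d (m + n) (eta + theta).
have n2 := bddmeas_cos (R := R) d (m - n) (eta - theta).
have e : 2^-1 * (tmean (fun x => f x * w x * cos (phase (m + n) x + (eta + theta))) +
   tmean (fun x => f x * w x * cos (phase (m - n) x + (eta - theta)))) = 0.
  by rewrite !aw addr0 mulr0.
rewrite -[RHS]e -(tmeanD (bddmeasM (bddmeasM nf nw) n1) (bddmeasM (bddmeasM nf nw) n2)).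
rewrite -(tmeanZ _ (bddmeasD (bddmeasM (bddmeasM nf nw) n1) (bddmeasM (bddmeasM nf nw) n2))).
congr tmean; apply/funext => x; rewrite phaseBl phaseDl.
rewrite (_ : _ + _ + (eta + theta) = (phase m x + eta) + (phase n x + theta)); last by ring.
rewrite (_ : _ - _ + (eta - theta) = (phase m x + eta) - (phase n x + theta)); last by ring.
by move: (phase m x + eta) (phase n x + theta) => a b; rewrite cosD cosB; field.
Qed.

Let ctr : 'rV[R]_d := const_mx pi.

(* A trigonometric polynomial with values in [0, 1], equal to 1 only at ctr on
   the cell; its powers concentrate there. *)
Let bump x : R := 2^-1 + (2 * d%:R)^-1 * \sum_(j < d) cos (x 0 j - pi).

Let dR0 : 0 < d%:R :> R.
Proof. by rewrite ltr0n. Qed.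

Lemma bump_ge0 x : 0 <= bump x.
Proof.
have : - d%:R <= \sum_(j < d) cos (x 0 j - pi).
  rewrite -[d in leLHS]card_ord -sumr_const -sumrN; apply: ler_sum => j _.
  exact: cos_geN1.
rewrite /bump invfM -mulrA -[X in X + _]mulr1 -mulrDr => h.
rewrite mulr_ge0// addrC -lerBlDr sub0r ler_pdivlMl// mulrN1.
exact: h.
Qed.

Lemma bump_le (x : 'rV[R]_d) (j : 'I_d) (a : R) :
  cos (x 0 j - pi) <= a -> bump x <= 1 - (1 - a) / (2 * d%:R).
Proof.
move=> xa; have : \sum_(j < d) cos (x 0 j - pi) <= a + (d%:R - 1).
  rewrite (bigD1 j)//= lerD//.
  have -> : d%:R - 1 = \sum_(i < d | i != j) 1 :> R.
    rewrite sumr_const cardC1 card_ord -subn1 natrB//.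
  by apply: ler_sum => i _; exact: cos_le1.
rewrite /bump => h.
have := ler_wpM2l (ltW (_ : 0 < (2 * d%:R)^-1)) h; rewrite invr_gt0 mulr_gt0// => /(_ isT) {}h.
rewrite -lerBrDl; apply: (le_trans h).
by rewrite le_eqVlt; apply/orP; left; apply/eqP; field; rewrite gt_eqF.
Qed.

Lemma bump_ge (x : 'rV[R]_d) (a : R) :
  (forall j, a <= cos (x 0 j - pi)) -> (1 + a) / 2 <= bump x.
Proof.
move=> xa; have : d%:R * a <= \sum_(j < d) cos (x 0 j - pi).
  rewrite mulr_natl -[d in leLHS]card_ord -sumr_const; apply: ler_sum => j _.
  exact: xa.
rewrite /bump => h.
have := ler_wpM2l (ltW (_ : 0 < (2 * d%:R)^-1)) h; rewrite invr_gt0 mulr_gt0// => /(_ isT) {}h.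
apply: le_trans (lerD (lexx _) h).
by rewrite le_eqVlt; apply/orP; left; apply/eqP; field; rewrite gt_eqF.
Qed.

Lemma annihilates_bump f N : bddmeas d f ->
  (forall n (theta : R), tmean (fun x => f x * cos (phase n x + theta)) = 0) ->
  annihilates f (fun x => bump x ^+ N).
Proof.
move=> nf f0; elim: N => [|N IH].
  split; first exact: bddmeas_cst.
  move=> n theta; rewrite -[RHS](f0 n theta); congr tmean; apply/funext => x.
  by rewrite expr0 mulr1.
have step : annihilates f (fun x => \sum_(j < d) bump x ^+ N *
    cos (phase (delta_mx 0 j) x + - pi)).
  exact: (annihilates_sum _ nf (fun j => annihilatesM_cos _ _ nf IH)).
have := annihilatesD nf (annihilatesZ 2^-1 nf IH) (annihilatesZ (2 * d%:R)^-1 nf step).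
congr annihilates; apply/funext => x; rewrite exprSr [in X in _ = _ * X]/bump mulrDr; congr (_ + _).
  by rewrite mulrC.
rewrite [RHS]mulrCA; congr (_ * _); rewrite mulr_sumr; apply: eq_bigr => j _.
congr (_ * cos (_ - _)).
rewrite /phase /dotp (bigD1 j)//= big1 ?addr0 => [|i ij]; first by rewrite !mxE !eqxx mul1r.
by rewrite !mxE (negbTE ij) andbF mul0r.
Qed.

(** If [f ctr] were positive, the integral of f against the N-th power of [bump], which is zero,
    would be at least a constant times q'^N from a small cube around [ctr], minus a constant times
    q^N from the points far from it. Since q < q', this fails for large N. *)
Lemma fourier_center_le0 f : continuous f -> periodic2pi f ->
  (forall n (theta : R), tmean (fun x => f x * cos (phase n x + theta)) = 0) ->
  f ctr <= 0.
Proof.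
move=> cf pf f0; rewrite leNgt; apply/negP => fc.
have nf := bddmeas_periodic cf pf; have [B fB] := periodic_bounded cf pf.
have B0 : 0 <= B by apply: le_trans (fB 0).
pose delta := f ctr / 2.
have delta0 : 0 < delta by rewrite divr_gt0.
have [eta [eta0 eta1 etaP]] : exists eta : R, [/\ 0 < eta, eta <= 1 &
    forall x, (forall j, `|x 0 j - pi| < eta) -> delta <= f x].
  have : \forall x \near ctr, delta < f x.
    apply: cvgr_gt (cf ctr) _ _; rewrite /delta; lra.
  move=> /nbhs_ballP[e /= e0 eP]; exists (Num.min 1 e); split.
  - by rewrite lt_min ltr01.
  - by rewrite ge_min lexx.
  move=> x xe; apply/ltW/eP; rewrite -ball_normE /= [ltLHS]mx_normrE.
  apply/bigmax_ltP; split => // -[i j] _ /=; rewrite !mxE ord1 distrC.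
  by have := xe j; rewrite lt_min => /andP[].
have pi2 : 2 <= pi :> R by exact: pi_ge2.
have cos_eta : cos eta < 1.
  rewrite -[ltRHS]cos0 ltr_cos ?in_itv/= ?lexx ?pi_ge0 ?(ltW eta0)//=; lra.
(* An upper bound for [bump] on the part of the cell where some coordinate differs from pi by at
   least eta. *)
pose q : R := 1 - (1 - cos eta) / (2 * d%:R).
have d2 : 0 < 2 * d%:R :> R by rewrite mulr_gt0.
have q0 : 0 <= q.
  rewrite subr_ge0 ler_pdivrMr// mul1r.
  have := cos_geN1 eta; have : 1 <= d%:R :> R by rewrite ler1n.
  lra.
have q1 : q < 1 by rewrite gtrBl divr_gt0// subr_gt0.
(* A smaller radius, within which [bump] stays above some q' > q. Between the two radii only the
   positivity of f is used. *)
have [eta' [eta'0 eta'1 eta'P]] : exists eta' : R,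
    [/\ 0 < eta', eta' < eta & 2 * q - 1 < cos eta'].
  have : \forall y \near (0 : R), 2 * q - 1 < cos y.
    apply: cvgr_gt (@continuous_cos R 0) _ _; rewrite cos0; lra.
  move=> /nbhs_ballP[e /= e0 eP]; exists (Num.min eta e / 2).
  have m0 : 0 < Num.min eta e by rewrite lt_min eta0.
  split; first by rewrite divr_gt0.
    apply: (@lt_le_trans _ _ (Num.min eta e)); last by rewrite ge_min lexx.
    by rewrite ltr_pdivrMr// ltr_pMr// ltr1n.
  apply: eP; rewrite -ball_normE /= sub0r normrN ger0_norm ?divr_ge0 ?(ltW m0)//.
  apply: (@lt_le_trans _ _ (Num.min eta e)); last by rewrite ge_min lexx orbT.
  by rewrite ltr_pdivrMr// ltr_pMr// ltr1n.
pose q' : R := (1 + cos eta') / 2.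
have qq' : q < q' by rewrite /q' ltr_pdivlMr//; lra.
have q'0 : 0 < q' by exact: le_lt_trans qq'.
pose a : 'rV[R]_d := const_mx (pi - eta'); pose W' := cbox a (2 * eta').
have W'P x : W' x -> forall j, `|x 0 j - pi| <= eta'.
  by move=> xW j; have := xW j; rewrite !mxE ler_norml; lra.
have W'cell : W' `<=` @torus_cell R d.
  move=> x /W'P xW j; have := xW j; rewrite ler_norml; lra.
pose om := fine (hausdorff d W').
have Pfin := pbox_fin (0 : 'rV[R]_d) ((2 * pi) *: map_mx intr (1%:M : 'M[int]_d)).
rewrite -torus_cellE in Pfin.
have mW' := measurable_cbox d a (2 * eta').
have mcell : measurable (@torus_cell R d : set (caratheodory_type (hausdorff_outer d d : set
  'rV[R]_d -> \bar R))).
  by rewrite torus_cellE; exact: measurable_pbox row_free_torus.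
have om0 : 0 < om.
  apply: fine_gt0; apply/andP; split.
    by apply: hausdorff_cbox_gt0 => //; rewrite mulr_gt0.
  by apply: le_lt_trans Pfin; apply: le_hausdorff.
pose ind x : R := \1_W' x.
have nind : bddmeas d ind.
  split; first exact: measurable_indic.
  by exists 1 => x; rewrite /ind indicE; case: (_ \in _); rewrite ?normr1 ?normr0.
have tind : tmean ind = om.
  rewrite /tmean /mean /Rintegral /om -torus_cellE; congr fine.
  by rewrite integral_indic// setIidl.
pose vol := fine (hausdorff d (@torus_cell R d : set 'rV[R]_d)).
have key N : delta * q' ^+ N * om <= B * vol * q ^+ N.
  have [nb ab] := annihilates_bump N nf f0.
  have : tmean (fun x => f x * bump x ^+ N) = 0.
    rewrite -[RHS](ab 0 0); congr tmean; apply/funext => x.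
    have -> : phase 0 x + 0 = 0 :> R.
      by rewrite addr0 /phase map_mx0 /dotp big1// => j _; rewrite mxE mul0r.
    by rewrite cos0 mulr1.
  have nl := bddmeasD (bddmeasM (bddmeas_cst d d (delta * q' ^+ N)) nind)
    (bddmeas_cst d d (- (B * q ^+ N))).
  have nr := bddmeasM nf nb.
  have : tmean (fun x => delta * q' ^+ N * ind x + - (B * q ^+ N)) <=
      tmean (fun x => f x * bump x ^+ N).
    apply: (mean_le row_free_torus nl nr) => x; rewrite inE -torus_cellE => xc.
    have bx := bump_ge0 x.
    have [xW|xW] := pselect (forall j, `|x 0 j - pi| < eta).
      have fx := etaP x xW.
      have B1 : 0 <= B * q ^+ N by rewrite mulr_ge0// exprn_ge0.
      rewrite /ind indicE; case: (boolP (x \in W')) => [|_].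
        rewrite inE => xW'; rewrite mulr1.
        apply: (@le_trans _ _ (delta * q' ^+ N)); first by rewrite gerDl oppr_le0.
        apply: ler_pM => //; rewrite ?(ltW delta0) ?exprn_ge0 ?(ltW q'0)//.
        rewrite lerXn2r ?nnegrE ?(ltW q'0)//; apply: bump_ge => j.
        rewrite -(cos_norm (_ - _)); apply: cos_le_cos.
        - exact: normr_ge0.
        - rewrite [leRHS]ger0_norm ?(ltW eta'0)//; exact: W'P.
        - rewrite ger0_norm ?(ltW eta'0)//; lra.
      rewrite mulr0 add0r; apply: (@le_trans _ _ 0); first by rewrite oppr_le0.
      by rewrite mulr_ge0 ?exprn_ge0// (le_trans (ltW delta0)).
    move/existsNP: xW => [j /negP]; rewrite -leNgt => xj.
    have bq : bump x <= q.
      apply: (bump_le (j := j)); apply: cos_le_cos (ltW eta0) xj _.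
      by have := xc j; rewrite ler_norml; lra.
    rewrite /ind indicE memNset; last first.
      by move=> /W'P/(_ j) h; move: (le_lt_trans h eta'1); rewrite ltNge xj.
    rewrite mulr0 add0r; apply: lerNnormlW; rewrite normrM.
    apply: ler_pM; rewrite ?normr_ge0 ?fB// ger0_norm ?exprn_ge0//.
    by rewrite lerXn2r ?nnegrE.
  rewrite (tmeanD (bddmeasM (bddmeas_cst d d (delta * q' ^+ N)) nind)
    (bddmeas_cst d d (- (B * q ^+ N)))).
  rewrite (tmeanZ _ nind) tind.
  rewrite -[tmean (fun=> _)]/(mean _ _ _) (mean_cst 0 row_free_torus) -torus_cellE -/vol.
  by move=> h1 h2; rewrite h2 in h1; lra.
have cvg0 : B * vol * ((q / q') ^+ N) @[N --> \oo] --> B * vol * 0.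
  apply: cvgM; first exact: cvg_cst.
  apply: cvg_expr; rewrite ger0_norm ?divr_ge0 ?(ltW q'0)//.
  by rewrite ltr_pdivrMr// mul1r.
have : delta * om <= B * vol * 0.
  apply: (cvgr_to_ge cvg0); apply: nearW => N.
  by rewrite expr_div_n mulrA ler_pdivlMr ?exprn_gt0// mulrAC key.
by rewrite mulr0 leNgt mulr_gt0.
Qed.

End Completeness.

(** * Finite Fourier expansion of an eigenfunction and Parseval's identity *)

Section Expansion.
Context {R : realType} {d : nat} (d0 : (0 < d)%N).
Implicit Types (f g w : 'rV[R]_d -> R) (x v : 'rV[R]_d) (n m : 'rV[int]_d).

(** Any point can be translated to the centre of the cell, the translation being absorbed in the
    free angle theta. The sign bound at the centre is then applied to f and to - f. *)
Lemma fourier_eq0 f : continuous f -> periodic2pi f ->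
  (forall n (theta : R), tmean (fun x => f x * cos (phase n x + theta)) = 0) ->
  forall x, f x = 0.
Proof.
have le0 g : continuous g -> periodic2pi g ->
    (forall n (theta : R), tmean (fun x => g x * cos (phase n x + theta)) = 0) ->
    forall x, g x <= 0.
  move=> cg pg g0 x; pose v := x - const_mx pi.
  have ng := bddmeas_periodic cg pg.
  have -> : x = const_mx pi + v by rewrite /v addrC subrK.
  apply: (@fourier_center_le0 R d d0 (fun y => g (y + v))).
  - move=> y; have cv : {for y, continuous (fun y : 'rV[R]_d => y + v)}.
      by apply: continuousD; [exact: cvg_id|exact: cst_continuous].
    exact: (continuous_comp cv (cg (y + v))).
  - by move=> y n; rewrite addrAC pg.
  move=> n theta; have ph : periodic2pi (fun z => g z * cos (phase n z + (theta - phase n v))).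
    by move=> z m; rewrite pg (periodic_cos_phase n (theta - phase n v) z m).
  have nh := bddmeasM ng (bddmeas_cos d n (theta - phase n v)).
  rewrite -(g0 n (theta - phase n v)) -(tmean_shift v nh ph); congr tmean; apply/funext => y.
  by congr (_ * cos _); rewrite phaseDr; ring.
move=> cf pf f0 x; apply/eqP; rewrite eq_le le0//=.
rewrite -oppr_le0; apply: (le0 (fun x => - f x)).
- by move=> y; apply: continuousN; exact: cf.
- by move=> y n; rewrite pf.
move=> n theta; have nw := bddmeasM (bddmeas_periodic cf pf) (bddmeas_cos d n theta).
rewrite -[RHS](mulr0 (-1)) -(f0 n theta) -(tmeanZ _ nw); congr tmean; apply/funext => y.
by rewrite mulN1r mulNr.
Qed.

Lemma sphere_seq (lam : R) : exists s : seq 'rV[int]_d, uniq s /\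
  forall n, (n \in s) = ((dotp n n)%:~R == lam ^+ 2).
Proof.
pose B := Num.truncn `|lam|.
pose box : seq 'rV[int]_d :=
  [seq \row_j ((f j : nat)%:Z - B%:Z) | f : {ffun 'I_d -> 'I_(2 * B).+1}].
exists (undup [seq n <- box | (dotp n n)%:~R == lam ^+ 2]); rewrite undup_uniq; split => // n.
rewrite mem_undup mem_filter; case: eqP => //= nl; apply/mapP.
have nB j : (absz (n 0%R j) <= B)%N.
  rewrite /B truncn_ge_nat// -ler_sqr ?nnegrE// real_normK ?num_real// -nl.
  have -> : (absz (n 0 j))%:R ^+ 2 = (n 0 j ^+ 2)%:~R :> R.
    by rewrite -[_%:R]/((absz (n 0 j))%:Z%:~R) -rmorphXn/= abszE real_normK ?num_real.
  by rewrite ler_int sqr_coord_le.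
exists [ffun j => inord (absz (n 0 j + B%:Z))]; first by rewrite mem_enum.
apply/rowP => j; rewrite !mxE ffunE.
by have [h1 h2] := absz_shift (nB j); rewrite inordK.
Qed.

(** Left unevaluated; positivity is enough for dividing by it. *)
Definition tvol : R := fine (hausdorff d (@torus_cell R d)).

Lemma tvol_gt0 : 0 < tvol.
Proof.
apply: fine_gt0; apply/andP; split.
  apply: (lt_le_trans (hausdorff_cbox_gt0 0 d0 (@ltr01 R))).
  apply: le_hausdorff => x xb j; have := xb j; rewrite mxE add0r => /andP[-> x1] /=.
  by apply: (le_lt_trans x1); have := @pi_ge2 R; lra.
by rewrite torus_cellE; exact: pbox_fin.
Qed.

Lemma tmean_cos m (theta : R) :
  tmean (fun x => cos (phase m x + theta)) = (m == 0)%:R * (tvol * cos theta).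
Proof.
have [->|m0] := eqVneq m 0.
  rewrite mul1r mulrC /tvol torus_cellE -(mean_cst 0 row_free_torus); congr mean.
  apply/funext => x; congr cos.
  by rewrite /phase map_mx0 /dotp big1 ?add0r// => j _; rewrite mxE mul0r.
rewrite mul0r.
have nc := bddmeas_cos_phase (R := R) d m; have ns := bddmeas_sin_phase (R := R) d m.
have := tmeanD (bddmeasM (bddmeas_cst d d (cos theta)) nc)
  (bddmeasM (bddmeas_cst d d (- sin theta)) ns).
rewrite (tmeanZ _ nc) (tmeanZ _ ns) tmean_cos_eq0// tmean_sin_eq0 !mulr0 addr0 => e.
by rewrite -[RHS]e; congr tmean; apply/funext => x; rewrite cosD; ring.
Qed.

Lemma sum_delta_seq (T : eqType) (s : seq T) (y : T) (Y : T -> R) : uniq s ->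
  \sum_(n <- s) (n == y)%:R * Y n = (y \in s)%:R * Y y.
Proof.
elim: s => [|n s IH] /=; first by rewrite big_nil mul0r.
move=> /andP[ns us]; rewrite big_cons IH// inE eq_sym.
have [->|] := eqVneq y n; last by rewrite mul0r add0r.
by rewrite (negbTE ns) mul0r addr0.
Qed.

Definition trigsum (s : seq 'rV[int]_d) (al be : 'rV[int]_d -> R) x : R :=
  \sum_(n <- s) (al n * cos (phase n x) + be n * sin (phase n x)).

Lemma bddmeas_trig (al be : 'rV[int]_d -> R) n :
  bddmeas d (fun x => al n * cos (phase n x) + be n * sin (phase n x)).
Proof.
by apply: bddmeasD; apply: bddmeasM;
  [exact: bddmeas_cst|exact: bddmeas_cos_phase|exact: bddmeas_cst|exact: bddmeas_sin_phase].
Qed.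

Lemma continuous_trig (al be : 'rV[int]_d -> R) n :
  continuous (fun x => al n * cos (phase n x) + be n * sin (phase n x)).
Proof.
have cc : continuous (fun x : 'rV[R]_d => cos (phase n x)).
  by under eq_fun do rewrite -[phase n _]addr0; exact: continuous_cos_phase.
have cs : continuous (fun x : 'rV[R]_d => sin (phase n x)).
  by under eq_fun do rewrite -cosBpihalf; exact: continuous_cos_phase.
move=> y; have ck (a : R) : {for y, continuous (fun _ : 'rV[R]_d => a)}.
  exact: cst_continuous.
exact: (continuousD (continuousM (ck (al n)) (cc y)) (continuousM (ck (be n)) (cs y))).
Qed.

(** Both n = m and n = - m contribute, since in real form the frequencies m and - m carry the same
    functions up to sign. *)
Lemma tmean_trig_cos (al be : 'rV[int]_d -> R) n m theta :
  tmean (fun x => (al n * cos (phase n x) + be n * sin (phase n x)) * cos (phase m x + theta)) =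
  tvol / 2 * ((n == - m)%:R * (al n * cos theta + be n * sin theta) +
              (n == m)%:R * (al n * cos theta - be n * sin theta)).
Proof.
have nc (k : 'rV[int]_d) (t : R) := bddmeas_cos d k t.
pose F1 x := al n / 2 * cos (phase (n + m) x + theta).
pose F2 x := al n / 2 * cos (phase (n - m) x + - theta).
pose F3 x := be n / 2 * cos (phase (n + m) x + (theta - pi / 2)).
pose F4 x := be n / 2 * cos (phase (n - m) x + (- theta - pi / 2)).
have n1 : bddmeas d F1 := bddmeasM (bddmeas_cst d d _) (nc _ _).
have n2 : bddmeas d F2 := bddmeasM (bddmeas_cst d d _) (nc _ _).
have n3 : bddmeas d F3 := bddmeasM (bddmeas_cst d d _) (nc _ _).
have n4 : bddmeas d F4 := bddmeasM (bddmeas_cst d d _) (nc _ _).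
transitivity (tmean (fun x => (F1 x + F2 x) + (F3 x + F4 x))).
  congr tmean; apply/funext => x; rewrite /F1 /F2 /F3 /F4 !addrA !cosBpihalf phaseDl phaseBl.
  rewrite (_ : phase n x + phase m x + theta = phase n x + (phase m x + theta)); last by ring.
  rewrite (_ : phase n x - phase m x - theta = phase n x - (phase m x + theta)); last by ring.
  move: (phase n x) (phase m x + theta) => a b.
  by rewrite cosD cosB sinD sinB; field.
rewrite (tmeanD (bddmeasD n1 n2) (bddmeasD n3 n4)) (tmeanD n1 n2) (tmeanD n3 n4).
rewrite !(tmeanZ _ (nc _ _)) !tmean_cos !cosBpihalf cosN sinN.
by rewrite subr_eq0 addr_eq0; field.
Qed.

Lemma eigen_expansion f (lam : R) : C2 f -> periodic2pi f ->
  (forall x, - laplacian f x = lam ^+ 2 * f x) ->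
  exists s al be, [/\ uniq s, {in s, forall n, (dotp n n)%:~R = lam ^+ 2},
    f = trigsum s al be &
    tmean (fun x => f x ^+ 2) = tvol * \sum_(n <- s) (al n ^+ 2 + be n ^+ 2)].
Proof.
move=> C2f pf ef; have [cf _ _ _ _] := C2f; have nf := bddmeas_periodic cf pf.
have tvol0 := tvol_gt0.
have [s [us sP]] := sphere_seq lam.
(* The customary factor 2 is absent because [s] contains - n together with n, and the two terms of
   the sum are equal. *)
pose al n := tmean (fun x => f x * cos (phase n x)) / tvol.
pose be n := tmean (fun x => f x * sin (phase n x)) / tvol.
have ncos n := bddmeas_cos_phase (R := R) d n; have nsin n := bddmeas_sin_phase (R := R) d n.
have alE n : tmean (fun x => f x * cos (phase n x)) = tvol * al n.
  by rewrite /al mulrC divfK// gt_eqF.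
have beE n : tmean (fun x => f x * sin (phase n x)) = tvol * be n.
  by rewrite /be mulrC divfK// gt_eqF.
have alN n : al (- n) = al n.
  by congr (tmean _ / _); apply/funext => x; rewrite phaseNl cosN.
have beN n : be (- n) = - be n.
  rewrite /be -mulNr -[X in _ = X / _]mulN1r -(tmeanZ _ (bddmeasM nf (nsin n))).
  by congr (tmean _ / _); apply/funext => x; rewrite phaseNl sinN; ring.
have sN n : (- n \in s) = (n \in s) by rewrite !sP dotpNl dotpNr opprK.
have fcoef m theta : tmean (fun x => f x * cos (phase m x + theta)) =
    tvol * (al m * cos theta - be m * sin theta).
  have := tmeanD (bddmeasM (bddmeas_cst d d (cos theta)) (bddmeasM nf (ncos m)))
    (bddmeasM (bddmeas_cst d d (- sin theta)) (bddmeasM nf (nsin m))).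
  rewrite (tmeanZ _ (bddmeasM nf (ncos m))) (tmeanZ _ (bddmeasM nf (nsin m))) alE beE => e.
  transitivity (cos theta * (tvol * al m) + - sin theta * (tvol * be m)); last by ring.
  by rewrite -[RHS]e; congr tmean; apply/funext => x; rewrite cosD; ring.
have ntr := bddmeas_sum s (bddmeas_trig al be).
have fE : f = trigsum s al be.
  apply/funext => x; apply/eqP; rewrite -subr_eq0; apply/eqP.
  apply: (fourier_eq0 (f := fun x => f x - trigsum s al be x)).
  - have ct : continuous (trigsum s al be).
      by rewrite /trigsum; apply: continuous_sum => n; exact: continuous_trig.
    by move=> y; exact: (continuousB (cf y) (ct y)).
  - move=> y n; rewrite pf; congr (_ - _); apply: eq_bigr => m _.
    congr (_ * _ + _ * _).
      by have := periodic_cos_phase m (0 : R) y n; rewrite !addr0.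
    by have := periodic_cos_phase m (- (pi / 2) : R) y n; rewrite !cosBpihalf.
  move=> m theta; have nm := bddmeas_cos (R := R) d m theta.
  transitivity (tmean (fun x => f x * cos (phase m x + theta) +
      -1 * \sum_(n <- s) (al n * cos (phase n x) + be n * sin (phase n x)) * cos (phase m x +
        theta))).
    by congr tmean; apply/funext => y; rewrite -mulr_suml -/(trigsum s al be y); ring.
  have ntm n := bddmeasM (bddmeas_trig al be n) nm.
  rewrite (tmeanD (bddmeasM nf nm) (bddmeasM (bddmeas_cst d d (-1)) (bddmeas_sum s ntm))).
  rewrite (tmeanZ _ (bddmeas_sum s ntm)) (tmean_sum s ntm).
  under eq_bigr do rewrite tmean_trig_cos.
  rewrite -mulr_sumr big_split/= !sum_delta_seq// sN alN beN.
  have [ms|ms] := boolP (m \in s).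
    rewrite fcoef /= !mul1r. by field.
  rewrite (eigen_coef_eq0 (lam := lam) theta C2f pf ef); last by rewrite -sP.
  by rewrite !mul0r addr0 !mulr0 addr0.
exists s, al, be; split => //; first by move=> n; rewrite sP => /eqP.
transitivity (tmean (fun x => \sum_(n <- s)
  (al n * (f x * cos (phase n x)) + be n * (f x * sin (phase n x))))).
  (* Parseval: only one of the two factors f is expanded, the other produces the coefficients. *)
  congr tmean; apply/funext => x; rewrite expr2 {2}fE /trigsum mulr_sumr.
  by apply: eq_bigr => n _; ring.
have nfc n := bddmeasM nf (ncos n); have nfs n := bddmeasM nf (nsin n).
rewrite (tmean_sum s (fun n => bddmeasD (bddmeasM (bddmeas_cst d d (al n)) (nfc n))
  (bddmeasM (bddmeas_cst d d (be n)) (nfs n)))).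
rewrite mulr_sumr; apply: eq_bigr => n _.
rewrite (tmeanD (bddmeasM (bddmeas_cst d d (al n)) (nfc n)) (bddmeasM (bddmeas_cst d d (be n))
  (nfs n))).
by rewrite (tmeanZ _ (nfc n)) (tmeanZ _ (nfs n)) alE beE; ring.
Qed.

End Expansion.

(** * Restriction to rational planes *)

(** The kernel is the direction of the plane. Having a rational basis, it has an integral one, and 2
    pi times its rows are periods of every function on the torus. *)
Lemma integer_kernel_basis (m k d : nat) (a : 'M[rat]_(m, d)) :
  (m + k)%N = d -> row_free a -> exists u : 'M[int]_(k, d),
    row_free (map_mx intr u : 'M[rat]_(k, d)) /\
    (map_mx intr u :=: kermx a^T)%MS.
Proof.
move=> mkd /eqP fa.
have rk : \rank (kermx a^T) = k by rewrite mxrank_ker mxrank_tr fa -mkd addKn.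
move: (row_base_free (kermx a^T)) (eq_row_base (kermx a^T)).
move: (row_base (kermx a^T)); rewrite rk => B fB eB.
have [M M0 [u eu]] := clear_denominators B.
have Mq : M%:~R != 0 :> rat by rewrite intr_eq0 gt_eqF.
have uB : (map_mx intr u :=: B)%MS by rewrite eu; exact: eqmx_scale.
exists u; split; last exact: eqmx_trans uB eB.
by rewrite /row_free uB -/(row_free B).
Qed.

(** Over the rationals the row space of [a] equals its double orthogonal complement: it is contained
    in it, and the ranks agree because m + k = d. *)
Lemma orthogonal_kernel_basis (m k d : nat) (a : 'M[rat]_(m, d)) (u : 'M[int]_(k, d))
    (v : 'rV[int]_d) :
  (m + k)%N = d -> row_free a -> row_free (map_mx intr u : 'M[rat]_(k, d)) ->
  (map_mx intr u :=: kermx a^T)%MS ->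
  (forall l, dotp v (row l u) = 0) -> (map_mx intr v <= a)%MS.
Proof.
move=> mkd /eqP fa /eqP fu uk vu.
have au : (a <= kermx (map_mx intr u)^T)%MS.
  have ua : map_mx intr u *m a^T = 0 by apply/sub_kermxP; rewrite uk.
  by apply/sub_kermxP; rewrite -[a]trmxK -trmx_mul ua trmx0.
have /eqmxP eau : (a == kermx (map_mx intr u)^T)%MS.
  rewrite -(mxrank_leqif_eq au) mxrank_ker mxrank_tr fu fa -mkd addnK.
  exact: eqxx.
rewrite eau; apply/sub_kermxP/rowP => l; rewrite !mxE.
transitivity ((dotp v (row l u))%:~R : rat); last by rewrite vu.
by rewrite /dotp rmorph_sum; apply: eq_bigr => j _; rewrite !mxE rmorphM.
Qed.

(** The kernel of a rational matrix commutes with extension of scalars to the reals, so the rational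
    basis also spans the real direction. *)
Lemma rational_kernel_real (R : realType) (m k d : nat) (a : 'M[rat]_(m, d))
    (u : 'M[int]_(k, d)) (y : 'rV[R]_d) :
  (map_mx intr u :=: kermx a^T)%MS ->
  (forall i, \sum_(j < d) ratr (a i j) * y 0 j = 0) ->
  (y <= (map_mx intr u : 'M[R]_(k, d)))%MS.
Proof.
move=> uk ya.
have -> : map_mx intr u = map_mx (ratr : rat -> R) (map_mx intr u) :> 'M[R]_(k, d).
  by apply/matrixP => i j; rewrite !mxE ratr_int.
have yk : (y <= kermx (map_mx (ratr : rat -> R) a^T))%MS.
  apply/sub_kermxP/rowP => i; rewrite !mxE -[RHS](ya i).
  by apply: eq_bigr => j _; rewrite !mxE mulrC.
apply: submx_trans yk _.
by rewrite -map_kermx map_submx uk.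
Qed.

Section L2norm.
Context {R : realType} (d : nat).
Implicit Types e : 'rV[R]_d -> R[i].
Local Open Scope ereal_scope.

Definition normsq e x : R := (complex.Re (e x) ^+ 2 + complex.Im (e x) ^+ 2)%R.

Lemma L2normE k (S : set 'rV[R]_d) e :
  L2norm k S e = (\int[hausdorff_measure d k]_(x in S) (normsq e x)%:E) `^ 2^-1.
Proof.
rewrite /L2norm unlock; congr (_ `^ _).
have e1 := integral_mkcond (mu := hausdorff_measure d k) S (fun x => (normsq e x)%:E).
refine (etrans _ (esym e1)); apply: eq_integral => x _.
rewrite !patchE; case: ifP => _; last first.
  by rewrite abse0 poweR0r.
rewrite /=; congr (_%:E).
rewrite ger0_norm; last by case: (e x) => p q; exact: sqrtr_ge0.
rewrite powR_mulrn; last by case: (e x) => p q; exact: sqrtr_ge0.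
rewrite /normsq; case: (e x) => p q /=; rewrite sqr_sqrtr//.
by rewrite addr_ge0// sqr_ge0.
Qed.

End L2norm.

Section Restriction.
Context {R : realType}.

Lemma rational_plane_measurable (m k d : nat) (a : 'M[rat]_(m, d)) (b : 'I_m -> R) :
  measurable (rational_plane a b :
    set (caratheodory_type (hausdorff_outer d k : set 'rV[R]_d -> \bar R))).
Proof.
rewrite (_ : rational_plane a b = \bigcap_(i in [set: 'I_m])
    ((fun x : 'rV[R]_d => \sum_(j < d) x 0 j * ratr (a i j)) @^-1` [set b i])); last first.
  apply/seteqP; split => [x xP i _ /=|x xP i].
    by rewrite -(xP i); apply: eq_bigr => j _; rewrite mulrC.
  by rewrite -(xP i I); apply: eq_bigr => j _; rewrite mulrC.
apply: fin_bigcap_measurable; first exact: finite_finset.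
move=> i _; have ml := @measurable_linear R k d (fun j => ratr (a i j)).
exact: (measurable_preimage ml (measurable_set1 (b i))).
Qed.

(* A cell of the period lattice of the plane, dilated by an integer, contains
   every admissible S, so S can be replaced by a torus of dimension k. *)
Lemma totally_geodesic_cover (m k d : nat) (C0 : R) (a : 'M[rat]_(m, d))
    (u0 : 'M[int]_(k, d)) :
  row_free (map_mx intr u0 : 'M[rat]_(k, d)) -> (map_mx intr u0 :=: kermx a^T)%MS ->
  exists2 z : int, z != 0 & forall b S, totally_geodesic C0 k (rational_plane a b) S ->
    exists p, S `<=` pbox p ((2 * pi) *: map_mx intr (z *: u0)).
Proof.
move=> fu uk; pose U0 : 'M[R]_(k, d) := map_mx intr u0.
have fU0 : row_free U0.
  have -> : U0 = map_mx (ratr : rat -> R) (map_mx intr u0).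
    by apply/matrixP => i j; rewrite !mxE ratr_int.
  by rewrite row_free_map.
pose c1 : R := \sum_l \sum_j 2 * `|C0| * `|pinvmx U0 j l|.
have c10 : 0 <= c1 by apply: sumr_ge0 => l _; apply: sumr_ge0 => j _; rewrite !mulr_ge0.
pose T := (Num.truncn c1).+1.
have TP : c1 < T%:R by exact: truncnS_gt.
have T0 : 0 < T%:R :> R by exact: le_lt_trans TP.
(* Relative to a point p0 of S, coordinates along [U0] are at most c1 < T <= w in absolute value,
   where w = 2 pi T. A cell with edges 2 w = 2 pi (2 T) can be centred at p0, which explains the
   factor 2. *)
exists (2 * T)%:Z => // b S [_ [V oV SE] hS [p1 Sp1]].
have [p0 p0S] : S !=set0.
  apply/set0P/eqP => S0; move: hS; rewrite S0 hausdorff0 => /eqP.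
  by rewrite eq_sym onee_eq0.
pose w : R := 2 * pi * T%:R.
have w0 : 0 < w by rewrite mulr_gt0// twopi_gt0.
have Tw : T%:R <= w.
  by rewrite /w ler_peMl// ?(ltW T0)//; have := @pi_ge2 R; lra.
exists (p0 - (const_mx w : 'rV[R]_k) *m U0) => x xS.
have xp0 j : `|(x - p0) 0 j| <= 2 * `|C0|.
  have h (y : 'rV[R]_d) : S y -> `|(y - p1) 0 j| <= `|C0|.
    move=> yS; apply: le_trans (coord_le_enorm _ _) _.
    by apply: le_trans (Sp1 y yS) (ler_norm _).
  have -> : x - p0 = (x - p1) - (p0 - p1) by rewrite opprB addrA subrK.
  rewrite mxE [X in _ + X]mxE; apply: (le_trans (ler_normB _ _)).
  by have := h x xS; have := h p0 p0S; lra.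
have /submxP[t xt] : (x - p0 <= U0)%MS.
  apply: (rational_kernel_real uk) => i.
  move: xS p0S; rewrite SE => -[_ xV] [_ p0V].
  under eq_bigr do rewrite !mxE mulrBr.
  by rewrite sumrB xV p0V subrr.
have tw l : `|t 0 l| < w.
  apply: lt_le_trans Tw; apply: le_lt_trans TP.
  have -> : t = (x - p0) *m pinvmx U0 by rewrite xt mulmxKp.
  rewrite mxE /c1 (bigD1 l)//=; apply: (le_trans (ler_norm_sum _ _ _)).
  apply: (@le_trans _ _ (\sum_j 2 * `|C0| * `|pinvmx U0 j l|)).
    by apply: ler_sum => j _; rewrite normrM ler_wpM2r.
  rewrite lerDl; apply: sumr_ge0 => i _; apply: sumr_ge0 => j _.
  by rewrite !mulr_ge0.
exists ((2 * w)^-1 *: (t + const_mx w)).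
  move=> l /=; rewrite !mxE mulrC; have := tw l; rewrite ltr_norml => /andP[t1 t2].
  have w2 : 0 < 2 * w by rewrite mulr_gt0.
  by rewrite ler_pdivlMr// ltr_pdivrMr// mul0r mul1r; lra.
have -> : (2 * pi) *: map_mx intr ((2 * T)%:Z *: u0) = (2 * w) *: U0.
  by apply/matrixP => i j; rewrite !mxE rmorphM/= /w PoszM rmorphM/=; ring.
rewrite -scalemxAl -scalemxAr scalerA mulVf; last by rewrite gt_eqF// mulr_gt0.
by rewrite scale1r mulmxDl -xt [x - p0 + _]addrC addrA subrK addrC subrK.
Qed.

(** The counting bound is applied to each class of frequencies: two members differ from a common n
    by elements of the row space of [a], hence also from each other. Parseval then replaces the sum
    of squared coefficients by the mean over the torus. *)
Lemma mean_sqr_restriction (m k d : nat) (a : 'M[rat]_(m, d)) (u0 : 'M[int]_(k, d)) (z : int)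
    (p : 'rV[R]_d) (lam : R) (f : 'rV[R]_d -> R) (N : nat) :
  (m + k)%N = d -> (0 < d)%N -> row_free a -> z != 0 ->
  row_free (map_mx intr u0 : 'M[rat]_(k, d)) -> (map_mx intr u0 :=: kermx a^T)%MS ->
  row_free ((2 * pi) *: map_mx intr (z *: u0) : 'M[R]_(k, d)) ->
  (forall s : seq 'rV[int]_d, uniq s ->
    {in s, forall n, (dotp n n)%:~R = lam ^+ 2} ->
    {in s &, forall n n', (map_mx intr (n - n') <= a)%MS} -> (size s <= N)%N) ->
  C2 f -> periodic2pi f -> (forall x, - laplacian f x = lam ^+ 2 * f x) ->
  mean p ((2 * pi) *: map_mx intr (z *: u0)) (fun x => f x ^+ 2) <=
  fine (hausdorff k (pbox p ((2 * pi) *: map_mx intr (z *: u0)))) * N%:R / @tvol R d *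
    tmean (fun x => f x ^+ 2).
Proof.
move=> mkd d0 fa z0 fu uk fU count_le C2f pf ef.
have [s [al [be [us sl -> ->]]]] := eigen_expansion d0 C2f pf ef.
have tv := tvol_gt0 (R := R) d0.
have := @mean_sqr_trig_le R k d p (z *: u0) fU s al be N.
rewrite mulrA divfK ?gt_eqF//; apply => n ns.
rewrite -size_filter; apply: count_le.
- by rewrite filter_uniq.
- by move=> n'; rewrite mem_filter => /andP[_ /sl].
have cl n' : n' \in [seq n' <- s | [forall l, dotp (n - n') (row l (z *: u0)) == 0]] ->
    (map_mx intr (n - n') <= a)%MS.
  rewrite mem_filter => /andP[/forallP h _].
  apply: (orthogonal_kernel_basis mkd fa fu uk) => l.
  have := h l; rewrite (_ : row l (z *: u0) = z *: row l u0); last by apply/rowP => j; rewrite !mxE.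
  by rewrite dotpZr mulf_eq0 (negbTE z0) => /eqP.
move=> n1 n2 /cl h1 /cl h2.
have -> : map_mx intr (n1 - n2) = map_mx intr (n - n2) - map_mx intr (n - n1) :> 'rV[rat]_d.
  by rewrite -map_mxB; congr map_mx; rewrite opprB [RHS]addrC addrA subrK.
by rewrite addmx_sub// eqmx_opp.
Qed.

End Restriction.

Section RestrictionBound.
Context {R : realType}.

Lemma L2norm_mean (k d : nat) (p : 'rV[R]_d) (U : 'M[R]_(k, d)) (S : set 'rV[R]_d)
    (e : 'rV[R]_d -> R[i]) : row_free U ->
  measurable (S : set (caratheodory_type (hausdorff_outer d k : set 'rV[R]_d -> \bar R))) ->
  S `<=` pbox p U -> bddmeas k (normsq e) ->
  (L2norm k S e <= (Num.sqrt (mean p U (normsq e)))%:E)%E.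
Proof.
move=> fU mS SP ne; rewrite L2normE.
have e0 x : 0 <= normsq e x by rewrite addr_ge0// sqr_ge0.
have mP := measurable_pbox p fU.
have mf : measurable_fun (pbox p U : set (caratheodory_type (hausdorff_outer d k : set 'rV[R]_d
  -> \bar R)))
    (fun x => (normsq e x)%:E).
  by apply/measurable_EFinP; apply: measurable_funTS; exact: ne.1.
have SPle := @ge0_subset_integral _ _ _ (hausdorff_measure d k) S (pbox p U) mS mP
  (fun x => (normsq e x)%:E) mf (fun x _ => e0 x) SP.
have m0 : 0 <= mean p U (normsq e) by apply: Rintegral_ge0 => x _; exact: e0.
have meanE : (\int[hausdorff_measure d k]_(x in pbox p U) (normsq e x)%:E)%E =
    (mean p U (normsq e))%:E.
  rewrite /mean /Rintegral fineK//.
  exact: (integrable_fin_num mP (bddmeas_integrable p fU ne)).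
rewrite meanE in SPle.
have I0 : (0 <= \int[hausdorff_measure d k]_(x in S) (normsq e x)%:E)%E.
  by apply: integral_ge0 => x _; rewrite lee_fin; exact: e0.
rewrite -(powR12_sqrt m0) -poweR_EFin.
have h1 : (\int[hausdorff_measure d k]_(x in S) (normsq e x)%:E)%E \in `[0%E, +oo%E].
  by rewrite in_itv; apply/andP; split; [exact: I0 | exact: leey].
have h2 : (mean p U (normsq e))%:E \in `[0%E, +oo%E].
  by rewrite in_itv; apply/andP; split; [exact: m0 | exact: leey].
have r0 : 0 <= 2^-1 :> R by rewrite invr_ge0.
exact: (gt0_ler_poweR r0 h1 h2 SPle).
Qed.

Lemma torus_L2norm_mean (d : nat) (e : 'rV[R]_d -> R[i]) : bddmeas d (normsq e) ->
  torus_L2norm e = (Num.sqrt (tmean (normsq e)))%:E.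
Proof.
move=> ne; rewrite /torus_L2norm L2normE torus_cellE.
have e0 x : 0 <= normsq e x by rewrite addr_ge0// sqr_ge0.
have m0 : 0 <= tmean (normsq e) by apply: Rintegral_ge0 => x _; exact: e0.
rewrite -powR12_sqrt// -poweR_EFin; congr (_ `^ _)%E.
rewrite /tmean /mean /Rintegral fineK//.
exact: (integrable_fin_num (measurable_pbox 0 row_free_torus)
  (bddmeas_integrable 0 row_free_torus ne)).
Qed.

(** The right-hand side [b] influences only the base point of the cell, whose measure is bounded
    independently of it. The count N stays a parameter, so that hyperplanes and higher codimension
    share the argument; its square root appears because N bounds squared norms. *)
Lemma restriction_bound (m k d : nat) (C0 : R) (a : 'M[rat]_(m, d)) :
  (m + k)%N = d -> (0 < d)%N -> row_free a ->
  exists2 c : R, 0 < c & forall (b : 'I_m -> R) (S : set 'rV[R]_d),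
    totally_geodesic C0 k (rational_plane a b) S ->
  forall (lam : R) (e : 'rV[R]_d -> R[i]) (N : nat), torus_eigenfunction lam e ->
  (forall s : seq 'rV[int]_d, uniq s ->
    {in s, forall n, (dotp n n)%:~R = lam ^+ 2} ->
    {in s &, forall n n', (map_mx intr (n - n') <= a)%MS} -> (size s <= N)%N) ->
  (L2norm k S e <= (c * Num.sqrt N%:R)%:E * torus_L2norm e)%E.
Proof.
move=> mkd d0 fa; have [u0 [fu uk]] := integer_kernel_basis mkd fa.
have [z z0 cover] := totally_geodesic_cover C0 fu uk.
pose U : 'M[R]_(k, d) := (2 * pi) *: map_mx intr (z *: u0).
have fU : row_free U.
  have -> : U = (2 * pi * z%:~R) *: map_mx (ratr : rat -> R) (map_mx intr u0).
    by apply/matrixP => i j; rewrite !mxE ratr_int rmorphM/= mulrA.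
  have c0 : 2 * pi * z%:~R != 0 :> R.
    by rewrite mulf_neq0 ?intr_eq0// gt_eqF// mulr_gt0// pi_gt0.
  by rewrite /row_free (eqmx_scale _ c0) mxrank_map.
have [B HB] := hausdorff_pbox_bounded U.
pose B1 := `|B| + 1; have B10 : 0 < B1 by rewrite ltr_wpDl.
have tv := tvol_gt0 (R := R) d0.
exists (Num.sqrt (B1 / @tvol R d)); first by rewrite sqrtr_gt0 divr_gt0.
move=> b S SG lam e N [pe C2u C2v eu ev] count_le.
have [p Sp] := cover b S SG.
pose f x := complex.Re (e x); pose g x := complex.Im (e x).
have pf : periodic2pi f by move=> x n; rewrite /f pe.
have pg : periodic2pi g by move=> x n; rewrite /g pe.
have [cf _ _ _ _] := C2u; have [cg _ _ _ _] := C2v.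
have nf k' : bddmeas k' f.
  split; first exact: continuous_measurable_hausdorff.
  exact: periodic_bounded.
have ng k' : bddmeas k' g.
  split; first exact: continuous_measurable_hausdorff.
  exact: periodic_bounded.
have nf2 k' : bddmeas k' (fun x => f x ^+ 2) := bddmeasM (nf k') (nf k').
have ng2 k' : bddmeas k' (fun x => g x ^+ 2) := bddmeasM (ng k') (ng k').
have ne k' : bddmeas k' (normsq e) := bddmeasD (nf2 k') (ng2 k').
have mS : measurable (S : set (caratheodory_type (hausdorff_outer d k : set 'rV[R]_d -> \bar R))).
  have [_ [V oV ->] _ _] := SG.
  apply: measurableI; last exact: rational_plane_measurable.
  exact: hausdorff_caratheodory_open.
have t0 : 0 <= tmean (normsq e).
  by apply: Rintegral_ge0 => x _; rewrite addr_ge0// sqr_ge0.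
rewrite (torus_L2norm_mean (ne d)).
apply: le_trans (L2norm_mean fU mS Sp (ne k)) _.
rewrite -EFinM lee_fin -sqrtrM ?divr_ge0 ?(ltW B10) ?(ltW tv)//.
rewrite -sqrtrM ?mulr_ge0 ?divr_ge0 ?(ltW B10) ?(ltW tv)//.
apply: ler_wsqrtr.
have bf := mean_sqr_restriction p mkd d0 fa z0 fu uk fU count_le C2u pf eu.
have bg := mean_sqr_restriction p mkd d0 fa z0 fu uk fU count_le C2v pg ev.
rewrite (_ : mean p U (normsq e) = mean p U (fun x => f x ^+ 2) + mean p U (fun x => g x ^+ 2));
  last first.
  exact: (meanD p fU (nf2 k) (ng2 k)).
apply: (le_trans (lerD bf bg)); rewrite -mulrDr -(tmeanD (nf2 d) (ng2 d)).
apply: ler_wpM2r => //.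
rewrite -mulrA [leRHS]mulrAC -mulrA; apply: ler_pM => //.
- by rewrite fine_ge0// hausdorff_ge0.
- by rewrite divr_ge0// ltW.
rewrite -lee_fin fineK; last first.
  by rewrite ge0_fin_numE ?hausdorff_ge0//; exact: le_lt_trans (HB p) (ltry _).
by apply: le_trans (HB p) _; rewrite lee_fin /B1 (le_trans (ler_norm _))// lerDl.
by rewrite invr_ge0 ltW.
Qed.

End RestrictionBound.

Theorem theorem6 (R : realType) (d k : nat) (C0 : R)
    (a : 'M[rat]_(d - k, d)) :
  (2 <= d)%N -> (1 <= k <= d - 1)%N -> d%:R <= C0 ->
  row_free a ->
  ((1 <= k <= d - 2)%N ->
     forall eps : R, 0 < eps ->
     exists2 C : R, 0 < C &
       forall (b : 'I_(d - k) -> R) (S : set 'rV[R]_d),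
         totally_geodesic C0 k (rational_plane a b) S ->
       forall (lambda : R) (e : 'rV[R]_d -> R[i]),
         1 < lambda -> torus_eigenfunction lambda e ->
         (L2norm k S e <=
          (C * lambda `^ ((d%:R - k%:R - 2) / 2 + eps))%:E * torus_L2norm e)%E)
  /\
  (k = (d - 1)%N ->
     exists2 C : R, 0 < C &
       forall (b : 'I_(d - k) -> R) (S : set 'rV[R]_d),
         totally_geodesic C0 k (rational_plane a b) S ->
       forall (lambda : R) (e : 'rV[R]_d -> R[i]),
         1 < lambda -> torus_eigenfunction lambda e ->
         (L2norm k S e <= C%:E * torus_L2norm e)%E).
Proof.
move=> d2 /andP[k1 kd] _ fa.
have mkd : (d - k + k)%N = d by rewrite subnK// (leq_trans kd)// leq_subr.
have d0 : (0 < d)%N by exact: ltnW.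
have [c c0 cP] := restriction_bound C0 mkd d0 fa.
split=> [/andP[_ kd2] eps eps0|k_eq].
  have dk : (d - k)%N = (d - k - 2).+2 by lia.
  have dkR : (d - k - 2)%N%:R = d%:R - k%:R - 2 :> R.
    by rewrite !natrB//; lia.
  (* The count enters the norm through its square root, so it may be allowed twice the loss. *)
  have e20 : 0 < 2 * eps by rewrite mulr_gt0.
  (* The number of rows is abstracted because the type of [a] depends on [d - k], which is not
     literally of the form [m.+2]. *)
  have plane (m : nat) (a' : 'M[rat]_(m, d)) : m = (d - k - 2).+2 -> row_free a' ->
      exists2 C : R, 0 < C & forall (lambda : R) (s : seq 'rV[int]_d),
      1 < lambda -> uniq s ->
      {in s, forall n, (dotp n n)%:~R = lambda ^+ 2} ->
      {in s &, forall n n', (map_mx intr (n - n') <= a')%MS} ->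
      (size s)%:R <= C * lambda ^+ (d - k - 2) * lambda `^ (2 * eps).
    by move=> mE; subst m => fa'; exact: size_sphere_subspace.
  have [C C_gt0 CP] := plane _ a dk fa.
  exists (c * Num.sqrt C); first by rewrite mulr_gt0// sqrtr_gt0.
  move=> b S SG lam e lam1 eige.
  have lam0 : 0 < lam by exact: lt_trans lam1.
  pose X := C * lam ^+ (d - k - 2) * lam `^ (2 * eps).
  have X0 : 0 <= X by rewrite !mulr_ge0 ?exprn_ge0 ?powR_ge0// ltW.
  apply: (le_trans (cP b S SG lam e (Num.truncn X) eige _)).
    move=> s us sl sa; rewrite truncn_ge_nat//; exact: CP.
  apply: lee_wpmul2r; first exact: Lnorm_ge0.
  rewrite lee_fin -mulrA ler_wpM2l ?(ltW c0)//.
  apply: (@le_trans _ _ (Num.sqrt X)); first by apply: ler_wsqrtr; rewrite truncn_le.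
  rewrite /X -mulrA sqrtrM ?(ltW C_gt0)// ler_wpM2l ?sqrtr_ge0//.
  rewrite -powR_mulrn ?(ltW lam0)// -powRD ?(gt_eqF lam0) ?implybT//.
  rewrite -powR12_sqrt ?powR_ge0// -powRrM.
  rewrite le_eqVlt; apply/orP; left; apply/eqP; congr (_ `^ _).
  by rewrite dkR; field.
exists (c * Num.sqrt 2); first by rewrite mulr_gt0// sqrtr_gt0.
move=> b S SG lam e lam1 eige; apply: (cP b S SG lam e 2 eige) => s us sl sa.
have dk : (d - k)%N = 1%N by lia.
have line (m : nat) (a' : 'M[rat]_(m, d)) : m = 1%N -> row_free a' ->
    {in s &, forall n n', (map_mx intr (n - n') <= a')%MS} -> (size s <= 2)%N.
  move=> m1; subst m => fa' sa'; apply: (size_sphere_line (a := a')) => //.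
    by apply/eqP => a0; move: fa'; rewrite a0 /row_free mxrank0.
  move=> n n' ns n's; split; first exact: sa'.
  by apply: (@intr_inj R); rewrite sl// sl.
exact: (line _ a dk fa sa).
Qed.
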